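(* Let $q\ge2$ be fixed and impose periodic boundary conditions. For all integers $2829\le K\le L\le M$ there exists a constant $\kappa=\kappa(K,L,M)>0$ such that for all distinct $\mathbf{s},\mathbf{s}'\in\mathcal{S}$, as $\beta\to\infty$, $$\mathbb{E}_{\mathbf{s}}^{\beta}[\tau_{\breve{\mathbf{s}}}]=(1+o_\beta(1))\,\frac{\kappa}{q-1}\,e^{\Gamma\beta}\qquad\text{and}\qquad\mathbb{E}_{\mathbf{s}}^{\beta}[\tau_{\mathbf{s}'}]=(1+o_\beta(1))\,\kappa\,e^{\Gamma\beta}.$$ Moreover, the constant $\kappa$ satisfies $$\lim_{K\to\infty}\kappa(K,L,M)=\begin{cases}1/8&\text{if }K<L<M,\\1/16&\text{if }K=L<M\text{ or }K<L=M,\\1/48&\text{if }K=L=M.\end{cases}$$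
   Context: $\mathbb{T}_N=\mathbb{Z}/N\mathbb{Z}$, $\Lambda=\mathbb{T}_K\times\mathbb{T}_L\times\mathbb{T}_M$, $S=\{1,\dots,q\}$, $\mathcal{X}=S^\Lambda$, $H(\sigma)=\sum_{\{x,y\}\subseteq\Lambda:x\sim y}\mathbf{1}\{\sigma(x)\ne\sigma(y)\}$ ($x\sim y$: nearest neighbours in the torus). $\mathbf{s}_a$ is the configuration with all spins $a$, $\mathcal{S}=\{\mathbf{s}_1,\dots,\mathbf{s}_q\}$, $\breve{\mathbf{s}}=\mathcal{S}\setminus\{\mathbf{s}\}$. $\{\sigma_\beta(t)\}_{t\ge0}$ is the continuous-time Markov chain on $\mathcal{X}$ which jumps from $\sigma$ to $\zeta$ at rate $e^{-\beta\max\{H(\zeta)-H(\sigma),0\}}$ if $\sigma,\zeta$ differ at exactly one site, and at rate $0$ otherwise; $\mathbb{E}_\sigma^\beta$ is the expectation for the process started at $\sigma$, and $\tau_{\mathcal{A}}=\inf\{t\ge0:\sigma_\beta(t)\in\mathcal{A}\}$, $\tau_\sigma=\tau_{\{\sigma\}}$. $\Gamma=2KL+2K+2$ is the energy barrier between ground states, i.e. the minimum, over sequences of single-spin updates joining two distinct ground states, of the maximal value of $H$ along the sequence. $o_\beta(1)$ denotes a quantity that tends to $0$ as $\beta\to\infty$ for each fixed $K,L,M$. The limit $K\to\infty$ is along triples $K\le L\le M$ in the indicated regime. *)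

(* Defs.v *)
From HB Require Import structures.
From mathcomp Require Import all_boot all_order all_algebra.
From mathcomp Require Import all_classical all_reals all_analysis.
Set Implicit Arguments.
Unset Strict Implicit.
Unset Printing Implicit Defensive.
Import Order.TTheory GRing.Theory Num.Theory.
Import numFieldNormedType.Exports.
Local Open Scope ring_scope.

(** * Continuous-time Markov chains on a finite state space *)

(** Transition function on [0, +oo[ of the chain which jumps from [x] to
    [y != x] at rate [r x y].  The values [r x x], and [p t] for [t < 0], play
    no role. *)
Record is_transition_function (R : realType) (V : finType) (r : V -> V -> R)
    (p : R -> V -> V -> R) : Prop := {
  trans_ge0 : forall t x y, 0 <= t -> 0 <= p t x y;
  trans_sum1 : forall t x, 0 <= t -> \sum_(y : V) p t x y = 1;
  trans_start : forall x y, p 0 x y = (x == y)%:R;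
  trans_semigroup : forall s t x y, 0 <= s -> 0 <= t ->
    p (s + t) x y = \sum_(z : V) p s x z * p t z y;
  trans_rate : forall x y, x != y ->
    (h^-1 * p h x y @[h --> 0^'+] --> r x y)%classic }.

(** [X] is the Markov chain with jump rates [r] started at [v0]: it has
    right-continuous paths (for the discrete topology on [V]), and its
    finite-dimensional distributions are given by the transition function. *)
Record is_markov_chain (R : realType) (d : measure_display)
    (Omega : measurableType d) (P : probability Omega R) (V : finType)
    (r : V -> V -> R) (v0 : V) (X : R -> Omega -> V) : Prop := {
  chain_measurable : forall t v, 0 <= t ->
    measurable [set w | X t w = v]%classic;
  chain_right_continuous : forall w t, 0 <= t ->
    (\forall u \near t^'+, X u w = X t w)%classic;
  chain_fdd : exists2 p, is_transition_function r p &
    forall (n : nat) (t : nat -> R) (x : nat -> V),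
      t 0%N = 0 -> (forall i, t i <= t i.+1) ->
      P [set w | forall i, (i <= n)%N -> X (t i) w = x i]%classic =
      ((x 0%N == v0)%:R *
       \prod_(i < n) p (t i.+1 - t i) (x i) (x i.+1))%:E }.

(** A probability space carrying the chain with rates [r] started at [v0]. *)
Record markov_chain (R : realType) (V : finType) (r : V -> V -> R) (v0 : V) :=
  MarkovChain {
    chain_display : measure_display;
    chain_space : measurableType chain_display;
    chain_prob : probability chain_space R;
    chain_path : R -> chain_space -> V;
    chainP : is_markov_chain chain_prob r v0 chain_path }.

(** The value is [+oo] on paths that never visit [A]. *)
Definition hitting_time (R : realType) (V : finType) (r : V -> V -> R) (v0 : V)
    (C : markov_chain r v0) (A : {set V}) (w : chain_space C) : \bar R :=
  ereal_inf [set t%:E | t in [set t : R | 0 <= t /\ chain_path t w \in A]]%classic.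

Definition mean_hitting_time (R : realType) (V : finType) (r : V -> V -> R)
    (v0 : V) (C : markov_chain r v0) (A : {set V}) : \bar R :=
  (\int[chain_prob C]_w hitting_time A w)%E.

(** [f b = (1 + o(1)) g b] as [b --> +oo]; in particular [f b] is eventually
    finite. *)
Definition asymptotic (R : realType) (f : R -> \bar R) (g : R -> R) : Prop :=
  exists2 o : R -> R, (o b @[b --> +oo%R] --> (0 : R))%classic &
    (\forall b \near +oo%R, f b = ((1 + o b) * g b)%:E)%classic.

(** * The Potts model on the three-dimensional torus *)

(** ['Z_N] is Z/NZ only for [N >= 2]. *)
Definition site (K L M : nat) : finType := ('Z_K * 'Z_L * 'Z_M)%type.

Definition adjacent (N : nat) (i j : 'Z_N) : bool := (j == i + 1) || (i == j + 1).

Definition neighbour (K L M : nat) (x y : site K L M) : bool :=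
  let: (x1, x2, x3) := x in let: (y1, y2, y3) := y in
  [|| [&& adjacent x1 y1, x2 == y2 & x3 == y3],
      [&& x1 == y1, adjacent x2 y2 & x3 == y3] |
      [&& x1 == y1, x2 == y2 & adjacent x3 y3]].

Definition config (q K L M : nat) : finType := {ffun site K L M -> 'I_q}.

(** The number of unordered pairs of neighbours with different spins. *)
Definition hamiltonian (q K L M : nat) (sigma : config q K L M) : nat :=
  #|[set [set e.1; e.2] | e : site K L M * site K L M &
       neighbour e.1 e.2 && (sigma e.1 != sigma e.2)]%SET|.

Definition monochromatic (q K L M : nat) (a : 'I_q) : config q K L M :=
  [ffun=> a].

Definition ground_states (q K L M : nat) : {set config q K L M} :=
  [set monochromatic K L M a | a : 'I_q]%SET.

Definition metropolis_rate (R : realType) (q K L M : nat) (beta : R)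
    (sigma zeta : config q K L M) : R :=
  if #|[set x | sigma x != zeta x]%SET| == 1%N then
    expR (- beta *
      Num.max ((hamiltonian zeta)%:R - (hamiltonian sigma)%:R) 0)
  else 0.

Definition Gamma (K L : nat) : nat := (2 * K * L + 2 * K + 2)%N.

(** [kappa K L M --> l] as [K --> oo] along the triples in [D]; the convergence
    is uniform in [L] and [M]. *)
Definition limit_along (R : realType) (D : nat -> nat -> nat -> bool)
    (kappa : nat -> nat -> nat -> R) (l : R) : Prop :=
  forall eps : R, 0 < eps ->
    (\forall K \near \oo, forall L M : nat, D K L M ->
       `|kappa K L M - l| < eps)%classic.

(* Main.v *)
Require Import Defs.
From HB Require Import structures.
From mathcomp Require Import all_boot all_order all_algebra.
From mathcomp Require Import all_classical all_reals all_analysis.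
From mathcomp Require Import perm measurable_realfun.
From mathcomp Require Import zify ring lra.
Set Implicit Arguments.
Unset Strict Implicit.
Unset Printing Implicit Defensive.
Import Order.TTheory GRing.Theory Num.Theory.
Import numFieldNormedType.Exports.
Local Open Scope nat_scope.

(** The configurations of energy at most Gamma are never classified. The test function is defined by
    cases (extreme volume, slab in one of three directions, more full than empty lines), and it only
    has to survive a change of case along a single-spin step. This comes from gaps: the integer that
    decides a case moves by at most one, and [slab_gap] and [no_tie] show that it avoids the
    threshold. Both rest on one count: energy at most Gamma allows at most K L + K + 1 nonconstant
    lines, while a layer that contains c sites and misses c sites is a strip or has at least 2 sqrt
    c nonconstant lines.

    The limit is a count of paths. For each of the q - 1 other spins there are 8 * orders * K L M
    lexicographic paths, each made of K L M unit edges. Almost every edge lies on one path only, so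
    the paths act in parallel and the form is close to 2 * 8 * orders * (q - 1), the factor 2 coming
    from ordered pairs; kappa is 2 (q - 1) divided by it. Orders of the axes matter through
    [growth_path]: growth along the second or third direction fits into Gamma only if the
    corresponding sides are equal. *)

(** By potential theory the mean exit time of a ground state [s] is
    [2 * \sum_x mu x * h x / cform h h], where [h] is the equilibrium potential.
    As [beta --> +oo] the sum tends to [1], while [expR (Gamma * beta) * cform h h]
    is squeezed by the minimum of a form that only involves the edges of height at
    most [Gamma] and is monotone in [beta]; this gives [kappa].

    The limit form is bounded below by the Cauchy-Schwarz inequality along the
    paths that fill the torus lexicographically (line by line and layer by layer),
    and above by a test function of the region of a single spin.  It depends on the
    volume only as long as the region is a slab, and it varies only at volumes where
    the region is forced to grow along a lexicographic path.  Both bounds read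
    [8 * orders * kappa = 1 + O(1/s)] for [100 s^2 <= K], where [8] counts corners
    and [orders] the orders of the axes that keep the energy at most [Gamma].

    A superposition of the exit times of all ground states solves the Dirichlet
    problem of a single target, by the symmetry between the spins. *)

(** * Lines, layers and constant lines *)

Definition bad (I : finType) (u : I -> bool) : bool :=
  [exists i, u i] && [exists i, ~~ u i].
Definition full (I : finType) (u : I -> bool) : bool := [forall i, u i].
Definition empty (I : finType) (u : I -> bool) : bool := [forall i, ~~ u i].

Definition bad_columns (I J : finType) (b : I -> J -> bool) : nat :=
  \sum_i bad (b i).
Definition bad_rows (I J : finType) (b : I -> J -> bool) : nat :=
  \sum_j bad (b ^~ j).
Definition cost (I J : finType) (b : I -> J -> bool) : nat :=
  bad_rows b + bad_columns b.
Definition area (I J : finType) (b : I -> J -> bool) : nat :=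
  \sum_i \sum_j b i j.

Lemma eq_bad (I : finType) (u v : I -> bool) : u =1 v -> bad u = bad v.
Proof. by move=> e; congr andb; apply: eq_existsb => i; rewrite e. Qed.

Lemma eq_full (I : finType) (u v : I -> bool) : u =1 v -> full u = full v.
Proof. by move=> e; apply: eq_forallb => i; rewrite e. Qed.

Lemma eq_empty (I : finType) (u v : I -> bool) : u =1 v -> empty u = empty v.
Proof. by move=> e; apply: eq_forallb => i; rewrite e. Qed.

Lemma badC (I : finType) (u : I -> bool) : bad (fun i => ~~ u i) = bad u.
Proof.
rewrite /bad andbC; congr andb; apply: eq_existsb => i; by rewrite ?negbK.
Qed.

Lemma emptyC (I : finType) (u : I -> bool) : empty (fun i => ~~ u i) = full u.
Proof. by apply: eq_forallb => i; rewrite negbK. Qed.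

Lemma bad2 (I : finType) (u : I -> bool) (i j : I) : u i -> ~~ u j -> bad u.
Proof. by move=> ui uj; apply/andP; split; apply/existsP; [exists i|exists j]. Qed.

Lemma nbad_eq (I : finType) (u : I -> bool) (i j : I) : ~~ bad u -> u i = u j.
Proof.
move=> nb; case ui : (u i); case uj : (u j) => //.
- by case/negP: nb; apply: (@bad2 _ _ i j); rewrite ?ui ?uj.
- by case/negP: nb; apply: (@bad2 _ _ j i); rewrite ?ui ?uj.
Qed.

Lemma line_trichotomy (I : finType) (u : I -> bool) : 0 < #|I| ->
  bad u + full u + empty u = 1.
Proof.
move/card_gt0P => [i0 _]; rewrite /bad /full /empty.
have -> : [exists i, ~~ u i] = ~~ [forall i, u i] by rewrite negb_forall.
have -> : [exists i, u i] = ~~ [forall i, ~~ u i].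
  by rewrite negb_forall; apply: eq_existsb => i; rewrite negbK.
case: (boolP [forall i, u i]); case: (boolP [forall i, ~~ u i]) => //.
by move=> /forallP /(_ i0) h /forallP /(_ i0) h'; rewrite h' in h.
Qed.

Lemma sum_bool_le (I : finType) (P : I -> bool) : \sum_i P i <= #|I|.
Proof. by rewrite -sum1_card; apply: leq_sum => i _; case: (P i). Qed.

Lemma sum_bool_eq_card (I : finType) (P : I -> bool) :
  #|I| <= \sum_i P i -> forall i, P i.
Proof.
move=> h i; case Pi: (P i) => //.
have : \sum_i P i < #|I|; last by rewrite ltnNge h.
rewrite -sum1_card (bigD1 i) //= [ltnRHS](bigD1 i) //= Pi add0n add1n ltnS.
by apply: leq_sum => j _; case: (P j).
Qed.

Lemma sum_bool_gt0 (I : finType) (P : I -> bool) (i : I) : P i -> 0 < \sum_i P i.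
Proof. by move=> Pi; rewrite (bigD1 i) //= Pi. Qed.

Lemma sum_bool_lt_card (I : finType) (P : I -> bool) :
  \sum_i P i < #|I| -> exists i, ~~ P i.
Proof.
move=> h; apply/existsP; rewrite -negb_forall; apply/negP => /forallP hP.
by move: h; rewrite (eq_bigr (fun=> 1)) ?sum1_card ?ltnn // => i _; rewrite hP.
Qed.

Lemma sum_bool_pos (I : finType) (P : I -> bool) : 0 < \sum_i P i -> exists i, P i.
Proof.
move=> h; apply/existsP; rewrite -[X in is_true X]negbK negb_exists; apply/negP => /forallP hP.
by move: h; rewrite big1 // => i _; rewrite (negbTE (hP i)).
Qed.

Lemma sum_boolC (I : finType) (P : I -> bool) :
  \sum_i P i + \sum_i ~~ P i = #|I|.
Proof.
rewrite -big_split /= -sum1_card; apply: eq_bigr => i _; by case: (P i).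
Qed.

Lemma sum_mul_bool (I J : finType) (P : I -> bool) (Q : J -> bool) :
  \sum_i \sum_j (P i && Q j) = (\sum_i P i) * (\sum_j Q j).
Proof.
rewrite big_distrl; apply: eq_bigr => i _; rewrite big_distrr.
by apply: eq_bigr => j _; case: (P i); case: (Q j).
Qed.

Section Layer.
Variables (I J : finType).
Implicit Type b : I -> J -> bool.

Definition layerC b : I -> J -> bool := fun i j => ~~ b i j.

Lemma bad_columnsC b : bad_columns (layerC b) = bad_columns b.
Proof. by apply: eq_bigr => i _; rewrite [bad _]badC. Qed.

Lemma bad_rowsC b : bad_rows (layerC b) = bad_rows b.
Proof. by apply: eq_bigr => i _; rewrite [bad _](badC (b ^~ i)). Qed.

Lemma costC b : cost (layerC b) = cost b.
Proof. by rewrite /cost bad_columnsC bad_rowsC. Qed.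

Lemma areaC b : area b + area (layerC b) = #|I| * #|J|.
Proof.
rewrite /area -big_split /= -sum_nat_const; apply: eq_bigr => i _.
exact: sum_boolC.
Qed.

Lemma area_le b : area b <= #|I| * #|J|.
Proof. by rewrite -(areaC b) leq_addr. Qed.

Lemma bad_columns_le b : bad_columns b <= #|I|.
Proof. exact: sum_bool_le. Qed.

Lemma bad_rows_le b : bad_rows b <= #|J|.
Proof. exact: sum_bool_le. Qed.

(* A constant row and a constant column share a site, so all of them carry the
   same value, and the other value only occurs where bad lines cross. *)
Lemma area_le_bad_product b :
  [\/ bad_rows b = #|J|, bad_columns b = #|I|,
      area b <= bad_rows b * bad_columns b |
      area (layerC b) <= bad_rows b * bad_columns b].
Proof.
have [hr|hr] := leqP #|J| (bad_rows b).
  by constructor 1; apply/eqP; rewrite eqn_leq bad_rows_le.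
have [hc|hc] := leqP #|I| (bad_columns b).
  by constructor 2; apply/eqP; rewrite eqn_leq bad_columns_le.
have [j0 hj0] := sum_bool_lt_card hr; have [i0 hi0] := sum_bool_lt_card hc.
have key i j : ~~ (bad (b i) && bad (b^~ j)) -> b i j = b i0 j0.
  rewrite negb_and => /orP[h|h].
    by rewrite (nbad_eq j j0 h) [RHS](nbad_eq i0 i hj0).
  by rewrite [LHS](nbad_eq i i0 h) (nbad_eq j j0 hi0).
rewrite mulnC /bad_rows /bad_columns -sum_mul_bool.
case e : (b i0 j0); [constructor 4|constructor 3].
all: apply: leq_sum => i _; apply: leq_sum => j _.
all: case: (boolP (bad (b i) && bad (b^~ j))) => [_|/key]; rewrite /layerC ?e.
all: by [case: (b i j)|move=> ->; rewrite ?e].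
Qed.

(** Isoperimetric inequality on the two-dimensional torus: AM-GM applied to [area_le_bad_product].
    The exceptions are the regions that wrap around the torus. *)
Lemma cost_sqr_ge b c : c <= area b -> c <= area (layerC b) ->
  [\/ bad_rows b = #|J|, bad_columns b = #|I| | 4 * c <= cost b ^ 2].
Proof.
have am : 4 * (bad_rows b * bad_columns b) <= cost b ^ 2.
  by rewrite /cost nat_AGM2.
move=> h1 h2; case: (area_le_bad_product b) => h; [constructor 1|constructor 2|constructor 3|constructor 3] => //.
all: by apply: leq_trans am; rewrite leq_mul2l /= (leq_trans _ h).
Qed.

Lemma cost_ge_double b r k : k <= #|I| -> k <= #|J| -> 2 * r <= k ->
  r ^ 2 <= area b -> r ^ 2 <= area (layerC b) -> 2 * r <= cost b.
Proof.
move=> kI kJ rk h1 h2; case: (cost_sqr_ge h1 h2) => h; rewrite /cost in h *; try lia.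
by rewrite -leq_sqr expnMn.
Qed.

(** A form of the isoperimetric inequality that is linear in the area, so that it can be summed over
    layers. From area [r ^ 2] on the cost is at least [2 * r]; below, the bound [2 sqrt area] is
    concave and lies above the chord. *)
Lemma cost_area_bound b r k : k <= #|I| -> k <= #|J| -> 2 * r <= k ->
  area b + r ^ 2 <= #|I| * #|J| -> 2 * r * area b <= cost b * (#|I| * #|J|).
Proof.
move=> kI kJ rk h; have aC := areaC b.
have [ha|ha] := leqP (r ^ 2) (area b).
  apply: leq_mul (area_le b); apply: (cost_ge_double kI kJ rk ha); lia.
have kk : k * k <= #|I| * #|J| by apply: leq_mul.
have rr : 4 * r ^ 2 <= k * k by nia.
case: (cost_sqr_ge (leqnn (area b)) (_ : area b <= area (layerC b))) => [|e|e|e].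
- lia.
- apply: leq_mul (area_le b); rewrite /cost; lia.
- apply: leq_mul (area_le b); rewrite /cost; lia.
rewrite -leq_sqr.
have -> : (2 * r * area b) ^ 2 = (4 * area b) * (r ^ 2 * area b) by lia.
rewrite expnMn; apply: leq_mul => //.
apply: (@leq_trans (#|I| * #|J| * (#|I| * #|J|))); last by rewrite -mulnn.
by apply: leq_mul; lia.
Qed.

Lemma cost_ge2 b i j i' j' : 1 < #|I| -> 1 < #|J| -> b i j -> ~~ b i' j' -> 2 <= cost b.
Proof.
move=> hI hJ h h'; apply: (@cost_ge_double b 1 2) => //.
  by rewrite /area (bigD1 i) //= (bigD1 j) //= h; lia.
by rewrite /area (bigD1 i') //= (bigD1 j') //= /layerC h'; lia.
Qed.

End Layer.


(** * Slabs *)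

Section Box.
Variables (I J T : finType).
Implicit Type a : I -> J -> T -> bool.

Definition layer a (t : T) : I -> J -> bool := fun i j => a i j t.
Definition boxC a : I -> J -> T -> bool := fun i j t => ~~ a i j t.
Definition volume a : nat := \sum_i \sum_j \sum_t a i j t.
Definition bad_verticals a : nat := \sum_i \sum_j bad (a i j).
Definition full_verticals a : nat := \sum_i \sum_j full (a i j).
Definition empty_verticals a : nat := \sum_i \sum_j empty (a i j).
Definition total_cost a : nat := \sum_t cost (layer a t).

(* Every bad line is crossed by at least two boundary edges, so twice the left
   hand side is at most the number of boundary edges. *)
Definition cheap k a : Prop :=
  bad_verticals a + total_cost a <= #|I| * #|J| + k + 1.
Definition balanced s a : bool :=
  (#|I| * #|J| * #|T| <= s * volume a) && (#|I| * #|J| * #|T| <= s * volume (boxC a)).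
(** Almost every vertical line is bad, which in a cheap region uses up nearly the whole energy. The
    threshold is a value that the count never takes, see [slab_gap]. *)
Definition slab s a : bool := full_verticals a + empty_verticals a < 2 * s ^ 2.

Definition trivial_layer (b : I -> J -> bool) : bool :=
  (area b == 0) || (area (layerC b) == 0).
Definition strip (b : I -> J -> bool) : bool :=
  (bad_rows b == #|J|) || (bad_columns b == #|I|).
(** A stack of full layers with one incomplete layer that is a strip. Only for these regions does
    the test function read off the exact volume. *)
Definition canonical k a : bool :=
  [exists t0, [&& [forall t, (t != t0) ==> trivial_layer (layer a t)],
                  cost (layer a t0) <= k + 1 & strip (layer a t0)]].
(** The volume rounded to whole layers, which is insensitive to small irregularities of the
    interface. *)
Definition height a : nat := \sum_t (#|I| * #|J| < 2 * area (layer a t)).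

Definition adds a a' (i0 : I) (j0 : J) (t0 : T) : Prop :=
  ~~ a i0 j0 t0 /\
  forall i j t, a' i j t = a i j t || [&& i == i0, j == j0 & t == t0].

Lemma volume_layers a : volume a = \sum_t area (layer a t).
Proof.
rewrite /volume (eq_bigr (fun i => \sum_t \sum_j a i j t)); last first.
  by move=> i _; rewrite exchange_big.
by rewrite exchange_big.
Qed.

Lemma volumeC a : volume a + volume (boxC a) = #|I| * #|J| * #|T|.
Proof.
rewrite !volume_layers -big_split /= mulnC -sum_nat_const.
by apply: eq_bigr => t _; rewrite areaC.
Qed.

Lemma bad_verticalsC a : bad_verticals (boxC a) = bad_verticals a.
Proof. by apply: eq_bigr => i _; apply: eq_bigr => j _; rewrite [bad _]badC. Qed.

Lemma total_costC a : total_cost (boxC a) = total_cost a.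
Proof. by apply: eq_bigr => t _; rewrite [LHS]costC. Qed.

Lemma full_verticalsC a : full_verticals (boxC a) = empty_verticals a.
Proof. by []. Qed.

Lemma empty_verticalsC a : empty_verticals (boxC a) = full_verticals a.
Proof. by apply: eq_bigr => i _; apply: eq_bigr => j _; rewrite [empty _]emptyC. Qed.

Lemma cheapC k a : cheap k a -> cheap k (boxC a).
Proof. by rewrite /cheap bad_verticalsC total_costC. Qed.

Lemma slabC s a : slab s (boxC a) = slab s a.
Proof. by rewrite /slab full_verticalsC empty_verticalsC addnC. Qed.

Lemma volumeCC a : volume (boxC (boxC a)) = volume a.
Proof.
by apply: eq_bigr => i _; apply: eq_bigr => j _; apply: eq_bigr => t _; rewrite /boxC negbK.
Qed.

Lemma balancedC s a : balanced s (boxC a) = balanced s a.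
Proof. by rewrite /balanced andbC volumeCC. Qed.

Lemma verticals_trichotomy a : 0 < #|T| ->
  bad_verticals a + full_verticals a + empty_verticals a = #|I| * #|J|.
Proof.
move=> hT; rewrite /bad_verticals /full_verticals /empty_verticals -!big_split /=.
rewrite -sum_nat_const; apply: eq_bigr => i _; rewrite -!big_split /= -sum1_card.
by apply: eq_bigr => j _; rewrite line_trichotomy.
Qed.

Lemma full_verticals_area a t : full_verticals a <= area (layer a t).
Proof.
apply: leq_sum => i _; apply: leq_sum => j _; rewrite /full /layer.
by case: (boolP [forall t, a i j t]) => // /forallP ->.
Qed.

Lemma empty_verticals_area a t : empty_verticals a <= area (layerC (layer a t)).
Proof. by rewrite -full_verticalsC; apply: full_verticals_area. Qed.

(** An empty vertical leaves a hole in every layer, so each layer misses at least [r ^ 2] sites and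
    [cost_area_bound] applies to it. The predicate allows one layer to be left out. *)
Lemma empty_verticals_cost a k r : k <= #|I| -> k <= #|J| -> 2 * r <= k ->
  r ^ 2 <= empty_verticals a -> forall P : pred T,
  2 * r * (\sum_(t | P t) area (layer a t)) <=
  (\sum_(t | P t) cost (layer a t)) * (#|I| * #|J|).
Proof.
move=> kI kJ rk re P; rewrite big_distrr big_distrl /=; apply: leq_sum => t _.
apply: (cost_area_bound kI kJ rk).
by have := areaC (layer a t); have := empty_verticals_area a t; lia.
Qed.

Lemma sqrt_floor (e : nat) : exists r, r ^ 2 <= e < r.+1 ^ 2.
Proof.
elim: e => [|e [r /andP[h1 h2]]]; first by exists 0.
have [h|h] := leqP (r.+1 ^ 2) e.+1; last by exists r; lia.
by exists r.+1; nia.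
Qed.

Lemma trivial_layerP (b : I -> J -> bool) :
  trivial_layer b -> (forall i j, b i j) \/ (forall i j, ~~ b i j).
Proof.
case/orP => /eqP h; [right|left] => i j.
  by apply/negP => h'; move: h; rewrite /area (bigD1 i) //= (bigD1 j) //= h'.
apply/negPn/negP => h'.
by move: h; rewrite /area (bigD1 i) //= (bigD1 j) //= /layerC h'.
Qed.

Lemma trivial_layer_cost (b : I -> J -> bool) : 1 < #|I| -> 1 < #|J| ->
  cost b < 2 -> trivial_layer b.
Proof.
move=> hI hJ h; apply/negPn/negP; rewrite negb_or => /andP[h1 h2].
have ex (c : I -> J -> bool) : area c != 0 -> exists i j, c i j.
  rewrite /area => hc; case: (pickP (fun p : I * J => c p.1 p.2)) => [[i j] /= e|e].
    by exists i, j.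
  move: hc; rewrite big1 // => i _; rewrite big1 // => j _.
  by rewrite -[c i j]/(c (i, j).1 (i, j).2) e.
have [i [j e]] := ex _ h1; have [i' [j' e']] := ex _ h2.
by move: h; rewrite ltnNge (cost_ge2 hI hJ e e').
Qed.

End Box.

Section SlabLemmas.
Variables (I J T : finType) (k s : nat).
Hypotheses (kI : k <= #|I|) (kJ : k <= #|J|) (kT : k <= #|T|).
Hypotheses (s5 : 5 <= s) (sk : 100 * s ^ 2 <= k).
Implicit Type a : I -> J -> T -> bool.

(** Otherwise, up to complement, [s ^ 2] verticals are empty, and balance forces a total cost of at
    least [2 * #|T|]. The budget left by the bad verticals is only [2 * s ^ 2 + k + 1], which is
    less than [2 * k]. *)
Lemma slab_gap a : cheap k a -> balanced s a ->
  full_verticals a + empty_verticals a <> 2 * s ^ 2.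
Proof.
wlog h : a / full_verticals a <= empty_verticals a => [hw|].
  have [h|h] := leqP (full_verticals a) (empty_verticals a); first exact: hw.
  move=> ch ba; rewrite -empty_verticalsC -full_verticalsC addnC.
  apply: hw; [|exact: cheapC|by rewrite balancedC].
  by rewrite empty_verticalsC full_verticalsC ltnW.
move=> ch /andP[ba _] e; have sk2 : 2 * s <= k by nia.
have hT : 0 < #|T| by nia.
have hs : s ^ 2 <= empty_verticals a by lia.
have := empty_verticals_cost kI kJ sk2 hs xpredT.
rewrite -volume_layers -/(total_cost a).
have := verticals_trichotomy a hT; move: ch ba; rewrite /cheap.
set XY := #|I| * #|J|; have XY0 : 0 < XY by rewrite muln_gt0; lia.
move=> ch ba tri hc.
have h1 : 2 * #|T| * XY <= total_cost a * XY by lia.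
rewrite leq_pmul2r // in h1; nia.
Qed.

(** With [r] the integer root of the number of empty verticals, a layer of cost [k] would leave at
    most about [2 * r ^ 2 + 4 * r + 1] for the others, whereas balance makes them cost about
    [2 * r * #|T| / s]. This is too much because [r < 2 * s] and [#|T|] is at least
    [100 * s ^ 2]. *)
Lemma slab_cost_empty a t0 : cheap k a -> balanced s a -> slab s a ->
  full_verticals a <= empty_verticals a -> 0 < empty_verticals a ->
  cost (layer a t0) < k.
Proof.
move=> ch /andP[ba _] sl fe e0; rewrite ltnNge; apply/negP => ck.
have hT : 0 < #|T| by nia.
have [r /andP[r1 r2]] := sqrt_floor (empty_verticals a).
have r0 : 0 < r by case: (r) r2 => // ; lia.
have rs : r < 2 * s by rewrite /slab in sl; nia.
have rk : 2 * r <= k by nia.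
have := verticals_trichotomy a hT; move: ch ba; rewrite /cheap.
rewrite /total_cost (bigD1 t0) //= volume_layers [\sum_t area _](bigD1 t0) //=.
have := empty_verticals_cost kI kJ rk r1 (predC1 t0) => /=.
have := area_le (layer a t0).
set XY := #|I| * #|J|; have XY0 : 0 < XY by rewrite muln_gt0; lia.
set c := \sum_(t | _) cost _; set v := \sum_(t | _) area _.
move=> al hc ch ba tri.
have c1 : c <= 2 * r ^ 2 + 4 * r + 1.
  have r3 : empty_verticals a <= r ^ 2 + 2 * r by nia.
  by lia.
have h1 : 2 * r * #|T| * XY <= (s * c + 2 * r * s) * XY.
  have := leq_mul (leqnn (2 * r)) ba; have := leq_mul (leqnn s) hc.
  have := leq_mul (leqnn (2 * r * s)) al; move: (area _) (#|T|) => A Tc; clear; lia.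
rewrite leq_pmul2r // in h1.
have := leq_mul (leqnn s) c1; have := leq_mul (leqnn (2 * r)) (leq_trans sk kT).
have := leq_mul (leqnn (2 * r * s)) (ltnW rs); have := leq_mul (leqnn (r * s)) s5.
have := leq_mul (leqnn s) r0; have : 0 < r * s by rewrite muln_gt0 r0; lia.
by lia.
Qed.

(** Without constant verticals the budget for all layers is [k + 1]. A layer of cost [k] leaves at
    most 1, and a nontrivial layer costs at least 2. *)
Lemma slab_costly_layer a t0 : cheap k a -> balanced s a -> slab s a ->
  k <= cost (layer a t0) ->
  [/\ full_verticals a + empty_verticals a = 0,
      forall t, t != t0 -> trivial_layer (layer a t) &
      cost (layer a t0) <= k + 1].
Proof.
move=> ch ba sl ck; have hT : 0 < #|T| by nia.
have D0 : full_verticals a + empty_verticals a = 0.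
  have [h|h] := leqP (full_verticals a) (empty_verticals a).
    have [e|e] := posnP (empty_verticals a); first by lia.
    by have := slab_cost_empty t0 ch ba sl h e; lia.
  have := @slab_cost_empty (boxC a) t0 (cheapC ch).
  rewrite balancedC slabC empty_verticalsC full_verticalsC [cost _]costC.
  by move=> /(_ ba sl (ltnW h) (leq_ltn_trans (leq0n _) h)); rewrite ltnNge ck.
have := verticals_trichotomy a hT; move: ch; rewrite /cheap /total_cost (bigD1 t0) //=.
move=> ch tri; split=> // [t tt0|]; last by lia.
apply: trivial_layer_cost; try nia.
by move: ch; rewrite (bigD1 t) //=; lia.
Qed.

Lemma canonical_of_strip a t0 : cheap k a -> balanced s a -> slab s a ->
  k <= cost (layer a t0) -> strip (layer a t0) -> canonical k a.
Proof.
move=> ch ba sl ck st; have [_ h1 h2] := slab_costly_layer ch ba sl ck.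
apply/existsP; exists t0; rewrite h2 st !andbT; apply/forallP => t.
by apply/implyP; apply: h1.
Qed.

Lemma strip_cost (b : I -> J -> bool) : strip b -> k <= cost b.
Proof. by rewrite /cost => /orP[/eqP -> | /eqP ->]; lia. Qed.

Lemma half_layer_canonical a t0 : cheap k a -> balanced s a -> slab s a ->
  #|I| * #|J| <= 2 * area (layer a t0) + 2 ->
  2 * area (layer a t0) <= #|I| * #|J| + 2 -> canonical k a.
Proof.
move=> ch ba sl h1 h2; have aC := areaC (layer a t0).
have kk : k * k <= #|I| * #|J| by apply: leq_mul.
have q1 : k ^ 2 <= 2 * area (layer a t0) + 2 by lia.
have q2 : k ^ 2 <= 2 * area (layerC (layer a t0)) + 2 by lia.
set c := minn (area (layer a t0)) (area (layerC (layer a t0))).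
have qc : k ^ 2 <= 2 * c + 2 by rewrite /c; lia.
have st : strip (layer a t0) \/ k + 1 < cost (layer a t0).
  case: (cost_sqr_ge (geq_minl _ _ : c <= _) (geq_minr _ _)) => [e|e|q].
  - by left; rewrite /strip e eqxx.
  - by left; rewrite /strip e eqxx orbT.
  - by right; nia.
have ck : k <= cost (layer a t0) by case: st => [/strip_cost|]; lia.
case: st => [|h]; first exact: canonical_of_strip.
by have [_ _] := slab_costly_layer ch ba sl ck; lia.
Qed.

End SlabLemmas.


(** * Single-site steps between slabs *)

(* The volumes [n] at which a slab grows by an extension of an arc inside a strip. *)
Definition steep (k s X Y Z n : nat) : bool :=
  [&& 12 * Z <= 5 * s * (n %/ (X * Y)), 12 * Z + 5 * s * (n %/ (X * Y) + 1) <= 5 * s * Z,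
      3 * k <= n %% (X * Y), n %% (X * Y) + 3 * k < X * Y,
      1 <= n %% (X * Y) %% k & n %% (X * Y) %% k + 2 <= k].
(** Normalised by its final value, this is the test function on slabs. It is flat within [3 * k] of
    a multiple of [X * Y], where a strip may appear or disappear, and at the two ends of the volume
    range. *)
Definition profile (k s X Y Z n : nat) : nat := \sum_(m < n) steep k s X Y Z m.

Section Profile.
Variables k s X Y Z : nat.
Local Notation steep := (steep k s X Y Z).
Local Notation profile := (profile k s X Y Z).

Lemma profileS n : profile n.+1 = profile n + steep n.
Proof. by rewrite /profile big_ord_recr. Qed.

Lemma profile_flat m n : m <= n -> (forall j, m <= j < n -> ~~ steep j) ->
  profile m = profile n.
Proof.
move=> /subnK <-; elim: (n - m) => [//|d IH] h.
rewrite addSn profileS -IH => [|j /andP[h1 h2]]; last by apply: h; lia.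
by rewrite (negbTE (h _ _)) ?addn0 //; lia.
Qed.

Lemma profile_flat_low i r : r <= 3 * k -> r < X * Y ->
  profile (X * Y * i + r) = profile (X * Y * i).
Proof.
move=> rk rX; apply/esym/profile_flat => [|j hj]; first lia.
have -> : j = i * (X * Y) + (j - X * Y * i) by lia.
by rewrite /steep modnMDl modn_small; lia.
Qed.

Lemma profile_flat_high i r : X * Y <= r + 3 * k -> r <= X * Y ->
  profile (X * Y * i + r) = profile (X * Y * (i + 1)).
Proof.
move=> rk rX; apply: profile_flat => [|j hj]; first lia.
have -> : j = i * (X * Y) + (j - X * Y * i) by lia.
by rewrite /steep modnMDl modn_small; lia.
Qed.

Lemma profile_low n : 0 < s -> 5 * s * n <= 12 * (X * Y * Z) -> profile n = 0.
Proof.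
move=> s0 h; rewrite -(@profile_flat 0 n) /profile ?big_ord0 // => j /andP[_ jn].
apply/negP => /and3P[h1 h2 /and3P[_ h3 _]]; have XY0 : 0 < X * Y by lia.
have := leq_mul (leqnn (X * Y)) h1; have := leq_mul (leqnn s) (leq_trunc_div j (X * Y)).
have := leq_mul (leqnn s) jn; lia.
Qed.

Lemma profile_high n : 0 < s -> n <= X * Y * Z -> 5 * s * (X * Y * Z - n) <= 12 * (X * Y * Z) ->
  profile n = profile (X * Y * Z).
Proof.
move=> s0 nN h; apply: profile_flat => // j /andP[nj jN].
apply/negP => /and3P[h1 h2 _].
have XY0 : 0 < X * Y by case: (X * Y) jN.
have := ltn_ceil j XY0; set i := j %/ _ in h1 h2 *.
move=> hj; have := leq_mul (leqnn (X * Y)) h2.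
have : s * j < s * ((i.+1) * (X * Y)) by rewrite ltn_pmul2l.
have : s * n <= s * j by rewrite leq_pmul2l.
have : s * (X * Y * Z - n) + s * n = s * (X * Y * Z) by rewrite -mulnDr subnK.
lia.
Qed.

End Profile.

(** * Strips under the change of one site *)

Section Strip.

Lemma area_rows (I J : finType) (b : I -> J -> bool) :
  area b = \sum_j \sum_i b i j.
Proof. by rewrite /area exchange_big. Qed.

Lemma sum_bool_two (I : finType) (P : I -> bool) (j0 : I) :
  1 < \sum_j P j -> exists2 j, j != j0 & P j.
Proof.
rewrite (bigD1 j0) //= => h.
have : 0 < \sum_(i | i != j0) P i by case: (P j0) h => /=; lia.
rewrite lt0n sum_nat_eq0 negb_forall => /existsP[j]; rewrite negb_imply => /andP[h1 h2].
by exists j => //; case: (P j) h2.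
Qed.

Lemma area_le_full_rows (I J : finType) (b : I -> J -> bool) :
  area b <= #|I| * (\sum_j full (b ^~ j) + bad_rows b).
Proof.
rewrite area_rows /bad_rows -big_split /= big_distrr /=; apply: leq_sum => j _.
have [I0|I0] := posnP #|I|.
  by have := sum_bool_le (b ^~ j); rewrite I0 mul0n.
have := line_trichotomy (b ^~ j) I0; case e : (empty _) => h.
  by rewrite big1 // => i _; move/forallP/(_ i): e => /negbTE ->.
have -> : full (b ^~ j) + bad (b ^~ j) = 1 by lia.
by rewrite muln1 (sum_bool_le (b ^~ j)).
Qed.

(** The bad columns use up the cost, so at most one row is bad. An area of [3 * k] then needs two
    full rows, and one of them differs from the row [j0] of the changed site. *)
Lemma two_full_rows (I J : finType) (b : I -> J -> bool) (k : nat) (j0 : J) :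
  2 < k -> k <= #|I| -> cost b <= k + 1 -> bad_columns b = #|I| ->
  3 * k <= area b -> exists2 j, j != j0 & full (b ^~ j).
Proof.
move=> k2 kI cb bI ab; apply: sum_bool_two.
set F := \sum_j _; rewrite ltnNge; apply/negP => F1.
have := area_le_full_rows b; rewrite -/F => hF.
by rewrite /cost in cb; nia.
Qed.

(** A full and an empty row, both different from [j0], survive the change and keep every column
    bad. *)
Lemma strip_perturb_columns (I J : finType) (b b' : I -> J -> bool) (k : nat)
    (i0 : I) (j0 : J) :
  2 < k -> k <= #|I| -> cost b <= k + 1 ->
  (forall i j, (i, j) != (i0, j0) -> b' i j = b i j) ->
  3 * k <= area b -> area b + 3 * k <= #|I| * #|J| -> bad_columns b = #|I| ->
  bad_columns b' = #|I|.
Proof.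
move=> k2 kI cb bb' h1 h2 bI.
have [j jj /forallP fj] := two_full_rows j0 k2 kI cb bI h1.
have [|||j' jj' /forallP ej] := @two_full_rows _ _ (layerC b) _ j0 k2 kI.
- by rewrite costC.
- by rewrite bad_columnsC.
- by have := areaC b; lia.
rewrite /bad_columns (eq_bigr (fun=> 1)) ?sum1_card // => i _.
rewrite (@bad2 _ (b' i) j j') //; rewrite bb' ?xpair_eqE ?(negbTE jj) ?(negbTE jj') ?andbF //.
exact: ej.
Qed.

Lemma strip_perturb (I J : finType) (b b' : I -> J -> bool) (k : nat)
    (i0 : I) (j0 : J) :
  2 < k -> k <= #|I| -> k <= #|J| -> cost b <= k + 1 ->
  (forall i j, (i, j) != (i0, j0) -> b' i j = b i j) ->
  3 * k <= area b -> area b + 3 * k <= #|I| * #|J| -> strip b -> strip b'.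
Proof.
move=> k2 kI kJ cb bb' h1 h2 /orP[/eqP e|/eqP e]; apply/orP; [left|right].
  apply/eqP; apply: (@strip_perturb_columns J I (fun j i => b i j) (fun j i => b' i j) k j0 i0) => //.
  - by move: cb; rewrite /cost addnC.
  - by move=> j i h; apply: bb'; rewrite xpair_eqE andbC -xpair_eqE.
  - by rewrite area_rows; exact: h1.
  - by rewrite area_rows [X in _ <= X]mulnC; exact: h2.
by apply/eqP; apply: (strip_perturb_columns k2 kI cb bb').
Qed.

End Strip.

Section Steps.
Variables (I J T : finType) (k s : nat).
Hypotheses (kI : k <= #|I|) (kJ : k <= #|J|) (kT : k <= #|T|).
Hypotheses (s5 : 5 <= s) (sk : 100 * s ^ 2 <= k).
Implicit Type a : I -> J -> T -> bool.

Local Notation steep := (steep k s #|I| #|J| #|T|).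
Local Notation profile := (profile k s #|I| #|J| #|T|).

(** Two readings of the same profile, by volume and by height; [canonical_boundary] shows that they
    agree where one replaces the other. *)
Definition slab_value a : nat :=
  if canonical k a then profile (volume a) else profile (#|I| * #|J| * height a).

Lemma adds_same a a' i0 j0 t0 : adds a a' i0 j0 t0 ->
  forall i j t, (i, j, t) != (i0, j0, t0) -> a' i j t = a i j t.
Proof.
by move=> [_ h] i j t; rewrite h !xpair_eqE -andbA => /negbTE ->; rewrite orbF.
Qed.

Lemma adds_area a a' i0 j0 t0 t : adds a a' i0 j0 t0 ->
  area (layer a' t) = area (layer a t) + (t == t0).
Proof.
move=> [n0 h]; have -> : (t == t0 : nat) = \sum_i \sum_j ((i == i0) && ((j == j0) && (t == t0))).
  rewrite (sum_mul_bool (pred1 i0) (fun j => (j == j0) && (t == t0))).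
  rewrite (bigD1 i0) //= eqxx big1 ?addn0 ?mul1n => [|i /negbTE ->] //.
  by rewrite (bigD1 j0) //= eqxx big1 ?addn0 => [|j /negbTE ->] //.
rewrite /area -big_split /=; apply: eq_bigr => i _; rewrite -big_split /=.
apply: eq_bigr => j _; rewrite /layer h.
case: eqP => [->|_]; last by rewrite orbF addn0.
case: eqP => [->|_]; last by rewrite orbF addn0.
case: eqP => [->|_]; last by rewrite orbF addn0.
by rewrite (negbTE n0).
Qed.

Lemma adds_volume a a' i0 j0 t0 : adds a a' i0 j0 t0 -> volume a' = volume a + 1.
Proof.
move=> h; rewrite !volume_layers (eq_bigr _ (fun t _ => adds_area t h)) big_split /=.
by rewrite [X in _ + X](bigD1 t0) //= eqxx [X in _ + (_ + X)]big1 // => t /negbTE ->.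
Qed.

Lemma adds_height a a' i0 j0 t0 : adds a a' i0 j0 t0 ->
  height a = height a' \/
  2 * area (layer a t0) <= #|I| * #|J| < 2 * area (layer a' t0).
Proof.
move=> h; case: (leqP (2 * area (layer a t0)) (#|I| * #|J|)) => h1.
  case: (ltnP (#|I| * #|J|) (2 * area (layer a' t0))) => h2; [by right|left].
  apply: eq_bigr => t _; rewrite (adds_area t h); case: eqP => [e|]; last by rewrite addn0.
  by rewrite e; move: h2; rewrite (adds_area t0 h) eqxx; lia.
left; apply: eq_bigr => t _; rewrite (adds_area t h); case: eqP => [->|]; last by rewrite addn0.
by lia.
Qed.

Lemma strip_area (b : I -> J -> bool) : strip b -> 0 < area b < #|I| * #|J|.
Proof.
move=> st; have kk : 0 < k by nia.
have h : forall c : I -> J -> bool, strip c -> 0 < area c.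
  move=> c /orP[/eqP e|/eqP e].
    have /card_gt0P[j0 _] : 0 < #|J| by lia.
    have := @sum_bool_eq_card _ (fun j => bad (c ^~ j)).
    rewrite -e leqnn => /(_ isT j0) /andP[/existsP[i ci] _].
    by rewrite /area (bigD1 i) //= (bigD1 j0) //= ci.
  have /card_gt0P[i0 _] : 0 < #|I| by lia.
  have := @sum_bool_eq_card _ (fun i => bad (c i)).
  rewrite -e leqnn => /(_ isT i0) /andP[/existsP[j ci] _].
  by rewrite /area (bigD1 i0) //= (bigD1 j) //= ci.
have := h _ st; have := h (layerC b); rewrite /strip bad_rowsC bad_columnsC => /(_ st).
by have := areaC b; lia.
Qed.

Lemma canonical_decomposition a : canonical k a -> exists t1 i,
  [/\ strip (layer a t1), cost (layer a t1) <= k + 1,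
      volume a = #|I| * #|J| * i + area (layer a t1),
      height a = i + (#|I| * #|J| < 2 * area (layer a t1)) &
      i = \sum_(t | t != t1) (area (layer a t) != 0)].
Proof.
case/existsP => t1 /and3P[/forallP tr c st].
exists t1, (\sum_(t | t != t1) (area (layer a t) != 0)).
have /andP[XY0 _] := strip_area st; have aXY := area_le (layer a t1).
have full t : t != t1 -> area (layer a t) = #|I| * #|J| * (area (layer a t) != 0).
  move=> tt; move: (tr t); rewrite tt /= => /orP[/eqP -> //|]; first by rewrite muln0.
  move=> /eqP e; have := areaC (layer a t); rewrite e addn0 => ->.
  by rewrite -lt0n (leq_trans XY0 aXY) muln1.
split=> //.
  rewrite volume_layers (bigD1 t1) //= addnC; congr addn.
  by rewrite big_distrr; apply: eq_bigr => t /full.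
rewrite /height (bigD1 t1) //= addnC; congr addn; apply: eq_bigr => t /full ->.
have p : 0 < #|I| * #|J| := leq_trans XY0 aXY.
by case: (area _ != 0); [rewrite muln1 ltn_Pmull -?lt0n ?p|rewrite !muln0].
Qed.

(** Leaving the canonical regions means destroying the strip. By [strip_perturb] this only happens
    when the layer has fewer than [3 * k] sites or misses fewer than [3 * k], where the profile is
    flat. *)
Lemma canonical_boundary a a' i0 j0 t0 :
  (forall i j t, (i, j, t) != (i0, j0, t0) -> a' i j t = a i j t) ->
  canonical k a -> ~~ canonical k a' -> cheap k a' -> balanced s a' -> slab s a' ->
  profile (volume a) = profile (#|I| * #|J| * height a).
Proof.
move=> same ca nca' ch ba sl.
have [t1 [i [st c hv hh _]]] := canonical_decomposition ca.
have k2 : 2 < k by nia.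
have kk : k * k <= #|I| * #|J| by apply: leq_mul.
have not_strip : ~~ strip (layer a' t1).
  apply/negP => st'; move/negP: nca'; apply.
  exact: (canonical_of_strip kI kJ kT s5 sk ch ba sl (strip_cost kI kJ kT s5 sk st') st').
have : 3 * k <= area (layer a t1) -> #|I| * #|J| < area (layer a t1) + 3 * k.
  move=> h1; rewrite ltnNge; apply/negP => h2; case/negP: not_strip.
  apply: (strip_perturb (b := layer a t1) (i0 := i0) (j0 := j0) k2 kI kJ c) => // u v h.
  by apply: same; rewrite xpair_eqE negb_and h.
have /andP[_ aXY] := strip_area st.
rewrite hv hh => h; have [h1|h1] := ltnP (area (layer a t1)) (3 * k).
  by rewrite profile_flat_low ?(ltnW h1) //; congr profile; congr muln; nia.
have h2 := h h1; rewrite profile_flat_high ?(ltnW aXY) //; last by lia.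
by congr profile; congr muln; nia.
Qed.

Lemma slab_step a a' i0 j0 t0 : adds a a' i0 j0 t0 ->
  cheap k a -> balanced s a -> slab s a ->
  cheap k a' -> balanced s a' -> slab s a' ->
  slab_value a = slab_value a' \/
  [/\ canonical k a, canonical k a' & steep (volume a)].
Proof.
move=> ad ch ba sl ch' ba' sl'; have same := adds_same ad.
have e := adds_area t0 ad; rewrite eqxx in e.
have hh : ~~ canonical k a || ~~ canonical k a' -> height a = height a'.
  move=> nc; case: (adds_height ad) => // /andP[h1 h2].
  case/orP: nc => /negP[].
    by apply: (half_layer_canonical kI kJ kT s5 sk ch ba sl (t0 := t0)); lia.
  by apply: (half_layer_canonical kI kJ kT s5 sk ch' ba' sl' (t0 := t0)); lia.
rewrite /slab_value; case: (boolP (canonical k a)) (hh) => ca; case: (boolP (canonical k a')) => ca' /= hh'.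
- rewrite (adds_volume ad) addn1 profileS; case: (boolP (steep _)) => st; [by right|left].
  by rewrite addn0.
- by left; rewrite -hh' //; apply: canonical_boundary same _ _ _ _ _.
- left; rewrite hh' //; apply/esym/(@canonical_boundary a' a i0 j0 t0) => // i j t h.
  by rewrite same.
- by left; rewrite hh'.
Qed.

Lemma height_volume a : #|I| * #|J| * height a <= 2 * volume a.
Proof.
rewrite volume_layers /height !big_distrr; apply: leq_sum => t _ /=.
by case: ltnP => h; lia.
Qed.

Lemma height_volumeC a :
  #|I| * #|J| * (#|T| - height a) <= 2 * volume (boxC a) /\ height a <= #|T|.
Proof.
have hT : height a <= #|T| by apply: (sum_bool_le (fun t => _ < 2 * area (layer a t))).
split=> //; rewrite mulnBr leq_subLR volume_layers big_distrr /= /height.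
rewrite [X in X <= _]mulnC -sum_nat_const big_distrr -big_split; apply: leq_sum => t _ /=.
rewrite -[area (layer (boxC a) t)]/(area (layerC (layer a t))).
by have := areaC (layer a t); case: ltnP => h /=; rewrite ?muln0 ?muln1; lia.
Qed.

(** The height may double the volume, which is why [profile_low] reaches [12 / 5] times [N / s],
    where [N] is the number of sites: the excess over 2 absorbs the extra [s], as [5 * s <= N]. *)
Lemma slab_value_low a : s * volume a <= #|I| * #|J| * #|T| + s -> 0 < #|T| ->
  slab_value a = 0.
Proof.
move=> h hT; have sXY : 5 * s <= #|I| * #|J| * #|T|.
  by apply: (@leq_trans (k * k * k)); [nia|rewrite !leq_mul].
rewrite /slab_value; case: ifP => _; apply: profile_low; try lia.
have := leq_mul (leqnn s) (height_volume a); lia.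
Qed.

Lemma slab_value_high a : s * volume (boxC a) <= #|I| * #|J| * #|T| + s -> 0 < #|T| ->
  slab_value a = profile (#|I| * #|J| * #|T|).
Proof.
move=> h hT; have sXY : 5 * s <= #|I| * #|J| * #|T|.
  by apply: (@leq_trans (k * k * k)); [nia|rewrite !leq_mul].
have vC := volumeC a; rewrite /slab_value; case: ifP => _; apply: profile_high; try by lia.
- by have [_ h2] := height_volumeC a; apply: leq_mul.
- rewrite -mulnBr; have [h1 _] := height_volumeC a.
  have := leq_mul (leqnn s) h1; lia.
Qed.

End Steps.


(** * Shapes that are not slabs in any direction *)

Section Views.
Variables (I J T : finType).
Implicit Type a : I -> J -> T -> bool.

Definition view1 a : J -> T -> I -> bool := fun j t i => a i j t.
Definition view2 a : I -> T -> J -> bool := fun i t j => a i j t.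

Lemma total_cost_views a :
  total_cost a = bad_verticals (view1 a) + bad_verticals (view2 a).
Proof.
rewrite /total_cost /bad_verticals (exchange_big _ _ _ _ _ (fun j t => _ (bad (view1 a j t)))).
by rewrite [X in _ + X]exchange_big -big_split.
Qed.

Lemma total_cost_view2 a :
  total_cost (view2 a) = bad_verticals (view1 a) + bad_verticals a.
Proof. by rewrite /total_cost /bad_verticals [X in _ + X]exchange_big -big_split. Qed.

Lemma total_cost_view1 a :
  total_cost (view1 a) = bad_verticals (view2 a) + bad_verticals a.
Proof. by rewrite /total_cost /bad_verticals -big_split. Qed.

Lemma volume_view1 a : volume (view1 a) = volume a.
Proof.
rewrite /volume exchange_big /= [RHS]exchange_big /= exchange_big /=.
by apply: eq_bigr => j _; rewrite exchange_big.
Qed.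

Lemma volume_view2 a : volume (view2 a) = volume a.
Proof. by rewrite /volume; apply: eq_bigr => i _; rewrite exchange_big. Qed.

End Views.

(** One of the two kinds of constant verticals has at least [s ^ 2] members; [empty_verticals_cost]
    applies to the region or to its complement. *)
Lemma slabN_cost (I J T : finType) (k s : nat) (a : I -> J -> T -> bool) :
  k <= #|I| -> k <= #|J| -> 2 * s <= k -> ~~ slab s a ->
  2 * s * minn (volume a) (volume (boxC a)) <= total_cost a * (#|I| * #|J|).
Proof.
move=> kI kJ sk; rewrite -leqNgt => h.
have [h1|h1] := leqP (s ^ 2) (empty_verticals a).
  have := empty_verticals_cost kI kJ sk h1 xpredT; rewrite -volume_layers.
  by apply: leq_trans; rewrite leq_mul2l geq_minl orbT.
have h2 : s ^ 2 <= empty_verticals (boxC a) by rewrite empty_verticalsC; lia.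
have := empty_verticals_cost kI kJ sk h2 xpredT.
rewrite -volume_layers -/(total_cost _) total_costC.
by apply: leq_trans; rewrite leq_mul2l geq_minr orbT.
Qed.

Section NotSlab.
Variables (I J T : finType) (s : nat).
Hypotheses (IJ : #|I| <= #|J|) (JT : #|J| <= #|T|).
Hypotheses (s5 : 5 <= s) (sK : 100 * s ^ 2 <= #|I|).
Implicit Type a : I -> J -> T -> bool.
Local Notation K := #|I|.
Local Notation L := #|J|.
Local Notation M := #|T|.

Let K2500 : 2500 <= K.
Proof. by apply: leq_trans sK; rewrite (@leq_mul 100 25) // (@leq_sqr 5). Qed.

Let s2K : 2 * s <= K.
Proof. by apply: leq_trans sK; rewrite -mulnn; nia. Qed.

Let slabN a : ~~ slab s a -> 2 * s ^ 2 <= full_verticals a + empty_verticals a.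
Proof. by rewrite /slab -leqNgt. Qed.

Lemma strip_cost_ge (b : I -> J -> bool) : strip b -> K <= cost b.
Proof. by rewrite /cost => /orP[/eqP -> | /eqP ->]; lia. Qed.

Lemma cost_sqr_strip (b : I -> J -> bool) c :
  c <= area b -> c <= area (layerC b) -> strip b \/ 4 * c <= cost b ^ 2.
Proof.
by move=> h1 h2; case: (cost_sqr_ge h1 h2) => h; [left|left|right]; rewrite // /strip h eqxx ?orbT.
Qed.

(** Every layer contains and misses at least [c] sites. If [4 * c] exceeds [K ^ 2], isoperimetry
    suffices. Otherwise all [M] layers cost at least [2 * r] with [r] the root of [c], and
    [2 * r * M] exceeds the budget [2 * c + K + 1]. *)
Lemma tie_layer_cost a c t : cheap K a ->
  full_verticals a = c -> empty_verticals a = c -> s ^ 2 <= c -> K <= cost (layer a t).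
Proof.
move=> ch fc ec sc; have M0 : 0 < M by lia.
have ge1 u : c <= area (layer a u) by rewrite -fc full_verticals_area.
have ge2 u : c <= area (layerC (layer a u)) by rewrite -ec empty_verticals_area.
have [h|h] := ltnP (K ^ 2) (4 * c).
  case: (cost_sqr_strip (ge1 t) (ge2 t)) => [/strip_cost_ge //|h'].
  by rewrite -leq_sqr (leq_trans (ltnW h)).
have [r /andP[r1 r2]] := sqrt_floor c.
have rK : 2 * r <= K by rewrite -leq_sqr expnMn; apply: leq_trans h; rewrite leq_mul2l.
have rs : s <= r by rewrite -ltnS -ltn_sqr (leq_ltn_trans sc).
have hM : 2 * r * M <= total_cost a.
  rewrite mulnC -sum_nat_const; apply: leq_sum => u _.
  by apply: (cost_ge_double (leqnn K) IJ rK); [have := ge1 u|have := ge2 u]; lia.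
have := verticals_trichotomy a M0; move: ch; rewrite /cheap fc ec => ch tri.
have : 2 * r * M <= 2 * r ^ 2 + 4 * r + K + 1.
  have : c <= r ^ 2 + 2 * r by move: r2; clear; nia.
  by move: hM ch tri; clear; lia.
have : 2 * r * K <= 2 * r * M by rewrite leq_mul2l (leq_trans IJ JT) orbT.
have : r * (2 * r) <= r * K by rewrite leq_mul2l rK orbT.
have : 5 * (K - 4) <= r * (K - 4) by rewrite leq_mul2r (leq_trans s5 rs) orbT.
have : r * (K - 4) = r * K - 4 * r by rewrite mulnBr (mulnC r 4).
move: K2500; clear; lia.
Qed.

Section Tie.
Variables (a : I -> J -> T -> bool) (c : nat).
Hypotheses (ch : cheap K a) (fc : full_verticals a = c) (ec : empty_verticals a = c).
Hypothesis sc : s ^ 2 <= c.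

Let x t := cost (layer a t) - K.

(** The minimal cost [K * M] of the layers already covers the term [K * L] of the budget. In
    particular few verticals are bad, and [2 * c] is close to [K * L]. *)
Lemma tie_excess : \sum_t x t + bad_verticals a <= K + 1.
Proof.
have : \sum_t x t + K * M = total_cost a.
  rewrite [K * M]mulnC -sum_nat_const -big_split; apply: eq_bigr => t _ /=.
  by rewrite subnK // (tie_layer_cost t ch fc ec sc).
have : K * L <= K * M by rewrite leq_mul2l JT orbT.
by move: ch; rewrite /cheap; clear; lia.
Qed.

Let c2 : K * L <= 2 * c + K + 1.
Proof.
have M0 : 0 < M by lia.
have := verticals_trichotomy a M0; rewrite fc ec; have := tie_excess; clear; lia.
Qed.

(** The threshold is such that four heavy layers exceed the total excess [K + 1], while a light
    layer costs less than [1.3 * K], below the isoperimetric value [sqrt 2 * K] of a half-full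
    layer. *)
Definition heavy t : bool := 3 * K <= 10 * x t.

Lemma tie_heavy : \sum_t heavy t <= 3.
Proof.
rewrite leqNgt; apply/negP => h.
have : 3 * K * (\sum_t heavy t) <= 10 * \sum_t x t.
  rewrite !big_distrr; apply: leq_sum => t _ /=.
  by case: (boolP (heavy t)) => h' /=; rewrite ?muln0 // muln1.
have : 3 * K * 4 <= 3 * K * (\sum_t heavy t) by rewrite leq_mul2l h orbT.
have := tie_excess; move: K2500; clear; lia.
Qed.

Lemma tie_light t : ~~ heavy t ->
  (bad_columns (layer a t) = K /\ 10 * bad_rows (layer a t) < 3 * K) \/
  [/\ bad_rows (layer a t) = L, 10 * bad_columns (layer a t) < 3 * K &
      L - K <= x t].
Proof.
rewrite /heavy -ltnNge /x; have := tie_layer_cost t ch fc ec sc => h1 h2.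
have ge1 : c <= area (layer a t) by rewrite -fc full_verticals_area.
have ge2 : c <= area (layerC (layer a t)) by rewrite -ec empty_verticals_area.
case: (cost_sqr_strip ge1 ge2) => [/orP[/eqP e|/eqP e]|h].
- by right; move: h1 h2; rewrite /cost e => h1 h2; split=> //; move: h1 h2 IJ; clear; lia.
- by left; move: h1 h2; rewrite /cost e => h1 h2; split=> //; move: h1 h2; clear; lia.
exfalso; have q : 10 * cost (layer a t) < 13 * K by move: h1 h2; clear; lia.
rewrite -ltn_sqr !expnMn in q.
have : K * K <= K * L by rewrite leq_mul2l IJ orbT.
have : 2500 * K <= K * K by rewrite leq_mul2r K2500 orbT.
move: q h c2 K2500; rewrite -!mulnn; move: (cost _ * _) => z; clear; lia.
Qed.

(** Two light layers cannot be strips of different orientation: at least [L / 10] full rows of one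
    cross at least [K / 10] empty columns of the other, and every crossing is a bad vertical. *)
Lemma tie_type t t' : ~~ heavy t -> ~~ heavy t' ->
  bad_columns (layer a t) = K -> 10 * bad_rows (layer a t) < 3 * K ->
  bad_rows (layer a t') = L -> 10 * bad_columns (layer a t') < 3 * K -> False.
Proof.
move=> _ _ _ h1 _ h2.
have ge1 : c <= area (layer a t) by rewrite -fc full_verticals_area.
have ge2 : c <= area (layerC (layer a t')) by rewrite -ec empty_verticals_area.
set al := \sum_j full (layer a t ^~ j).
set ga := \sum_i full (layerC (layer a t') i).
have q1 : area (layer a t) <= K * (al + bad_rows (layer a t)) := area_le_full_rows _.
have q2 : area (layerC (layer a t')) <= L * (ga + bad_columns (layer a t')).
  rewrite -bad_columnsC area_rows.
  exact: (@area_le_full_rows J I (fun j i => layerC (layer a t') i j)).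
have : ga * al <= bad_verticals a.
  rewrite -sum_mul_bool; apply: leq_sum => i _; apply: leq_sum => j _.
  case: (boolP (_ && _)) => // /andP[/forallP h /forallP h'].
  by rewrite (@bad2 _ (a i j) t t') //; [exact: h'|exact: h].
have hb := tie_excess => hga.
have KL : K * K <= K * L by rewrite leq_mul2l IJ orbT.
have K0 : 0 < K by lia.
have L0 : 0 < L by lia.
have K25 : 2500 * K <= K * L by rewrite mulnC leq_mul2l (leq_trans K2500 IJ) orbT.
have b1 : K * (10 * bad_rows (layer a t)) <= K * (3 * K) by rewrite leq_mul2l ltnW ?orbT.
have b2 : L * (10 * bad_columns (layer a t')) <= L * (3 * K) by rewrite leq_mul2l ltnW ?orbT.
have a1 : L <= 10 * al.
  rewrite -(leq_pmul2l K0); move: q1 ge1 c2 b1 KL K25 K2500; clear; lia.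
have a2 : K <= 10 * ga.
  rewrite -(leq_pmul2l L0); move: q2 ge2 c2 b2 KL K25 K2500; clear; lia.
have := leq_mul a2 a1; move: hga hb K25 K2500; clear; lia.
Qed.

Let half : K * L * M <= (2 * minn (volume a) (volume (boxC a)) + (K + 1) * M).
Proof.
have h1 : c * M <= volume a.
  by rewrite volume_layers mulnC -sum_nat_const leq_sum // => t _; rewrite -fc full_verticals_area.
have h2 : c * M <= volume (boxC a).
  by rewrite volume_layers mulnC -sum_nat_const leq_sum // => t _; rewrite -ec empty_verticals_area.
have := leq_mul c2 (leqnn M); rewrite -[X in X <= _]/(K * L * M).
move: h1 h2; case: leqP => h; clear -h; lia.
Qed.

Let light_count : M <= \sum_t ~~ heavy t + 3.
Proof. by have := sum_boolC heavy; have := tie_heavy; clear; lia. Qed.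

(** All light layers are strips of one orientation, so nearly all lines of one direction are bad and
    the other two directions have a budget of about [4 * K]. If the region were not a slab in that
    direction, [slabN_cost] with [s >= 5] and a volume of about one half would require at least
    about [5 * K]. *)
Lemma tie_slab : slab s (view1 a) || slab s (view2 a).
Proof.
have vC1 : volume (boxC (view1 a)) = volume (boxC a) by exact: (volume_view1 (boxC a)).
have vC2 : volume (boxC (view2 a)) = volume (boxC a) by exact: (volume_view2 (boxC a)).
have KM : K <= M := leq_trans IJ JT.
move: (ch); rewrite /cheap total_cost_views => budget.
have KL25 : 2500 * K <= K * L by rewrite mulnC leq_mul2l (leq_trans K2500 IJ) orbT.
have KLM : K * L <= K * M by rewrite leq_mul2l JT orbT.
have s5min : 10 * minn (volume a) (volume (boxC a)) <= 2 * s * minn (volume a) (volume (boxC a)).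
  by rewrite leq_mul2r; apply/orP; right; move: s5; clear; lia.
have hf := half.
case: (pickP (fun t => ~~ heavy t && (bad_rows (layer a t) == L) && (10 * bad_columns (layer a t) < 3 * K))) => [t' /andP[/andP[l' /eqP e'] h']|no].
  apply/orP; left; apply/negPn/negP => nsl.
  have LK : L <= K + 1.
    have : (L - K) * (M - 3) <= \sum_t x t.
      apply: (@leq_trans ((L - K) * \sum_t ~~ heavy t)).
        by rewrite leq_mul2l leq_subLR addnC light_count orbT.
      rewrite big_distrr; apply: leq_sum => t _ /=; case: (boolP (heavy t)) => hv /=; rewrite ?muln0 // muln1.
      by case: (tie_light hv) => [[e h]|[]] //; case: (tie_type hv l' e h e' h').
    have := tie_excess => q1 q2; rewrite leqNgt; apply/negP => q3.
    have : 2 * (M - 3) <= (L - K) * (M - 3) by rewrite leq_mul2r; apply/orP; right; move: q3; clear; lia.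
    by move: q1 q2 KM K2500; clear; lia.
  have B1 : L * M <= bad_verticals (view1 a) + 3 * L.
    have : L * \sum_t ~~ heavy t <= bad_verticals (view1 a).
      rewrite /bad_verticals exchange_big big_distrr; apply: leq_sum => t _ /=.
      case: (boolP (heavy t)) => hv /=; rewrite ?muln0 // muln1.
      by case: (tie_light hv) => [[e h]|[<-]] //; case: (tie_type hv l' e h e' h').
    by have := leq_mul (leqnn L) light_count; clear; lia.
  have := slabN_cost IJ KM s2K nsl; rewrite vC1 volume_view1 total_cost_view1 => q.
  have tc : bad_verticals (view2 a) + bad_verticals a <= K + 1 + 3 * L.
    have : L * K <= L * M by rewrite leq_mul2l KM orbT.
    by move: budget B1; clear; lia.
  have : 10 * minn (volume a) (volume (boxC a)) <= (K + 1 + 3 * L) * (L * M).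
    by apply: leq_trans s5min (leq_trans q _); rewrite leq_mul2r tc orbT.
  have : (K + 1 + 3 * L) * (L * M) <= (4 * K + 4) * (L * M).
    by rewrite leq_mul2r; apply/orP; right; move: LK; clear; lia.
  have M0 : 0 < M by move: KM K2500; clear; lia.
  have : (5 * (K * L)) * M <= ((4 * K + 4) * L + 5 * (K + 1)) * M -> False.
    rewrite leq_pmul2r // => z; have : 2500 * L <= K * L by rewrite leq_mul2r K2500 orbT.
    by move: z IJ K2500; clear; lia.
  by move: hf; clear; lia.
apply/orP; right; apply/negPn/negP => nsl.
have B2 : K * M <= bad_verticals (view2 a) + 3 * K.
  have : K * \sum_t ~~ heavy t <= bad_verticals (view2 a).
    rewrite /bad_verticals exchange_big big_distrr; apply: leq_sum => t _ /=.
    case: (boolP (heavy t)) => hv /=; rewrite ?muln0 // muln1.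
    case: (tie_light hv) => [[<- h]|[e h _]] //.
    by have := no t; rewrite hv e eqxx h.
  by have := leq_mul (leqnn K) light_count; clear; lia.
have := slabN_cost (leqnn K) KM s2K nsl; rewrite vC2 volume_view2 total_cost_view2 => q.
have tc : bad_verticals (view1 a) + bad_verticals a <= 4 * K + 1.
  by move: budget B2 KLM; clear; lia.
have : 10 * minn (volume a) (volume (boxC a)) <= (4 * K + 1) * (K * M).
  by apply: leq_trans s5min (leq_trans q _); rewrite leq_mul2r tc orbT.
have M0 : 0 < M by move: KM K2500; clear; lia.
have : (5 * (K * L)) * M <= ((4 * K + 1) * K + 5 * (K + 1)) * M -> False.
  rewrite leq_pmul2r // => z; have : 2500 * K <= K * K by rewrite leq_mul2r K2500 orbT.
  have : K * K <= K * L by rewrite leq_mul2l IJ orbT.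
  by move: z K2500; clear; lia.
by move: hf; clear; lia.
Qed.

End Tie.

Lemma no_tie a : cheap K a -> ~~ slab s a -> ~~ slab s (view1 a) -> ~~ slab s (view2 a) ->
  full_verticals a <> empty_verticals a.
Proof.
move=> ch n3 n1 n2 e.
have sc : s ^ 2 <= empty_verticals a by have := slabN n3; rewrite e; clear; lia.
by have := tie_slab ch e (erefl _) sc; rewrite (negbTE n1) (negbTE n2).
Qed.

(** If the full verticals prevailed, every layer would contain [f >= s ^ 2] sites. The small volume
    leaves at most a third of the layers nearly full; all others also miss [f] sites, and their
    costs exceed the budget. *)
Lemma low_volume_lines a : cheap K a -> ~~ slab s a ->
  s * volume a <= K * L * M + s -> full_verticals a < empty_verticals a.
Proof.
move=> ch n3 vol; rewrite ltnNge; apply/negP => ef; set f := full_verticals a in ef *.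
have KM : K <= M := leq_trans IJ JT; have M0 : 0 < M by move: KM K2500; clear; lia.
have fs : s ^ 2 <= f by have := slabN n3; rewrite -/f; move: ef; clear; lia.
have ge1 t : f <= area (layer a t) by exact: full_verticals_area.
have KL25 : 2500 * K <= K * L by rewrite mulnC leq_mul2l (leq_trans K2500 IJ) orbT.
have KLM : K * L <= K * M by rewrite leq_mul2l JT orbT.
have KLM0 : 5 * volume a <= K * L * M + 5.
  have [h|h] := leqP (volume a) 1; first by move: h; clear; lia.
  have : 5 * (volume a - 1) <= s * (volume a - 1) by rewrite leq_mul2r s5 orbT.
  by rewrite mulnBr muln1; move: vol h; clear; lia.
have f5 : 5 * f <= K * L + 1.
  have : f * M <= volume a.
    by rewrite volume_layers mulnC -sum_nat_const leq_sum.
  move=> h; have : 5 * f * M <= (K * L + 1) * M; last by rewrite leq_pmul2r.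
  by move: h KLM0 KM K2500; clear; lia.
set near := fun t => area (layerC (layer a t)) < f.
have G : 3 * \sum_t near t <= M.
  have h1 : (\sum_t near t) * (K * L - f) <= volume a.
    rewrite volume_layers big_distrl; apply: leq_sum => t _ /=.
    case: (boolP (near t)) => h /=; rewrite ?mul0n // mul1n.
    by rewrite leq_subLR -(areaC (layer a t)) addnC leq_add2r ltnW.
  have h2 : (\sum_t near t) * (3 * (K * L)) <= (\sum_t near t) * (4 * (K * L - f)).
    by rewrite leq_mul2l; apply/orP; right; move: f5 KL25 K2500; clear; lia.
  have KL0 : 0 < K * L by move: KL25 K2500; clear; lia.
  rewrite -(leq_pmul2r KL0); have : 2500 * 1 * M <= K * L * M.
    by rewrite leq_mul2r leq_mul ?orbT //; move: IJ K2500; clear; lia.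
  by move: h1 h2 KLM0 KM K2500; clear; lia.
have cnt := sum_boolC near.
have low m : (forall t, ~~ near t -> m <= cost (layer a t)) -> 2 * M * m <= 3 * (2 * f + K + 1).
  move=> hm; have : m * (\sum_t ~~ near t) <= total_cost a.
    rewrite big_distrr; apply: leq_sum => t _ /=.
    by case: (boolP (near t)) => h /=; rewrite ?muln0 // muln1 hm.
  have : 2 * M * m <= 3 * (\sum_t ~~ near t) * m by rewrite leq_mul2r; apply/orP; right; move: G cnt; clear; lia.
  have := verticals_trichotomy a M0; move: ch ef; rewrite /cheap -/f; clear; lia.
have ge2 t : ~~ near t -> f <= area (layerC (layer a t)) by rewrite /near -leqNgt.
have [h|h] := ltnP (K ^ 2) (4 * f).
  have : 2 * M * K <= 3 * (2 * f + K + 1).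
    apply: low => t /ge2 h2; case: (cost_sqr_strip (ge1 t) h2) => [/strip_cost_ge //|h'].
    by rewrite -leq_sqr (leq_trans (ltnW h)).
  by move: f5 KLM KL25 K2500; clear; lia.
have [r /andP[r1 r2]] := sqrt_floor f.
have rK : 2 * r <= K by rewrite -leq_sqr expnMn; apply: leq_trans h; rewrite leq_mul2l.
have rs : s <= r by rewrite -ltnS -ltn_sqr (leq_ltn_trans fs).
have : 2 * M * (2 * r) <= 3 * (2 * f + K + 1).
  apply: low => t /ge2 h2.
  by apply: (cost_ge_double (leqnn K) IJ rK); [have := ge1 t; move: r1; clear; lia|move: r1 h2; clear; lia].
have : f <= r ^ 2 + 2 * r by move: r2; clear; nia.
have : r * (2 * r) <= r * M by rewrite leq_mul2l (leq_trans rK KM) orbT.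
have : 5 * (M - 12) <= r * (M - 12) by rewrite leq_mul2r (leq_trans s5 rs) orbT.
have : r * (M - 12) = r * M - 12 * r by rewrite mulnBr (mulnC r 12).
by move: K2500 KM; clear; lia.
Qed.

Lemma high_volume_lines a : cheap K a -> ~~ slab s a ->
  s * volume (boxC a) <= K * L * M + s -> empty_verticals a < full_verticals a.
Proof.
move=> ch n3 vol; rewrite -full_verticalsC -(empty_verticalsC a).
by apply: low_volume_lines => //; [exact: cheapC|rewrite slabC].
Qed.

End NotSlab.


(** * The test function *)

Lemma profile_gt0 (k s X Y Z : nat) : k <= X -> k <= Y -> k <= Z ->
  5 <= s -> 100 * s ^ 2 <= k -> 0 < profile k s X Y Z (X * Y * Z).
Proof.
move=> kX kY kZ s5 sk; have k25 : 2500 <= k.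
  by apply: leq_trans sk; rewrite (@leq_mul 100 25) // (@leq_sqr 5).
have XY0 : 0 < X * Y by rewrite muln_gt0; move: k25 kX kY; clear; lia.
have kk : k * 2500 <= X * Y by rewrite leq_mul // (leq_trans k25).
have s0 : 0 < 5 * s by move: s5; clear; lia.
(* The first layer above the flat initial part, followed by a remainder [3 * k + 1] just past the
   margin, gives a steep volume. *)
set i := (12 * Z) %/ (5 * s) + 1.
have i1 : 12 * Z <= 5 * s * i.
  by have := ltn_ceil (12 * Z) s0; rewrite /i addn1 [5 * s * _]mulnC => /ltnW.
have i2 : 5 * s * i <= 12 * Z + 5 * s.
  by rewrite mulnDr muln1 leq_add2r [5 * s * _]mulnC leq_trunc_div.
have i3 : 12 * Z + 5 * s * (i + 1) <= 5 * s * Z.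
  rewrite mulnDr muln1; have : 25 * Z + 5 * (s - 5) * Z <= 5 * s * Z.
    by rewrite -mulnDl leq_mul2r; apply/orP; right; move: s5; clear; lia.
  have : 5 * (s - 5) * 2500 <= 5 * (s - 5) * Z by rewrite leq_mul2l (leq_trans k25) ?orbT.
  by move: i2 s5 k25 kZ; clear; lia.
have iZ : i < Z.
  have : 5 * s * (i + 1) <= 5 * s * Z by move: i3; clear; lia.
  by rewrite leq_pmul2l // addn1.
have r1 : 3 * k + 1 < X * Y by move: kk k25; clear; lia.
have nN : X * Y * i + (3 * k + 1) < X * Y * Z.
  have : X * Y * (i + 1) <= X * Y * Z by rewrite leq_mul2l addn1 iZ orbT.
  by rewrite mulnDr muln1; move: r1; clear; lia.
rewrite /profile (bigD1 (Ordinal nN)) //= addn_gt0; apply/orP; left.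
rewrite lt0b /steep [X * Y * i]mulnC divnMDl // divn_small // addn0 i1 i3.
rewrite modnMDl (modn_small r1) modnMDl (@modn_small 1) //; last by move: k25; clear; lia.
by move: kk k25; clear; lia.
Qed.

Section TestFunction.
Variables (R : realFieldType) (I J T : finType) (s : nat).
Hypotheses (IJ : #|I| <= #|J|) (JT : #|J| <= #|T|).
Hypotheses (s5 : 5 <= s) (sK : 100 * s ^ 2 <= #|I|).
Implicit Type a : I -> J -> T -> bool.
Local Notation K := #|I|.
Local Notation L := #|J|.
Local Notation M := #|T|.
Local Open Scope ring_scope.

Definition slab_ratio (X Y Z : finType) (k : nat) (a : X -> Y -> Z -> bool) : R :=
  (slab_value k s a)%:R / (profile k s #|X| #|Y| #|Z| (#|X| * #|Y| * #|Z|))%:R.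

(** The last case covers regions that are not slabs in any direction; these have unequal numbers of
    full and empty verticals by [no_tie], so the majority is stable under one step. *)
Definition test_function a : R :=
  if (s * volume a < K * L * M)%N then 0
  else if (s * volume (boxC a) < K * L * M)%N then 1
  else if slab s a then slab_ratio K a
  else if slab s (view2 a) then slab_ratio K (view2 a)
  else if slab s (view1 a) then slab_ratio K (view1 a)
  else (empty_verticals a < full_verticals a)%N%:R.

Definition growth (X Y Z : finType) (k : nat) (a a' : X -> Y -> Z -> bool) : Prop :=
  [/\ canonical k a, canonical k a', steep k s #|X| #|Y| #|Z| (volume a) &
      slab_ratio k a' = slab_ratio k a +
        (profile k s #|X| #|Y| #|Z| (#|X| * #|Y| * #|Z|))%:R^-1].

End TestFunction.

(** Only the vertical through the new site changes: it may become full or cease to be empty, but not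
    both, as it has more than one site. So the sum and the difference of the two counts each move by
    at most one. *)
Lemma adds_verticals (I J T : finType) (a a' : I -> J -> T -> bool) i0 j0 t0 :
  1 < #|T| -> adds a a' i0 j0 t0 -> exists x y : bool,
  [/\ ~~ (x && y), full_verticals a' = full_verticals a + x &
      empty_verticals a = empty_verticals a' + y].
Proof.
move=> T1 [n0 h].
have same i j : (i, j) != (i0, j0) -> a' i j =1 a i j.
  by move=> ij t; rewrite h andbA -xpair_eqE (negbTE ij) orbF.
pose S (b : I -> J -> T -> bool) (p : (T -> bool) -> bool) := \sum_i \sum_j p (b i j).
have split (b : I -> J -> T -> bool) (p : (T -> bool) -> bool) :
  S b p = p (b i0 j0) + (\sum_(j | j != j0) p (b i0 j) + \sum_(i | i != i0) \sum_j p (b i j)).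
  by rewrite /S (bigD1 i0) //= (bigD1 j0) //= addnA.
have rest (p : (T -> bool) -> bool) : (forall u v, u =1 v -> p u = p v) ->
  \sum_(j | j != j0) p (a' i0 j) + \sum_(i | i != i0) \sum_j p (a' i j) =
  \sum_(j | j != j0) p (a i0 j) + \sum_(i | i != i0) \sum_j p (a i j).
  move=> ext; congr addn.
    by apply: eq_bigr => j jj; congr nat_of_bool; apply/ext/same; rewrite xpair_eqE negb_and jj orbT.
  apply: eq_bigr => i ii; apply: eq_bigr => j _; congr nat_of_bool; apply/ext/same.
  by rewrite xpair_eqE negb_and ii.
have f := split a (@full T); have f' := split a' (@full T).
have e := split a (@empty T); have e' := split a' (@empty T).
rewrite (rest (@full T) (@eq_full T)) in f'; rewrite (rest (@empty T) (@eq_empty T)) in e'.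
have h0 : full (a i0 j0) = false by apply/negbTE/forallPn; exists t0.
have h1 : empty (a' i0 j0) = false by apply/negbTE/forallPn; exists t0; rewrite h !eqxx orbT.
have h2 : full (a' i0 j0) && empty (a i0 j0) = false.
  apply/negbTE/negP => /andP[/forallP p1 /forallP p2].
  have /card_gt1P[u [v [_ _ uv]]] := T1.
  have [tu|tu] := eqVneq u t0.
    have := p1 v; rewrite h -[v == t0](negbK) -tu eq_sym uv /= !andbF orbF.
    by move=> w; move: (p2 v); rewrite w.
  by have := p1 u; rewrite h (negbTE tu) !andbF orbF => w; move: (p2 u); rewrite w.
rewrite h0 in f; rewrite h1 in e'.
exists (full (a' i0 j0)), (empty (a i0 j0)); rewrite h2; split=> //.
  by rewrite [LHS]f' [full_verticals a]f add0n addnC.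
by rewrite [LHS]e [empty_verticals a']e' add0n addnC.
Qed.

Section SlabStep.
Variables (R : realFieldType) (I J T : finType) (s k : nat).
Hypotheses (kI : k <= #|I|) (kJ : k <= #|J|) (kT : k <= #|T|).
Hypotheses (s5 : 5 <= s) (sk : 100 * s ^ 2 <= k).
Implicit Type a : I -> J -> T -> bool.
Local Notation N := (#|I| * #|J| * #|T|).

(** The count moves by at most one and skips [2 * s ^ 2], hence stays on its side. *)
Lemma slab_adds a a' i0 j0 t0 : adds a a' i0 j0 t0 ->
  cheap k a -> balanced s a -> cheap k a' -> balanced s a' -> slab s a = slab s a'.
Proof.
move=> ad ch ba ch' ba'.
have := slab_gap kI kJ kT s5 sk ch ba; have := slab_gap kI kJ kT s5 sk ch' ba'.
have T1 : 1 < #|T| by nia.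
rewrite /slab; have [x [y [xy -> ->]]] := adds_verticals T1 ad; move: xy.
move: (full_verticals a) (empty_verticals a') (2 * s ^ 2) => f e z.
by case: x; case: y => //= _ g g'; apply/idP/idP; move: g g'; clear; lia.
Qed.

Lemma slab_ratio_step a a' i0 j0 t0 : adds a a' i0 j0 t0 ->
  cheap k a -> balanced s a -> slab s a ->
  cheap k a' -> balanced s a' -> slab s a' ->
  slab_ratio R s k a = slab_ratio R s k a' \/ growth R s k a a'.
Proof.
move=> ad ch ba sl ch' ba' sl'.
case: (slab_step kI kJ kT s5 sk ad ch ba sl ch' ba' sl') => [h|[c c' st]].
  by left; rewrite /slab_ratio h.
right; split=> //; rewrite /slab_ratio /slab_value c c' (adds_volume ad) addn1 profileS st.
by rewrite natrD mulrDl mul1r.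
Qed.

Lemma slab_ratio_low a : s * volume a <= N + s -> slab_ratio R s k a = 0%R.
Proof.
have T0 : 0 < #|T| by nia.
by move=> h; rewrite /slab_ratio (slab_value_low kI kJ kT s5 sk h T0) mul0r.
Qed.

Lemma slab_ratio_high a : s * volume (boxC a) <= N + s -> slab_ratio R s k a = 1%R.
Proof.
have T0 : 0 < #|T| by nia.
move=> h; rewrite /slab_ratio (slab_value_high kI kJ kT s5 sk h T0) divff //.
by rewrite pnatr_eq0 -lt0n profile_gt0.
Qed.

Lemma profile_le m n : m <= n -> profile k s #|I| #|J| #|T| m <= profile k s #|I| #|J| #|T| n.
Proof. by move/subnK <-; elim: (n - m) => // d IH; rewrite addSn profileS (leq_trans IH) // leq_addr. Qed.

Lemma slab_ratio_01 a : (0 <= slab_ratio R s k a <= 1)%R.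
Proof.
have p0 : (0 < (profile k s #|I| #|J| #|T| N)%:R :> R)%R by rewrite ltr0n profile_gt0.
rewrite /slab_ratio divr_ge0 ?ler0n // ler_pdivrMr // mul1r ler_nat /slab_value.
case: ifP => _; apply: profile_le; first by rewrite -(volumeC a) leq_addr.
by rewrite leq_mul2l (sum_bool_le (fun t => _ < 2 * area (layer a t))) orbT.
Qed.

End SlabStep.

Section TestStep.
Variables (R : realFieldType) (I J T : finType) (s : nat).
Hypotheses (IJ : #|I| <= #|J|) (JT : #|J| <= #|T|).
Hypotheses (s5 : 5 <= s) (sK : 100 * s ^ 2 <= #|I|).
Implicit Type a : I -> J -> T -> bool.
Local Notation K := #|I|.
Local Notation L := #|J|.
Local Notation M := #|T|.
Local Notation F := (test_function R s).
Local Notation KI := (leqnn K).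
Local Notation IT := (leq_trans IJ JT).

Lemma cheap_view2 a : cheap K a -> cheap K (view2 a).
Proof.
have : K * L <= K * M by rewrite leq_mul2l JT orbT.
by rewrite /cheap total_cost_views total_cost_view2; lia.
Qed.

Lemma cheap_view1 a : cheap K a -> cheap K (view1 a).
Proof.
have : K * L <= L * M by rewrite mulnC leq_mul2l IT orbT.
by rewrite /cheap total_cost_views total_cost_view1; lia.
Qed.

Lemma adds_view2 a a' i0 j0 t0 : adds a a' i0 j0 t0 -> adds (view2 a) (view2 a') i0 t0 j0.
Proof. by move=> [n h]; split=> // i t j; rewrite [LHS]h [(j == j0) && _]andbC. Qed.

Lemma adds_view1 a a' i0 j0 t0 : adds a a' i0 j0 t0 -> adds (view1 a) (view1 a') j0 t0 i0.
Proof. by move=> [n h]; split=> // j t i; rewrite [LHS]h [(i == i0) && _]andbC -andbA. Qed.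

Lemma balanced_view2 a : balanced s (view2 a) = balanced s a.
Proof.
rewrite /balanced volume_view2 -[volume (boxC (view2 a))]/(volume (view2 (boxC a))).
by rewrite volume_view2 mulnAC.
Qed.

Lemma balanced_view1 a : balanced s (view1 a) = balanced s a.
Proof.
rewrite /balanced volume_view1 -[volume (boxC (view1 a))]/(volume (view1 (boxC a))).
by rewrite volume_view1 [L * M * K]mulnC mulnA.
Qed.

(** The slack [s] is one site: the value is still 0 just above the cutoff, so that crossing the
    cutoff changes nothing. *)
Lemma test_low a : cheap K a -> s * volume a <= K * L * M + s ->
  ~~ (s * volume (boxC a) < K * L * M) -> F a = 0%R.
Proof.
move=> ch lo; rewrite -leqNgt => nhi; rewrite /test_function.
case: ifP => // _; rewrite ltnNge nhi /=.
case: (boolP (slab s a)) => n3; first exact: (slab_ratio_low R KI IJ IT s5 sK).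
case: (boolP (slab s (view2 a))) => n2.
  by apply: (slab_ratio_low (k := K) R KI IT IJ s5 sK); rewrite volume_view2 mulnAC.
case: (boolP (slab s (view1 a))) => n1.
  by apply: (slab_ratio_low (k := K) R IJ IT KI s5 sK); rewrite volume_view1 [L * M * K]mulnC mulnA.
by rewrite ltnNge ltnW // (low_volume_lines IJ JT s5 sK ch n3 lo).
Qed.

Lemma test_high a : cheap K a -> s * volume (boxC a) <= K * L * M + s ->
  ~~ (s * volume a < K * L * M) -> F a = 1%R.
Proof.
move=> ch hi nlo; rewrite /test_function (negbTE nlo).
case: ifP => // _.
case: (boolP (slab s a)) => n3; first exact: (slab_ratio_high R KI IJ IT s5 sK).
case: (boolP (slab s (view2 a))) => n2.
  apply: (slab_ratio_high (k := K) R KI IT IJ s5 sK).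
  by rewrite -[boxC _]/(view2 (boxC a)) volume_view2 mulnAC.
case: (boolP (slab s (view1 a))) => n1.
  apply: (slab_ratio_high (k := K) R IJ IT KI s5 sK).
  by rewrite -[boxC _]/(view1 (boxC a)) volume_view1 [L * M * K]mulnC mulnA.
by rewrite (high_volume_lines IJ JT s5 sK ch n3 hi).
Qed.

Lemma test_function_step a a' i0 j0 t0 : adds a a' i0 j0 t0 ->
  cheap K a -> cheap K a' ->
  [\/ F a' = F a,
      growth R s K a a' /\ F a' = (F a + (profile K s K L M (K * L * M))%:R^-1)%R,
      growth R s K (view2 a) (view2 a') /\
        F a' = (F a + (profile K s K M L (K * M * L))%:R^-1)%R |
      growth R s K (view1 a) (view1 a') /\
        F a' = (F a + (profile K s L M K (L * M * K))%:R^-1)%R].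
Proof.
move=> ad ch ch'; have v := adds_volume ad; have c := volumeC a; have c' := volumeC a'.
have N0 : 5 * s <= K * L * M.
  have s0 : s * 1 <= s ^ 2 by rewrite -mulnn leq_mul2l; move: s5; clear; lia.
  have : K * 1 * 1 <= K * L * M by rewrite !leq_mul //; move: s0 s5 sK IJ JT; clear; lia.
  by move: s0 s5 sK; clear; lia.
have sN : s * volume a + s * volume (boxC a) = s * (K * L * M) by rewrite -mulnDr c.
have sN' : s * volume a' + s * volume (boxC a') = s * (K * L * M) by rewrite -mulnDr c'.
have sv : s * volume a' = s * volume a + s by rewrite v mulnDr muln1.
have s5N : 5 * (K * L * M) <= s * (K * L * M) by rewrite leq_mul2r s5 orbT.
case: (ltnP (s * volume a) (K * L * M)) => lo.
  constructor 1; rewrite !test_low //; rewrite -?leqNgt; move: lo sN sN' sv s5N N0; clear; lia.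
case: (ltnP (s * volume (boxC a')) (K * L * M)) => hi'.
  constructor 1; rewrite !test_high //; rewrite -?leqNgt; move: lo hi' sN sN' sv s5N N0; clear; lia.
have ba : balanced s a by rewrite /balanced lo; move: hi' sN sN' sv; clear; lia.
have ba' : balanced s a' by rewrite /balanced hi' andbT; move: lo sv; clear; lia.
have a2 := adds_view2 ad; have a1 := adds_view1 ad.
have nlo' : s * volume a' < K * L * M = false by move: lo sv; clear; lia.
have nhi : s * volume (boxC a) < K * L * M = false by move: hi' sN sN' sv; clear; lia.
have [ba2 ba2'] : balanced s (view2 a) /\ balanced s (view2 a') by rewrite !balanced_view2.
have [ba1 ba1'] : balanced s (view1 a) /\ balanced s (view1 a') by rewrite !balanced_view1.
have [ch2 ch2'] := (cheap_view2 ch, cheap_view2 ch').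
have [ch1 ch1'] := (cheap_view1 ch, cheap_view1 ch').
have E3 := slab_adds KI IJ IT s5 sK ad ch ba ch' ba'.
have E2 := slab_adds KI IT IJ s5 sK a2 ch2 ba2 ch2' ba2'.
have E1 := slab_adds IJ IT KI s5 sK a1 ch1 ba1 ch1' ba1'.
rewrite /test_function [s * volume a < _]ltnNge lo nlo' nhi [s * volume (boxC a') < _]ltnNge hi' /= -E3 -E2 -E1.
case: (boolP (slab s a)) => n3.
  have n3' := n3; rewrite E3 in n3'.
  case: (slab_ratio_step R KI IJ IT s5 sK ad ch ba n3 ch' ba' n3') => [->|g]; first by constructor 1.
  by constructor 2; split=> //; case: g.
case: (boolP (slab s (view2 a))) => n2.
  have n2' := n2; rewrite E2 in n2'.
  case: (slab_ratio_step R KI IT IJ s5 sK a2 ch2 ba2 n2 ch2' ba2' n2') => [->|g]; first by constructor 1.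
  by constructor 3; split=> //; case: g.
case: (boolP (slab s (view1 a))) => n1.
  have n1' := n1; rewrite E1 in n1'.
  case: (slab_ratio_step R IJ IT KI s5 sK a1 ch1 ba1 n1 ch1' ba1' n1') => [->|g]; first by constructor 1.
  by constructor 4; split=> //; case: g.
constructor 1; have t := no_tie IJ JT s5 sK ch n3 n1 n2.
have t' : full_verticals a' <> empty_verticals a'.
  by apply: (no_tie IJ JT s5 sK ch'); rewrite -?E1 -?E2 -?E3.
have T1 : 1 < M by move: N0 IJ JT s5 sK; clear; nia.
have [x [y [xy f e]]] := adds_verticals T1 ad.
congr (nat_of_bool _)%:R%R; move: t t' xy; rewrite f e.
move: (full_verticals a) (empty_verticals a') => u w.
by case: x {f}; case: y {e} => //= t t' _; apply/idP/idP; move: t t'; clear; lia.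
Qed.

Lemma test_function_01 a : (0 <= F a <= 1)%R.
Proof.
rewrite /test_function; do 2![case: ifP => _; first by rewrite ?lexx ?ler01].
case: ifP => _; first exact: (slab_ratio_01 R KI IJ IT s5 sK).
case: ifP => _; first exact: (slab_ratio_01 R KI IT IJ s5 sK).
case: ifP => _; first exact: (slab_ratio_01 R IJ IT KI s5 sK).
by rewrite ler0n lern1 leq_b1.
Qed.

End TestStep.


(** * Arcs and lexicographic growth *)

Section Circle.
Variable p : nat.
Local Notation Z := 'I_p.+2.
Implicit Types (u : Z -> bool) (w o x : Z).
Local Open Scope ring_scope.

Definition boundary u : nat := (\sum_x (u x != u (x + 1)%R))%N.

(** The coordinate on the circle with origin [o] and orientation [e]. *)
Definition pos (e : bool) o x : nat := if e then x - o else o - x.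

Lemma pos_lt e o x : (pos e o x < p.+2)%N.
Proof. by rewrite /pos; case: e; apply: ltn_ord. Qed.

Lemma pos_inj e o : injective (pos e o).
Proof.
move=> x y; rewrite /pos; case: e => /val_inj; first exact: addIr.
by move/addrI/oppr_inj.
Qed.

Lemma eq_boundary u v : u =1 v -> boundary u = boundary v.
Proof. by move=> e; apply: eq_bigr => x _; rewrite !e. Qed.

Lemma boundary_three u x y z : x != y -> x != z -> y != z ->
  u x != u (x + 1) -> u y != u (y + 1) -> u z != u (z + 1) -> (3 <= boundary u)%N.
Proof.
move=> xy xz yz hx hy hz; have yx : y != x by rewrite eq_sym.
rewrite /boundary (bigD1 x) //= (bigD1 y yx) /=.
have c : (z != x) && (z != y) by rewrite ![z == _]eq_sym xz yz.
by rewrite (bigD1 z c) /= hx hy hz.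
Qed.

Lemma nat_walk (f : nat -> bool) m n : (m <= n)%N ->
  (forall i, (m <= i < n)%N -> f i = f i.+1) -> f m = f n.
Proof.
move/subnK <-; elim: (n - m)%N => [//|d IH] h; rewrite IH => [|i /andP[h1 h2]]; last by apply: h; lia.
by rewrite addSn; apply: h; lia.
Qed.

Let back w (i : nat) : Z := w - i%:R.

Let back_inj w i j : (i < p.+2)%N -> (j < p.+2)%N -> (back w i == back w j) = (i == j).
Proof.
move=> hi hj; apply/eqP/eqP => [/addrI/oppr_inj|-> //]; rewrite !Zp_nat => /(congr1 val) /=.
by rewrite !modn_small.
Qed.

Let backE w x : back w (w - x)%R = x.
Proof. by rewrite /back natr_Zp opprB addrC subrK. Qed.

Let backS w i : back w i.+1 + 1 = back w i.
Proof. by rewrite /back -natr1 opprD addrA subrK. Qed.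

Let back_last w : back w p.+1 = w + 1.
Proof.
rewrite -[w + 1](backE w) opprD addrA subrr sub0r; congr (back w _).
by rewrite /= /Zp_opp /= /Zp1 /= modn_small.
Qed.

Lemma boundary_bad u : bad u -> (2 <= boundary u)%N.
Proof.
case/andP => /existsP[x ux] /existsP[y uy].
have ex (v : Z -> bool) z z' : v z -> ~~ v z' -> exists t, v t && ~~ v (t + 1).
  move=> vz vz'; apply/existsP; rewrite -[X in is_true X]negbK negb_exists; apply/negP => /forallP h.
  have up i : v (z + i%:R).
    elim: i => [|i IH]; first by rewrite addr0.
    by have := h (z + i%:R); rewrite IH /= negbK -natr1 addrA.
  by move: (up (z' - z)); rewrite natr_Zp addrC subrK (negbTE vz').
have [t /andP[t1 t2]] := ex u x y ux uy.
have nnx : ~~ ~~ u x by rewrite negbK.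
have [t' /andP[t1' t2']] := ex (fun z => ~~ u z) y x uy nnx.
rewrite /boundary (bigD1 t) //= t1 (negbTE t2) (bigD1 t') /=; last by apply: contraNneq t1' => ->.
by rewrite (negbTE t1'); rewrite negbK in t2'; rewrite t2'.
Qed.

Lemma boundary_opp u : boundary (fun x => u (- x)) = boundary u.
Proof.
rewrite /boundary (reindex (fun x => - (x + 1))) /=; last first.
  by exists (fun x => - (x + 1)) => x _; rewrite opprD opprK addrK.
by apply: eq_bigr => x _; rewrite !opprD subrK !opprK eq_sym.
Qed.

(** Walking back from [w] one stays in [u] for some time and then leaves it. A later return would
    give a third boundary edge. *)
Let arc_back u w : (boundary u <= 2)%N -> ~~ u w -> u (w - 1) -> ~~ u (w + 1) ->
  exists j, (forall x, u x = (pos true (w - j%:R)%R x < j)%N) /\ pos true (w - j%:R) w = j.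
Proof.
move=> bu uw um up.
have ex : exists i, ~~ u (back w i.+1) by exists p; rewrite back_last.
have [j uj jmin] := ex_minnP ex.
have j0 : (0 < j)%N by rewrite lt0n; apply/eqP => j00; rewrite j00 /back um in uj.
have jp : (j <= p)%N by apply: jmin; rewrite back_last.
have low i : (0 < i <= j)%N -> u (back w i).
  case: i => // i /andP[_ ij]; apply/negPn/negP => h.
  by have := jmin _ h; rewrite leqNgt ij.
have high i : (j < i < p.+2)%N -> ~~ u (back w i).
  move=> /andP[ji ip]; rewrite -(@nat_walk (fun i => u (back w i)) j.+1 i) // => l /andP[l1 l2].
  apply/eqP/negPn/negP => h; have : (3 <= boundary u)%N; last by rewrite ltnNge bu.
  have lp : (l.+1 < p.+2)%N := leq_ltn_trans l2 ip.
  apply: (@boundary_three u (back w 1) (back w j.+1) (back w l.+1)).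
  - by rewrite back_inj //; move: j0; clear; lia.
  - by rewrite back_inj //; move: j0 l1; clear; lia.
  - by rewrite back_inj //; move: jp l1; clear; lia.
  - by rewrite backS /back subr0 (negbTE uw) [w - 1%:R]/(w - 1) um.
  - by rewrite backS (negbTE uj) low // leqnn j0.
  - by rewrite backS eq_sym.
have jlt : (j < p.+2)%N by rewrite ltnS leqW.
exists j; rewrite /pos.
have pw x : ((x - (w - j%:R))%R : nat) = ((j + (p.+2 - (w - x)%R)) %% p.+2)%N.
  have -> : x - (w - j%:R) = j%:R - (w - x) by rewrite !opprB addrCA addrC.
  by rewrite Zp_nat /= !modnDml modnDmr.
split=> [x|]; last first.
  by rewrite pw subrr /= subn0 modnDr (modn_small jlt).
rewrite pw -[in LHS](backE w x); have xp := ltn_ord (w - x).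
have [x0|x0] := posnP (w - x)%R.
  rewrite x0 subn0 modnDr (modn_small jlt) ltnn /back subr0.
  exact: negbTE.
have [xj|xj] := leqP (w - x)%R j.
  rewrite low ?x0 //; have -> : (j + (p.+2 - (w - x)%R) = (j - (w - x)%R) + p.+2)%N.
    by move: xp xj; clear; move: ((w - x)%R : nat) => y; lia.
  by rewrite modnDr modn_small //; move: jp x0 xj; clear; move: ((w - x)%R : nat) => y; lia.
rewrite (negbTE (high _ _)) ?xj // modn_small; move: xj xp jp; clear; move: ((w - x)%R : nat) => y; lia.
Qed.

(** Two arcs that differ by [w]: the site [w] prolongs one end, and [e] records which. *)
Lemma arc_extend u w : (boundary u <= 2)%N -> (boundary (fun x => u x || (x == w)) <= 2)%N ->
  ~~ u w -> (exists x, u x) -> (exists x, ~~ (u x || (x == w))) ->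
  exists e o j, (forall x, u x = (pos e o x < j)%N) /\ pos e o w = j.
Proof.
move=> bu bu' uw [y uy] [z uz]; case/norP: uz => uz zw.
have yw : y != w by apply: contraNneq uw => <-.
have walk (v : Z -> bool) : (boundary v <= 2)%N -> v (w - 1) != v w -> v w != v (w + 1) ->
    forall x, x != w -> v x = v (w - 1).
  move=> bv v1 v2 x xw; have x0 : (0 < (w - x)%R)%N.
    by rewrite lt0n; apply: contraNneq xw => h; rewrite -[x in x == _](backE w x) h /back subr0.
  rewrite -(backE w x) -[w - 1]/(back w 1); apply/esym/(@nat_walk (fun i => v (back w i)) 1) => // i /andP[i1 i2].
  have ip : (i.+1 < p.+2)%N := leq_ltn_trans i2 (ltn_ord _).
  apply/eqP/negPn/negP => h; have : (3 <= boundary v)%N; last by rewrite ltnNge bv.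
  apply: (@boundary_three v (back w 1) (back w 0) (back w i.+1)).
  - by rewrite back_inj.
  - by rewrite back_inj //; move: i1; clear; lia.
  - by rewrite back_inj.
  - by rewrite backS /back subr0.
  - by rewrite /back subr0.
  - by rewrite backS eq_sym.
(* If both neighbours of [w] are in [u], then [u] is everything but [w]; if none is, then [u] is
   empty. Both are excluded, and the two mixed cases are mirror images. *)
case um : (u (w - 1)); case up : (u (w + 1)).
- have := walk u bu; rewrite um up (negbTE uw) => /(_ isT isT z zw).
  by move=> h; rewrite h in uz.
- have [|j [h1 h2]] := arc_back bu uw um; first by rewrite up.
  by exists true, (w - j%:R), j.
- have := @arc_back (fun x => u (- x)) (- w); rewrite boundary_opp opprK.
  case=> //; first by rewrite -opprD opprK up.
    by rewrite addrC opprB um.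
  move=> j [h1 h2]; exists false, (- (- w - j%:R)), j; rewrite /pos; split=> [x|].
    by rewrite -[in LHS](opprK x) h1 /pos [in RHS]addrC.
  by rewrite -[RHS]h2 /pos addrC.
- have := walk (fun x => u x || (x == w)) bu'; rewrite um up eqxx orbT /=.
  have -> : (w - 1 == w) = false by rewrite -[w - 1]/(back w 1) -{2}[w]subr0 -[w - 0]/(back w 0) back_inj.
  have -> : (w + 1 == w) = false by rewrite -back_last -{2}[w]subr0 -[w - 0]/(back w 0) back_inj.
  by move=> /(_ isT isT y yw); rewrite uy.
Qed.

End Circle.


(** * Steep steps extend an arc inside a strip *)

Section StripGrowth.
Variables (I J T : finType) (k s : nat).
Hypotheses (kI : k <= #|I|) (kJ : k <= #|J|) (kT : k <= #|T|).
Hypotheses (s5 : 5 <= s) (sk : 100 * s ^ 2 <= k).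
Variables (a a' : I -> J -> T -> bool) (i0 : I) (j0 : J) (t0 : T).
Hypothesis ad : adds a a' i0 j0 t0.
Local Notation XY := (#|I| * #|J|).
Hypotheses (can : canonical k a) (can' : canonical k a').
Hypothesis st : steep k s #|I| #|J| #|T| (volume a).

Let k25 : 2500 <= k.
Proof. by apply: leq_trans sk; rewrite (@leq_mul 100 25) // (@leq_sqr 5). Qed.

Let k2 : 2 < k. Proof. by move: k25; clear; lia. Qed.

Let I0 : 0 < #|I|. Proof. by move: k2 kI; clear; lia. Qed.
Let J0 : 0 < #|J|. Proof. by move: k2 kJ; clear; lia. Qed.

(** The incomplete layer stays incomplete, because a steep volume is far from a multiple of the
    layer size. A site added in another layer would create a second incomplete layer, against
    [canonical k a']. *)
Lemma growth_layer : exists i,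
  [/\ strip (layer a t0), cost (layer a t0) <= k + 1, cost (layer a' t0) <= k + 1,
      (forall t, t != t0 -> trivial_layer (layer a t)) &
      volume a = XY * i + area (layer a t0) /\
      i = \sum_(t | t != t0) (area (layer a t) != 0)].
Proof.
have [t1 [i [sa ca va _ ia]]] := canonical_decomposition kI kJ kT s5 sk can.
have /andP[pa aXY] := strip_area kI kJ kT s5 sk sa.
have rE : volume a %% XY = area (layer a t1) by rewrite va mulnC modnMDl modn_small.
move: (st); rewrite /steep rE => /and5P[_ _ r1 r2 _].
have t01 : t0 = t1.
  have [/existsP[t1' /and3P[/forallP tr' _ _]]] := can'.
  have nt t : area (layer a' t) != 0 -> area (layerC (layer a' t)) != 0 -> t = t1'.
    move=> h1 h2; apply/eqP/negPn/negP => n; move: (tr' t).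
    by rewrite n /trivial_layer (negbTE h1) (negbTE h2).
  have A t := adds_area t ad; have C t := areaC (layer a' t).
  apply/eqP/negPn/negP => n01.
  have e1 : t1 = t1'.
    by apply: nt; have := C t1; rewrite (A t1) eq_sym (negbTE n01); move: pa aXY; clear; lia.
  have e0 : t0 = t1'.
    have [/existsP[t2 /and3P[/forallP tr _ s2]]] := can.
    have e2 : t1 = t2.
      apply/eqP/negPn/negP => n; move: (tr t1); rewrite n /trivial_layer.
      by have := areaC (layer a t1); move: pa aXY; clear; lia.
    have := tr t0; rewrite -e2 n01 /trivial_layer => /orP[/eqP z|/eqP z].
      by apply: nt; have := C t0; rewrite (A t0) z eqxx; move: aXY pa; clear; lia.
    have := area_le (layer a' t0); rewrite (A t0) eqxx.
    by have := areaC (layer a t0); rewrite z; clear; lia.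
  by rewrite e0 e1 eqxx in n01.
subst t1; exists i; split=> //.
  have [/existsP[t1' /and3P[/forallP tr' c' _]]] := can'.
  suff -> : t0 = t1' by [].
  apply/eqP/negPn/negP => n; move: (tr' t0); rewrite n /trivial_layer.
  have := areaC (layer a' t0); rewrite (adds_area t0 ad) eqxx.
  by move: r2 k25; clear; lia.
have [/existsP[t2 /and3P[/forallP tr _ s2]]] := can => t n.
have e2 : t0 = t2.
  apply/eqP/negPn/negP => n2; move: (tr t0); rewrite n2 /trivial_layer.
  by have := areaC (layer a t0); move: pa aXY; clear; lia.
by move: (tr t); rewrite -e2 n.
Qed.

(** A steep volume is not near a multiple of [k], so both regions have an incomplete row; the cost
    admits only one, and it must be the row of the new site. *)
Lemma strip_growth_structure : bad_columns (layer a t0) = #|I| ->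
  [/\ #|I| = k, bad_verticals a = XY /\ bad_verticals a' = XY,
      bad_columns (layer a' t0) = #|I|,
      bad (layer a t0 ^~ j0) && bad (layer a' t0 ^~ j0) &
      (forall j, j != j0 -> ~~ bad (layer a t0 ^~ j)) /\
      (forall t, t != t0 -> trivial_layer (layer a t))].
Proof.
move=> bI; have [i [sa ca ca' tr [va ia]]] := growth_layer.
have [n0 same] := ad.
have /andP[pa aXY] := strip_area kI kJ kT s5 sk sa.
have rE : volume a %% XY = area (layer a t0) by rewrite va mulnC modnMDl modn_small.
have XY0 : 0 < XY by rewrite muln_gt0 I0.
have iE : volume a %/ XY = i by rewrite va mulnC divnMDl // divn_small // addn0.
move: (st); rewrite /steep rE iE => /and5P[i1 i2 r1 r2 /andP[m1 m2]].
have layer_same t i' j' : (i', j') != (i0, j0) -> layer a' t i' j' = layer a t i' j'.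
  by rewrite xpair_eqE /layer same andbA => /negbTE ->; rewrite orbF.
have bI' : bad_columns (layer a' t0) = #|I|.
  by apply: (strip_perturb_columns k2 kI ca (layer_same t0) r1 _ bI); apply: ltnW.
have A' := adds_area t0 ad; rewrite eqxx in A'.
have rows (b : I -> J -> bool) : bad_rows b = 0 -> #|I| %| area b.
  move=> h; rewrite area_rows; apply: dvdn_sum => j _.
  have nb : ~~ bad (b ^~ j).
    by apply/negP => bb; have := sum_bool_gt0 (P := fun j => bad (b ^~ j)) bb; rewrite [X in 0 < X]h.
  rewrite (eq_bigr (fun=> nat_of_bool (b i0 j))) => [|x _].
    by rewrite sum_nat_const dvdn_mulr.
  by rewrite (nbad_eq (u := b ^~ j) x i0 nb).
(* If [#|I|] were [k + 1], no row could be bad before or after the step, and [#|I|] would divide two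
   consecutive areas. *)
have IK : #|I| = k.
  have [//|h] : #|I| = k \/ #|I| = k + 1.
    by move: ca kI; rewrite /cost bI; clear; lia.
  have := rows (layer a t0); have := rows (layer a' t0).
  move: ca ca'; rewrite /cost bI bI' h A' => c1 c2.
  have -> : bad_rows (layer a t0) = 0 by move: c1; clear; lia.
  have -> : bad_rows (layer a' t0) = 0 by move: c2; clear; lia.
  move=> /(_ erefl) d1 /(_ erefl) d2.
  by move: d1; rewrite (dvdn_addr _ d2) dvdn1; move: k25; clear; lia.
have R1 : bad_rows (layer a t0) <= 1 by move: ca; rewrite /cost bI IK; clear; lia.
have R1' : bad_rows (layer a' t0) <= 1 by move: ca'; rewrite /cost bI' IK; clear; lia.
have ndvd (b : I -> J -> bool) : bad_rows b = 0 -> area b %% k = 0.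
  by move=> h; have := rows b h; rewrite IK => /eqP.
have ex (b : I -> J -> bool) : bad_rows b != 0 -> exists j, bad (b ^~ j).
  by rewrite -lt0n => /sum_bool_pos.
have one (b : I -> J -> bool) j : bad_rows b <= 1 -> bad (b ^~ j) -> forall j', j' != j -> ~~ bad (b ^~ j').
  move=> h1 h2 j' jj; apply/negP => h3; move: h1.
  by rewrite /bad_rows (bigD1 j) //= h2 (bigD1 j') //= h3.
have [y1 by1] : exists j, bad (layer a t0 ^~ j).
  by apply: ex; apply/eqP => /ndvd z; rewrite z in m1.
have [y2 by2] : exists j, bad (layer a' t0 ^~ j).
  apply: ex; apply/eqP => /ndvd; rewrite A' -modnDml modn_small; last by move: m2 k2; clear; lia.
  by rewrite addn1.
have row_same j : j != j0 -> bad (layer a' t0 ^~ j) = bad (layer a t0 ^~ j).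
  by move=> n; apply: eq_bad => x; rewrite layer_same // xpair_eqE (negbTE n) andbF.
(* A bad row other than [j0] would stay bad, and the new site would make the constant row [j0] a
   second bad one. *)
have y10 : y1 = j0.
  apply/eqP/negPn/negP => n.
  have b1 : bad (layer a' t0 ^~ y1) by rewrite row_same.
  have := one _ _ R1' b1 j0; rewrite eq_sym n => /(_ isT) /negP; apply.
  have ix : exists x, x != i0.
    have /card_gt1P[u [v [_ _ uv]]] : 1 < #|I| by rewrite IK ltnW.
    by have [e|e] := eqVneq u i0; [exists v; rewrite -e eq_sym|exists u].
  have [x xi] := ix; apply: (@bad2 _ _ i0 x); first by rewrite /layer same !eqxx orbT.
  rewrite layer_same ?xpair_eqE ?(negbTE xi) // (nbad_eq (u := layer a t0 ^~ j0) x i0) //.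
  by apply: (one _ _ R1 by1); rewrite eq_sym.
have y20 : y2 = j0.
  apply/eqP/negPn/negP => n; rewrite y10 in by1.
  by have /negP[] := one _ _ R1 by1 y2 n; rewrite -row_same.
rewrite y10 in by1; rewrite y20 in by2; split=> //.
(* The number [i] of full layers is positive and leaves room for an empty one; the full and the
   empty layer together make every vertical bad. *)
- have i0' : 0 < i.
    by rewrite lt0n; apply/eqP => z; move: i1; rewrite z muln0; move: k25 kT; clear; lia.
  have iT : i.+1 < #|T|.
    have s50 : 0 < 5 * s by move: s5; clear; lia.
    have T0 : 0 < 12 * #|T| by move: k25 kT; clear; lia.
    rewrite -(ltn_pmul2l s50); apply: leq_trans i2; rewrite addn1 -[X in X < _]add0n ltn_add2r; exact: T0.
  have [t1 n1 f1] : exists2 t, t != t0 & forall u v, a u v t.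
    move: i0'; rewrite ia lt0n sum_nat_eq0 negb_forall => /existsP[t].
    rewrite negb_imply => /andP[n h]; exists t => // u v.
    case: (trivial_layerP (tr t n)) => z; first exact: z.
    have z0 : area (layer a t) = 0.
      by rewrite /area big1 // => x _; rewrite big1 // => y _; rewrite (negbTE (z x y)).
    by rewrite z0 in h.
  have [t2 n2 f2] : exists2 t, t != t0 & forall u v, ~~ a u v t.
    have : \sum_(t | t != t0) (area (layer a t) != 0) < \sum_(t | t != t0) 1.
      rewrite -ia; apply: leq_trans (_ : #|T|.-1 <= _); first by move: iT; case: #|T|.
      by rewrite -sum1_card (bigD1 t0).
    move=> h; have [t /andP[n e]] : exists t, (t != t0) && (area (layer a t) == 0).
      apply/existsP; rewrite -[X in is_true X]negbK negb_exists; apply/negP => /forallP z.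
      move: h; rewrite ltnNge => /negP[]; apply: leq_sum => t n.
      by have := z t; rewrite n /= => ->.
    exists t => // u v; case: (trivial_layerP (tr t n)) => z; last exact: z.
    by move: e; rewrite /area (bigD1 u) //= (bigD1 v) //= z.
  rewrite /bad_verticals -!sum_nat_const; split; apply: eq_bigr => x _.
    by rewrite -sum1_card; apply: eq_bigr => y _; rewrite (@bad2 _ (a x y) t1 t2).
  rewrite -sum1_card; apply: eq_bigr => y _.
  by rewrite (@bad2 _ (a' x y) t1 t2) // same ?f1 // (negbTE n2) !andbF orbF.
- by rewrite by1 by2.
- by split=> // j; apply: one.
Qed.

End StripGrowth.

Section Growth.
Variables p q r : nat.
Local Notation I := 'I_p.+2.
Local Notation J := 'I_q.+2.
Local Notation T := 'I_r.+2.
Implicit Type a : I -> J -> T -> bool.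

Definition box_energy a : nat :=
  \sum_i \sum_j boundary (a i j) +
  \sum_t (\sum_j boundary (layer a t ^~ j) + \sum_i boundary (layer a t i)).

Lemma sum_boundary_ge (X : finType) m (u : X -> 'I_m.+2 -> bool) :
  2 * \sum_x bad (u x) <= \sum_x boundary (u x).
Proof.
rewrite big_distrr; apply: leq_sum => x _ /=.
by case: (boolP (bad (u x))) => h; rewrite /= ?muln0 // muln1 boundary_bad.
Qed.

Lemma box_energy_ge a : 2 * (bad_verticals a + total_cost a) <= box_energy a.
Proof.
rewrite mulnDr leq_add //.
  by rewrite big_distrr; apply: leq_sum => i _; apply: sum_boundary_ge.
rewrite big_distrr; apply: leq_sum => t _; rewrite /= mulnDr.
by apply: leq_add; [exact: (sum_boundary_ge (fun j => layer a t ^~ j))|exact: sum_boundary_ge].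
Qed.

Lemma cheap_of_energy k a :
  box_energy a <= 2 * (#|I| * #|J|) + 2 * k + 2 -> cheap k a.
Proof.
move=> h; have := leq_trans (box_energy_ge a) h.
have -> : 2 * (#|I| * #|J|) + 2 * k + 2 = 2 * (#|I| * #|J| + k + 1) by clear; lia.
by rewrite leq_pmul2l.
Qed.

Lemma sum_pointwise (X : finType) (f : X -> nat) c : (forall x, c <= f x) ->
  \sum_x f x <= c * #|X| -> forall x, f x <= c.
Proof.
move=> h s x; have : \sum_(y | y != x) c <= \sum_(y | y != x) f y by apply: leq_sum.
move: s; rewrite mulnC -sum_nat_const (bigD1 x) //= [\sum_x0 c](bigD1 x) //=; lia.
Qed.

Definition rank_of (ex ey ez : bool) (o : I * J * T) (wx wy wz : nat) i j t : nat :=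
  wx * pos ex o.1.1 i + wy * pos ey o.1.2 j + wz * pos ez o.2 t.

End Growth.


Section StripLex.
Variables p q r k s : nat.
Local Notation I := 'I_p.+2.
Local Notation J := 'I_q.+2.
Local Notation T := 'I_r.+2.
Hypotheses (kI : k <= #|I|) (kJ : k <= #|J|) (kT : k <= #|T|).
Hypotheses (s5 : 5 <= s) (sk : 100 * s ^ 2 <= k).
Local Notation XY := (#|I| * #|J|).

(** The lower bounds [2 * XY], [2 * k] and 2 for the three directions add up to the whole energy.
    Hence each is attained and every line concerned has exactly two boundary edges, that is, it is
    an arc. *)
Lemma energy_equalities (b : I -> J -> T -> bool) j0 t0 :
  #|I| = k -> bad_verticals b = XY -> bad_columns (layer b t0) = #|I| ->
  bad (layer b t0 ^~ j0) -> box_energy b <= 2 * XY + 2 * k + 2 ->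
  [/\ 2 * XY + 2 * k + 2 = box_energy b, forall i j, boundary (b i j) <= 2,
      forall i, boundary (layer b t0 i) <= 2 & boundary (layer b t0 ^~ j0) <= 2].
Proof.
move=> Ik vb cb rb; rewrite /box_energy (bigD1 t0) //= (bigD1 j0) //=.
set A := \sum_i \sum_j _; set B := boundary _; set B' := \sum_(j | _) _.
set C := \sum_i _; set D := \sum_(t | _) _ => e.
have hA : 2 * XY <= A.
  by rewrite -vb big_distrr; apply: leq_sum => i _; apply: sum_boundary_ge.
have hB : 2 <= B by apply: boundary_bad.
have hC : 2 * k <= C.
  by rewrite -[X in _ * X]Ik -cb; apply: sum_boundary_ge.
split.
- by move: e hA hB hC; clearbody A B B' C D; move: XY => n; clear; lia.
- have bads : forall ij : I * J, bad (b ij.1 ij.2).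
    apply: sum_bool_eq_card; rewrite card_prod -vb -(pair_bigA _ (fun i j => nat_of_bool (bad (b i j)))) /=.
    exact: leqnn.
  move=> i j; apply: (@sum_pointwise (I * J)%type (fun ij => boundary (b ij.1 ij.2)) 2 _ _ (i, j)).
    by move=> [u v]; apply/boundary_bad/(bads (u, v)).
  rewrite card_prod -(pair_bigA _ (fun i j => boundary (b i j))) -/A.
  by move: e hA hB hC; clearbody A B B' C D; move: XY => n; clear; lia.
- apply: sum_pointwise => [i|]; last first.
    rewrite -/C Ik; by move: e hA hB hC; clearbody A B B' C D; move: XY => n; clear; lia.
  apply: boundary_bad; apply: (sum_bool_eq_card (P := fun i => bad (layer b t0 i))).
  by rewrite -[X in X <= _]cb leqnn.
- by rewrite -/B; move: e hA hB hC; clearbody A B B' C D; move: XY => n; clear; lia.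
Qed.

Lemma rank_lt (X Y x y z x' y' z' : nat) : x < X -> x' < X -> y < Y -> y' < Y ->
  (x + X * y + X * Y * z < x' + X * y' + X * Y * z') =
  (z < z') || (z == z') && ((y < y') || (y == y') && (x < x')).
Proof.
move=> xX xX' yY yY'.
have lex d u v u' v' : u < d -> u' < d -> (u + d * v < u' + d * v') = (v < v') || (v == v') && (u < u').
  move=> h h'; case: (ltngtP v v') => [vv|vv|->] /=; last by rewrite ltn_add2r.
    have : d * v.+1 <= d * v' by rewrite leq_mul2l vv orbT.
    by rewrite mulnS => w; apply/idP; move: w h; clear; lia.
  have : d * v'.+1 <= d * v by rewrite leq_mul2l vv orbT.
  by rewrite mulnS => w; apply/negbTE; rewrite -leqNgt; move: w h'; clear; lia.
have bound u v : u < X -> v < Y -> u + X * v < X * Y.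
  move=> h h'; have : X * v.+1 <= X * Y by rewrite leq_mul2l h' orbT.
  by rewrite mulnS; move: h; clear; lia.
by rewrite lex ?bound // lex.
Qed.

(** The three lines through the new site are arcs that this site prolongs, which gives an origin and
    a direction on each axis. Rows off [j0] and layers off [t0] are constant, so comparing slow
    coordinates first decides membership. *)
Lemma strip_lex (a a' : I -> J -> T -> bool) i0 j0 t0 : adds a a' i0 j0 t0 ->
  box_energy a <= 2 * XY + 2 * k + 2 -> box_energy a' <= 2 * XY + 2 * k + 2 ->
  canonical k a -> canonical k a' -> steep k s #|I| #|J| #|T| (volume a) ->
  bad_columns (layer a t0) = #|I| ->
  [/\ #|I| = k, box_energy a = 2 * XY + 2 * k + 2, box_energy a' = 2 * XY + 2 * k + 2 &
      exists ex ey ez o, forall i j t,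
        a i j t = (rank_of ex ey ez o 1 #|I| XY i j t <
                   rank_of ex ey ez o 1 #|I| XY i0 j0 t0)].
Proof.
move=> ad ea ea' ca ca' st bI.
have [Ik [vb vb'] bI' /andP[rb rb'] [nb tr]] :=
  strip_growth_structure kI kJ kT s5 sk ad ca ca' st bI.
have [<- v2 c2 r2] := energy_equalities Ik vb bI rb ea.
have [<- v2' c2' r2'] := energy_equalities Ik vb' bI' rb' ea'.
split=> //; have [n0 same] := ad.
have flat t u v u' v' : t != t0 -> a u v t = a u' v' t.
  move=> n; case: (trivial_layerP (tr t n)) => z; first by rewrite [LHS]z [RHS]z.
  by apply/esym; rewrite [LHS](negbTE (z _ _)) [RHS](negbTE (z _ _)).
have flat_row j u u' : j != j0 -> a u j t0 = a u' j t0.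
  by move=> n; apply: (nbad_eq (u := layer a t0 ^~ j)); apply: nb.
case/andP: (rb) => /existsP[x1 hx1] /existsP[x2 hx2].
case/andP: (rb') => _ /existsP[x3 hx3].
have [ex [ox [jx [hx hx0]]]] : exists e o j,
    (forall x, a x j0 t0 = (pos e o x < j)) /\ pos e o i0 = j.
  apply: arc_extend => //; last by exists x3; move: hx3; rewrite /layer same !eqxx !andbT.
    rewrite (@eq_boundary _ _ (layer a' t0 ^~ j0)) // => x.
    by rewrite /layer same !eqxx !andbT.
  by exists x1.
have columns_bad i : bad (layer a t0 i).
  by apply: (sum_bool_eq_card (P := fun i => bad (layer a t0 i))); rewrite -[X in X <= _]bI.
(* The line through the new site, with [j0] added, coincides with the line through [x1], a site of
   the same row that is already occupied; both are arcs of the old region [a]. *)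
have [ey [oy [jy [hy hy0]]]] : exists e o j,
    (forall y, (y != j0) && a i0 y t0 = (pos e o y < j)) /\ pos e o j0 = j.
  apply: arc_extend; rewrite ?eqxx //.
  - rewrite (@eq_boundary _ _ (layer a t0 i0)) // => y.
    by have [->|//] := eqVneq y j0; rewrite /layer (negbTE n0).
  - rewrite (@eq_boundary _ _ (layer a t0 x1)) // => y.
    have [->|n] := eqVneq y j0; first by rewrite orbT [RHS]hx1.
    by rewrite orbF; apply: flat_row.
  - case/andP: (columns_bad i0) => /existsP[y hy] _; exists y; rewrite [a _ _ _]hy andbT.
    by apply: contraNneq n0 => <-.
  - case/andP: (columns_bad x1) => _ /existsP[y hy]; exists y.
    have n : y != j0 by apply: contraNneq hy => ->; apply: hx1.
    by rewrite (negbTE n) (flat_row _ _ x1) // orbF.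
have vert i j : bad (a i j).
  have := @sum_bool_eq_card _ (fun ij : I * J => bad (a ij.1 ij.2)).
  rewrite card_prod -vb -(pair_bigA _ (fun i j => nat_of_bool (bad (a i j)))) leqnn.
  by move=> /(_ isT (i, j)).
have [ez [oz [jz [hz hz0]]]] : exists e o j,
    (forall z, (z != t0) && a i0 j0 z = (pos e o z < j)) /\ pos e o t0 = j.
  apply: arc_extend; rewrite ?eqxx //.
  - rewrite (@eq_boundary _ _ (a i0 j0)) // => z.
    by have [->|//] := eqVneq z t0; rewrite (negbTE n0).
  - rewrite (@eq_boundary _ _ (a x1 j0)) // => z.
    have [->|n] := eqVneq z t0; first by rewrite orbT [RHS]hx1.
    by rewrite orbF; apply: flat.
  - case/andP: (vert i0 j0) => /existsP[z hz] _; exists z; rewrite hz andbT.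
    by apply: contraNneq n0 => <-.
  - case/andP: (vert x1 j0) => _ /existsP[z hz]; exists z.
    have n : z != t0 by apply: contraNneq hz => ->; apply: hx1.
    by rewrite (negbTE n) (flat _ _ _ x1 j0) // orbF.
exists ex, ey, ez, (ox, oy, oz) => i j t; rewrite /rank_of /= !mul1n.
rewrite rank_lt ?card_ord ?pos_lt // -?card_ord.
rewrite hx0 hy0 hz0 -hz -hy -hz0 -hy0 (inj_eq (@pos_inj _ ez oz)) (inj_eq (@pos_inj _ ey oy)).
have [->|n] /= := eqVneq t t0; last by rewrite orbF; apply: flat.
have [->|n'] /= := eqVneq j j0; first exact: hx.
by rewrite orbF; apply: flat_row.
Qed.

End StripLex.


(** * The Hamiltonian as a sum over lines *)

Section Hamiltonian.
Variables (q K L M : nat).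
Hypotheses (K3 : 2 < K) (L3 : 2 < L) (M3 : 2 < M).
Implicit Types (x y : site K L M) (sigma : config q K L M).
Local Open Scope ring_scope.

Definition shift (d : 'I_3) x : site K L M :=
  match nat_of_ord d with
  | 0%N => (x.1.1 + 1, x.1.2, x.2)
  | 1%N => (x.1.1, x.1.2 + 1, x.2)
  | _ => (x.1.1, x.1.2, x.2 + 1)
  end.

Lemma I3_ind (P : 'I_3 -> Prop) : P (inord 0) -> P (inord 1) -> P (inord 2) -> forall d, P d.
Proof.
move=> p0 p1 p2 d; have := inord_val d; case: d => -[|[|[|//]]] h /= <- //.
Qed.

Lemma neighbour_shift x y :
  neighbour x y = [exists d, (y == shift d x) || (x == shift d y)].
Proof.
case: x => [[x1 x2] x3]; case: y => [[y1 y2] y3]; rewrite /neighbour /Defs.adjacent.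
apply/idP/existsP => [/or3P[]|[]].
- case/and3P => /orP[] /eqP -> /eqP -> /eqP ->.
    by exists (inord 0); rewrite /shift inordK //= eqxx.
  by exists (inord 0); rewrite /shift inordK //= eqxx orbT.
- case/and3P => /eqP -> /orP[] /eqP -> /eqP ->.
    by exists (inord 1); rewrite /shift inordK //= eqxx.
  by exists (inord 1); rewrite /shift inordK //= eqxx orbT.
- case/and3P => /eqP -> /eqP -> /orP[] /eqP ->.
    by exists (inord 2); rewrite /shift inordK //= eqxx.
  by exists (inord 2); rewrite /shift inordK //= eqxx orbT.
elim/I3_ind; rewrite /shift inordK //= => /orP[] /eqP[-> -> ->]; rewrite !eqxx ?orbT /= ?orbT //.
Qed.

Lemma Zp_plus1 n (i : 'Z_n) : (i + 1 == i) = false.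
Proof. by rewrite -[X in _ == X]addr0 (inj_eq (addrI i)) oner_eq0. Qed.

Lemma Zp_plus2 n (i : 'Z_n) : (2 < n)%N -> (i + 1 + 1 == i) = false.
Proof.
move=> n2; rewrite -addrA -[X in _ == X]addr0 (inj_eq (addrI i)).
apply/negbTE/eqP => /(congr1 val) /=.
by rewrite Zp_cast ?(ltnW n2) // !modn_small // ?(ltnW n2).
Qed.

Lemma shift_neq d x : shift d x != x.
Proof.
case: x => [[x1 x2] x3]; elim/I3_ind: d; rewrite /shift inordK //= !xpair_eqE Zp_plus1 ?andbF //.
Qed.

Lemma shift_inj1 d d' x : shift d x = shift d' x -> d = d'.
Proof.
case: x => [[x1 x2] x3]; elim/I3_ind: d; elim/I3_ind: d'; rewrite /shift !inordK //= => -[] //.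
all: move/eqP; rewrite ?Zp_plus1 //; try by rewrite eq_sym Zp_plus1.
Qed.

Lemma shift_shift d d' x : shift d (shift d' x) != x.
Proof.
case: x => [[x1 x2] x3]; elim/I3_ind: d; elim/I3_ind: d'; rewrite /shift !inordK //= !xpair_eqE.
all: by rewrite ?Zp_plus2 ?Zp_plus1 ?andbF.
Qed.

Definition edge_set (e : 'I_3 * site K L M) : {set site K L M} :=
  [set e.2; shift e.1 e.2]%SET.

(** This is where sides longer than 2 are needed: on a cycle of length 2 the step from [x] and the
    step back form the same pair. *)
Lemma edge_set_inj : injective edge_set.
Proof.
move=> [d x] [d' y]; rewrite /edge_set /= => e.
have : x \in [set y; shift d' y]%SET by rewrite -e !inE eqxx.
have : shift d x \in [set y; shift d' y]%SET by rewrite -e !inE eqxx orbT.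
rewrite !inE => h /orP[/eqP xy|/eqP xy].
  move: h; rewrite -xy (negbTE (shift_neq _ _)) /= => /eqP /shift_inj1 ->.
  by rewrite xy.
move: h; rewrite xy => /orP[|]; first by rewrite (negbTE (shift_shift _ _ _)).
by rewrite (negbTE (shift_neq _ _)).
Qed.

Lemma hamiltonian_sum sigma :
  hamiltonian sigma = (\sum_d \sum_x (sigma x != sigma (shift d x)))%N.
Proof.
rewrite /hamiltonian.
have -> : [set [set e.1; e.2] | e : site K L M * site K L M &
    neighbour e.1 e.2 && (sigma e.1 != sigma e.2)]%SET =
  (edge_set @: [set e | sigma e.2 != sigma (shift e.1 e.2)])%SET.
  apply/setP => A; apply/imsetP/imsetP => [[[x y]]|[[d x]]].
    rewrite inE /= neighbour_shift => /andP[/existsP[d /orP[] /eqP h] sxy] ->.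
      by exists (d, x); rewrite ?inE /= -?h // /edge_set /= h.
    by exists (d, y); rewrite ?inE /= -?h 1?eq_sym // /edge_set /= -h finset.setUC.
  rewrite inE /= => h ->; exists (x, shift d x) => //; rewrite inE /= neighbour_shift h andbT.
  by apply/existsP; exists d; rewrite eqxx.
rewrite card_imset; last exact: edge_set_inj.
rewrite pair_bigA /= -sum1_card big_mkcond /=.
by apply: eq_bigr => e _; rewrite inE; case: (_ != _).
Qed.

End Hamiltonian.

Section Energy.
Variables (K L M : nat).
Local Notation box := ('Z_K -> 'Z_L -> 'Z_M -> bool).
Implicit Types (a : box).

Definition line_energy a : nat :=
  \sum_d \sum_x (a x.1.1 x.1.2 x.2 !=
    a (@shift K L M d x).1.1 (shift d x).1.2 (shift d x).2).

Lemma sum_site (F : 'Z_K -> 'Z_L -> 'Z_M -> nat) :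
  \sum_(x : site K L M) F x.1.1 x.1.2 x.2 = \sum_i \sum_j \sum_t F i j t.
Proof.
by rewrite (pair_bigA _ (fun i j => \sum_t F i j t)) (pair_bigA _ (fun p t => F p.1 p.2 t)).
Qed.

Lemma line_energyE a : line_energy a = box_energy a.
Proof.
rewrite /line_energy !big_ord_recl big_ord0 addn0 /shift /=.
rewrite (sum_site (fun i j t => nat_of_bool (a i j t != a (i + 1)%R j t))).
rewrite (sum_site (fun i j t => nat_of_bool (a i j t != a i (j + 1)%R t))).
rewrite (sum_site (fun i j t => nat_of_bool (a i j t != a i j (t + 1)%R))).
rewrite /box_energy big_split /= addnA addnC; congr (_ + (_ + _)).
  rewrite exchange_big /=; under eq_bigr do rewrite exchange_big /=.
  by rewrite exchange_big.
by under eq_bigr do rewrite exchange_big /=; rewrite exchange_big.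
Qed.

End Energy.


(** * Lexicographic sets *)

Lemma box_energy_axes p q r (a : 'I_p.+2 -> 'I_q.+2 -> 'I_r.+2 -> bool) :
  box_energy a = \sum_i \sum_j boundary (a i j) +
  (\sum_j \sum_t boundary (fun i => a i j t) + \sum_i \sum_t boundary (fun j => a i j t)).
Proof.
by rewrite /box_energy big_split /=; congr (_ + (_ + _)); rewrite exchange_big.
Qed.

Section BoxViews.
Variables p q r : nat.
Local Notation I := 'I_p.+2.
Local Notation J := 'I_q.+2.
Local Notation T := 'I_r.+2.
Implicit Type a : I -> J -> T -> bool.

Definition transp (X Y Z : Type) (a : X -> Y -> Z -> bool) : Y -> X -> Z -> bool :=
  fun j i t => a i j t.

Lemma box_energy_view2 a : box_energy (view2 a) = box_energy a.
Proof.
have e : \sum_t \sum_j boundary (fun i => a i j t) = \sum_j \sum_t boundary (fun i => a i j t).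
  by rewrite exchange_big.
by rewrite !box_energy_axes -e [LHS]addnC [LHS]addnAC [LHS]addnC.
Qed.

Lemma box_energy_transp a : box_energy (transp a) = box_energy a.
Proof.
have e : \sum_i \sum_j boundary (a i j) = \sum_j \sum_i boundary (a i j).
  by rewrite exchange_big.
by rewrite !box_energy_axes e; congr addn; rewrite addnC.
Qed.

Lemma area_transp (X Y Z : finType) (b : X -> Y -> Z -> bool) t :
  area (layer (transp b) t) = area (layer b t).
Proof. by rewrite area_rows. Qed.

Lemma volume_transp (X Y Z : finType) (b : X -> Y -> Z -> bool) :
  volume (transp b) = volume b.
Proof. by rewrite !volume_layers; apply: eq_bigr => t _; rewrite area_transp. Qed.

Lemma canonical_transp k (X Y Z : finType) (b : X -> Y -> Z -> bool) :
  canonical k b -> canonical k (transp b).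
Proof.
case/existsP => t0 /and3P[tr c st]; apply/existsP; exists t0; apply/and3P; split.
- apply/forallP => t; apply/implyP => n; move/forallP/(_ t): tr; rewrite n /=.
  by rewrite /trivial_layer area_transp -(area_transp (boxC b)).
- by move: c; rewrite /cost addnC.
- by rewrite /strip orbC.
Qed.

Lemma adds_transp (X Y Z : finType) (b b' : X -> Y -> Z -> bool) i0 j0 t0 :
  adds b b' i0 j0 t0 -> adds (transp b) (transp b') j0 i0 t0.
Proof. by move=> [n h]; split=> // j i t; rewrite [LHS]h andbCA. Qed.

(** A strip has all columns or all rows bad; the second case is the first one for the transposed
    region. The alternative records which horizontal axis is the fast one. *)
Lemma box_growth k s a a' i0 j0 t0 : k <= #|I| -> k <= #|J| -> k <= #|T| ->
  5 <= s -> 100 * s ^ 2 <= k -> adds a a' i0 j0 t0 ->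
  box_energy a <= 2 * (#|I| * #|J|) + 2 * k + 2 ->
  box_energy a' <= 2 * (#|I| * #|J|) + 2 * k + 2 ->
  canonical k a -> canonical k a' -> steep k s #|I| #|J| #|T| (volume a) ->
  [/\ box_energy a = 2 * (#|I| * #|J|) + 2 * k + 2,
      box_energy a' = 2 * (#|I| * #|J|) + 2 * k + 2 &
      exists ex ey ez ox oy oz,
      let rk w1 w2 i j t := w1 * pos ex ox i + w2 * pos ey oy j + #|I| * #|J| * pos ez oz t in
      (#|I| = k /\ forall i j t, a i j t = (rk 1 k i j t < rk 1 k i0 j0 t0)) \/
      (#|J| = k /\ forall i j t, a i j t = (rk k 1 i j t < rk k 1 i0 j0 t0))].
Proof.
move=> kI kJ kT s5 sk ad ea ea' c c' st.
have [i [sa _ _ _ _]] := growth_layer kI kJ kT s5 sk ad c c' st.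
case/orP: sa => /eqP e.
  have [|||h1 h2 h3 [ey [ex [ez [[[oy ox] oz] h]]]]] := @strip_lex q p r k s kJ kI kT s5 sk
    _ _ _ _ _ (adds_transp ad) _ _ (canonical_transp c) (canonical_transp c') _ e.
  - by rewrite box_energy_transp [#|J| * _]mulnC.
  - by rewrite box_energy_transp [#|J| * _]mulnC.
  - by move: st; rewrite volume_transp /steep [#|J| * _]mulnC.
  move: h2 h3; rewrite !box_energy_transp [#|J| * _]mulnC => -> ->; split=> //.
  exists ex, ey, ez, ox, oy, oz; right; split=> // u v w.
  rewrite -[LHS]/(transp a v u w) h /rank_of /= h1 [k * #|I|]mulnC.
  by rewrite ![1 * _ + k * _]addnC.
have [h1 -> -> [ex [ey [ez [[[ox oy] oz] h]]]]] := strip_lex kI kJ kT s5 sk ad ea ea' c c' st e.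
split=> //; exists ex, ey, ez, ox, oy, oz; left; split=> // u v w.
by rewrite h /rank_of /= h1.
Qed.

End BoxViews.

Lemma box_energy_view1 p q r (a : 'I_p.+2 -> 'I_q.+2 -> 'I_r.+2 -> bool) :
  box_energy (view1 a) = box_energy a.
Proof. by rewrite -[view1 a]/(view2 (transp a)) box_energy_view2 box_energy_transp. Qed.

Lemma sum_bool_le1 (X : finType) (P : X -> bool) :
  (forall x y, P x -> P y -> x = y) -> \sum_x P x <= 1.
Proof.
move=> h; have [z hz|none] := pickP P; last by rewrite big1 // => z _; rewrite none.
rewrite (bigD1 z) //= hz big1 // => w wz; apply/eqP; rewrite eqb0.
by apply: contraNN wz => hw; rewrite (h w z).
Qed.

Section Monotone.
Variable p : nat.

(** An initial segment of positions changes value only at its end and at the origin. *)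
Lemma boundary_mono (P : pred nat) e (o : 'I_p.+2) :
  (forall i, P i.+1 -> P i) -> boundary (fun x => P (pos e o x)) <= 2 * bad (fun x => P (pos e o x)).
Proof.
wlog -> : e o / e = true => [hw|].
  case: e; first exact: hw.
  have flip x : pos false o (- x)%R = pos true (- o)%R x by rewrite /pos !opprK addrC.
  move=> mono; rewrite -boundary_opp.
  have -> : bad (fun x => P (pos false o x)) = bad (fun x => P (pos true (- o)%R x)).
    congr andb; apply/existsP/existsP => -[x h]; exists (- x)%R.
    - by rewrite -flip opprK.
    - by rewrite flip.
    - by rewrite -flip opprK.
    - by rewrite flip.
  rewrite (@eq_boundary _ _ (fun x => P (pos true (- o)%R x))); first exact: hw.
  by move=> x; rewrite flip.
move=> mono; have mono' i j : i <= j -> P j -> P i.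
  by move/subnK <-; elim: (j - i) => // d IH; rewrite addSn => /mono.
case: (boolP (bad _)) => [|nb]; last first.
  rewrite muln0 leqn0; apply/eqP/big1 => x _.
  by rewrite (nbad_eq (u := fun x => P (pos true o x)) x (x + 1)%R nb) eqxx.
case/andP => /existsP[x hx] /existsP[y hy]; rewrite muln1.
have exN : exists i, ~~ P i by exists (pos true o y).
have [m Pm mmin] := ex_minnP exN.
have PE i : P i = (i < m).
  case: (ltnP i m) => h; first by apply/negPn/negP => /mmin; rewrite leqNgt h.
  by apply/negP => /(mono' _ _ h); rewrite (negbTE Pm).
apply: (@leq_trans (\sum_(x : 'I_p.+2) ((pos true o x == m.-1) + (pos true o x == p.+1)))).
  apply: leq_sum => z _; rewrite !PE /pos.
  have -> : (z + 1 - o = (z - o) + 1)%R by rewrite addrAC.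
  move: (z - o)%R => w; have := ltn_ord w; rewrite /= [1 %% p.+2]modn_small // addn1 leq_eqVlt.
  rewrite eqSS => /orP[/eqP ->|h]; first by rewrite eqxx (leq_trans (leq_b1 _)) // leq_addl.
  rewrite modn_small //; case: (ltnP w m) => h1; case: (ltnP w.+1 m) => h2 //=.
    by have -> : w == m.-1 :> nat; [move: h1 h2; clear; lia|].
  by move: h1 h2; clear; lia.
rewrite big_split /=; have one c : \sum_(z : 'I_p.+2) (pos true o z == c) <= 1.
  by apply: sum_bool_le1 => x' y' /eqP hx' /eqP hy'; apply: (@pos_inj _ true o); rewrite hx' hy'.
exact: (leq_add (one _) (one _)).
Qed.

End Monotone.

Section RankEnergy.
Variables p q r : nat.
Local Notation I := 'I_p.+2.
Local Notation J := 'I_q.+2.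
Local Notation T := 'I_r.+2.

(** Each vertical line has at most two boundary edges. Along the second axis only lines of a single
    layer are bad, and along the first axis only a single line is: these account for the three
    terms. *)
Lemma rank_energy ex ey ez (ox : I) (oy : J) (oz : T) n :
  box_energy (fun i j t => pos ex ox i + p.+2 * pos ey oy j + p.+2 * q.+2 * pos ez oz t < n) <=
  2 * (p.+2 * q.+2) + 2 * p.+2 + 2.
Proof.
set a := fun _ _ _ => _; rewrite box_energy_axes -!addnA.
have px := pos_lt ex ox; have py := pos_lt ey oy; have pz := pos_lt ez oz.
have mul_lt (X : nat) u v : u < v -> X * u + X <= X * v by move=> h; rewrite addnC -mulnS leq_mul2l h orbT.
apply: leq_add; last rewrite addnC; last apply: leq_add.
- apply: (@leq_trans (\sum_(i : I) \sum_(j : J) 2)); last first.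
    by rewrite !sum_nat_const !card_ord; clear; lia.
  apply: leq_sum => i _; apply: leq_sum => j _.
  have := @boundary_mono r (fun z => pos ex ox i + p.+2 * pos ey oy j + p.+2 * q.+2 * z < n) ez oz.
  move=> h; apply: leq_trans (h _) _ => [z|]; last by case: (bad _).
  by apply: leq_trans; rewrite ltnS leq_add2l leq_mul2l leqnSn orbT.
- apply: (@leq_trans (\sum_(i : I) 2)); last by rewrite !sum_nat_const !card_ord mulnC.
  apply: leq_sum => i _.
  apply: (@leq_trans (\sum_t 2 * bad (fun j => a i j t))).
    apply: leq_sum => t _.
    apply: (@boundary_mono q (fun y => pos ex ox i + p.+2 * y + p.+2 * q.+2 * pos ez oz t < n) ey oy) => y.
    by apply: leq_trans; rewrite ltnS leq_add2r leq_add2l leq_mul2l leqnSn orbT.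
  rewrite -big_distrr /= -[X in _ <= X]muln1 leq_mul2l /=.
  apply: sum_bool_le1 => t t' /andP[/existsP[y1 h1] /existsP[y2 h2]] /andP[/existsP[y3 h3] /existsP[y4 h4]].
  apply: (@pos_inj _ ez oz); have [lt|lt|//] := ltngtP (pos ez oz t) (pos ez oz t').
    have := mul_lt (p.+2 * q.+2) _ _ lt; move: h3 h2; rewrite /a -leqNgt.
    have := mul_lt p.+2 _ _ (py y2); have := px i; clear; lia.
  have := mul_lt (p.+2 * q.+2) _ _ lt; move: h1 h4; rewrite /a -leqNgt.
  have := mul_lt p.+2 _ _ (py y4); have := px i; clear; lia.
apply: (@leq_trans (\sum_(jt : J * T) 2 * bad (fun i => a i jt.1 jt.2))).
  rewrite (pair_bigA _ (fun j t => boundary (fun i => a i j t))); apply: leq_sum => -[j t] _ /=.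
  apply: (@boundary_mono p (fun x => x + p.+2 * pos ey oy j + p.+2 * q.+2 * pos ez oz t < n) ex ox) => x.
  by apply: leq_trans; rewrite ltnS !leq_add2r.
rewrite -big_distrr /= -[X in _ <= X]muln1 leq_mul2l /=.
apply: sum_bool_le1 => -[j t] [j' t'] /andP[/existsP[x1 h1] /existsP[x2 h2]] /andP[/existsP[x3 h3] /existsP[x4 h4]].
rewrite /a /= -!leqNgt in h1 h2 h3 h4.
have key u v u' v' : u + q.+2 * v < u' + q.+2 * v' ->
    p.+2 * u + p.+2 * q.+2 * v + p.+2 <= p.+2 * u' + p.+2 * q.+2 * v'.
  by move=> /(mul_lt p.+2); rewrite (mulnDr p.+2 u) (mulnDr p.+2 u') !mulnA.
have e : pos ey oy j + q.+2 * pos ez oz t = pos ey oy j' + q.+2 * pos ez oz t'.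
  have [/key lt|/key lt|//] := 
    ltngtP (pos ey oy j + q.+2 * pos ez oz t) (pos ey oy j' + q.+2 * pos ez oz t').
    by move: lt h3 h2 (px x2); clear; lia.
  by move: lt h1 h4 (px x4); clear; lia.
have ez' : pos ez oz t = pos ez oz t'.
  have [/(mul_lt q.+2) lt|/(mul_lt q.+2) lt|//] := ltngtP (pos ez oz t) (pos ez oz t').
    by move: lt e (py j); clear; lia.
  by move: lt e (py j'); clear; lia.
by move: e; rewrite ez' => /addIn /(@pos_inj _ ey oy) ->; rewrite (pos_inj ez').
Qed.

End RankEnergy.


Section LexPaths.
Variables K L M : nat.
Hypotheses (K3 : 2 < K) (L3 : 2 < L) (M3 : 2 < M).
Local Notation site := (site K L M).

(* A path fills the torus in lexicographic order, starting from a corner, with a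
   direction on each axis and an order of the axes, from fastest to slowest. *)
Definition lexpath : finType := ('I_6 * (bool * bool * bool) * site)%type.

Definition axes (T : Type) (c : 'I_6) (u : T * T * T) : T * T * T :=
  let: (x, y, z) := u in
  match nat_of_ord c with
  | 0 => (x, y, z) | 1 => (y, x, z) | 2 => (x, z, y)
  | 3 => (z, x, y) | 4 => (y, z, x) | _ => (z, y, x)
  end.

Definition weights (c : 'I_6) : nat * nat * nat :=
  match nat_of_ord c with
  | 0 => (1, K, K * L) | 1 => (K, 1, K * L) | 2 => (1, K * L, K)
  | 3 => (K, K * L, 1) | 4 => (K * L, 1, K) | _ => (K * L, K, 1)
  end.

(** The reordered axes have the same side lengths, so [K] and [K * L] are the correct place values
    in [weights]. *)
Definition allowed (c : 'I_6) : bool := axes c (K, L, M) == (K, L, M).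

Definition position (w : lexpath) (x : site) : nat * nat * nat :=
  (pos w.1.2.1.1 w.2.1.1 x.1.1, pos w.1.2.1.2 w.2.1.2 x.1.2, pos w.1.2.2 w.2.2 x.2).

Definition rank (w : lexpath) (x : site) : nat :=
  let: (u, v, t) := weights w.1.1 in let: (i, j, l) := position w x in u * i + v * j + t * l.

Definition lexset (w : lexpath) (n : nat) : 'Z_K -> 'Z_L -> 'Z_M -> bool :=
  fun i j t => rank w (i, j, t) < n.

Lemma rank_axes w x : rank w x =
  let: (i, j, l) := axes w.1.1 (position w x) in i + K * j + K * L * l.
Proof.
case: w => [[c e] o]; rewrite /rank /weights /axes /position /=.
by case: c => -[|[|[|[|[|[|//]]]]]] _ /=; lia.
Qed.

Lemma allowed_axes c : allowed c ->
  let: (x, y, z) := axes c (K, L, M) in [/\ x = K, y = L & z = M].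
Proof. by rewrite /allowed; case: (axes _ _) => [[x y] z] /eqP[-> -> ->]. Qed.

Lemma axes_lt (c : 'I_6) i j l : allowed c -> i < K -> j < L -> l < M ->
  let: (i', j', l') := axes c (i, j, l) in [&& i' < K, j' < L & l' < M].
Proof.
move/allowed_axes; rewrite /axes.
case: c => -[|[|[|[|[|[|//]]]]]] _ /= [e1 e2 e3] h1 h2 h3; apply/and3P; split; lia.
Qed.

Lemma position_lt w x : let: (i, j, l) := position w x in [&& i < K, j < L & l < M].
Proof.
have lt n e (o y : 'Z_n) : 2 < n -> pos e o y < n.
  by move=> n2; apply: leq_trans (pos_lt e o y) _; rewrite Zp_cast // ltnW.
by rewrite /position !lt.
Qed.

Lemma position_inj w : injective (position w).
Proof. by move=> [[x y] z] [[x' y'] z'] [] /pos_inj -> /pos_inj -> /pos_inj ->. Qed.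

Lemma axes_inj (T : Type) c : injective (@axes T c).
Proof. by move=> [[x y] z] [[x' y'] z']; rewrite /axes; case: c => -[|[|[|[|[|[|//]]]]]] _ /= [-> -> ->]. Qed.

Lemma digits_lt i j l : i < K -> j < L -> l < M -> i + K * j + K * L * l < K * L * M.
Proof.
move=> iK jL lM; have h1 : K * j.+1 <= K * L by rewrite leq_mul2l jL orbT.
have h2 : K * L * l.+1 <= K * L * M by rewrite leq_mul2l lM orbT.
by move: h1 h2; rewrite !mulnS; move: iK; clear; lia.
Qed.

Lemma digits_inj i j l i' j' l' : i < K -> i' < K -> j < L -> j' < L ->
  i + K * j + K * L * l = i' + K * j' + K * L * l' -> (i, j, l) = (i', j', l').
Proof.
move=> iK iK' jL jL' e.
have K0 : 0 < K by apply: leq_trans K3. have L0 : 0 < L by apply: leq_trans L3.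
rewrite -!addnA -!mulnA -!mulnDr in e.
have ei : i = i' by have := congr1 (modn^~ K) e; rewrite /= ![_ + K * _]addnC ![K * _]mulnC !modnMDl !modn_small.
have e2 : j + L * l = j' + L * l' by apply/eqP; rewrite -(eqn_pmul2l K0) -(eqn_add2l i) {2}ei e.
have ej : j = j' by have := congr1 (modn^~ L) e2; rewrite /= ![_ + L * _]addnC ![L * _]mulnC !modnMDl !modn_small.
by move: e2; rewrite ej => /addnI /eqP; rewrite eqn_pmul2l // => /eqP ->; rewrite ei.
Qed.

Section Allowed.
Variable w : lexpath.
Hypothesis aw : allowed w.1.1.

Let ax x : let: (i, j, l) := axes w.1.1 (position w x) in [&& i < K, j < L & l < M].
Proof.
have := position_lt w x; case: (position w x) => [[i j] l] /and3P[h1 h2 h3].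
exact: axes_lt.
Qed.

Lemma rank_lt_volume x : rank w x < K * L * M.
Proof.
rewrite rank_axes; have := ax x; case: (axes _ _) => [[i j] l] /and3P[h1 h2 h3].
exact: digits_lt.
Qed.

Lemma rank_inj : injective (rank w).
Proof.
move=> x y; rewrite !rank_axes => h; apply/(@position_inj w)/(@axes_inj _ w.1.1).
move: h (ax x) (ax y); case: (axes _ _) => [[i j] l]; case: (axes _ _) => [[i' j'] l'].
by move=> h /and3P[h1 h2 _] /and3P[h1' h2' _]; apply: digits_inj.
Qed.

Lemma card_site : #|{: site}| = K * L * M.
Proof. by rewrite !card_prod !card_ord !Zp_cast // ltnW. Qed.

Lemma rank_surj n : n < K * L * M -> exists x, rank w x = n.
Proof.
move=> nN; pose f x : 'I_(K * L * M) := Ordinal (rank_lt_volume x).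
have finj : injective f by move=> x y /(congr1 val) /rank_inj.
have [g fg gf] := inj_card_bij finj (eq_leq (etrans (card_ord _) (esym card_site))).
by exists (g (Ordinal nN)); have := congr1 val (gf (Ordinal nN)).
Qed.

Lemma lexset_energy n : box_energy (lexset w n) <= 2 * (K * L) + 2 * K + 2.
Proof.
have key p q r (X Y : nat) (f : 'I_p.+2 -> 'I_q.+2 -> 'I_r.+2 -> bool) ex ey ez ox oy oz :
    X = p.+2 -> Y = q.+2 ->
    f = (fun i j t => pos ex ox i + X * pos ey oy j + X * Y * pos ez oz t < n) ->
    box_energy f <= 2 * (X * Y) + 2 * X + 2.
  by move=> -> -> ->; apply: rank_energy.
have cK : K = (Zp_trunc K).+2 by rewrite Zp_cast // ltnW.
have cL : L = (Zp_trunc L).+2 by rewrite Zp_cast // ltnW.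
have cM : M = (Zp_trunc M).+2 by rewrite Zp_cast // ltnW.
case: w aw => [[c [[ex ey] ez]] [[ox oy] oz]] /allowed_axes.
rewrite /axes /lexset /rank /weights /position /=.
case: c => -[|[|[|[|[|[|//]]]]]] _ /= [e1 e2 e3].
- by apply: (key _ _ _ K L _ ex ey ez ox oy oz cK cL); do 3![apply: funext => ?]; congr (_ < _); lia.
- rewrite -box_energy_transp.
  apply: (key _ _ _ K L _ ey ex ez oy ox oz); try by rewrite Zp_cast; lia.
  by do 3![apply: funext => ?]; rewrite /transp; congr (_ < _); lia.
- rewrite -box_energy_view2.
  apply: (key _ _ _ K L _ ex ez ey ox oz oy); try by rewrite Zp_cast; lia.
  by do 3![apply: funext => ?]; rewrite /view2; congr (_ < _); lia.
- rewrite -box_energy_view2 -box_energy_transp.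
  apply: (key _ _ _ K L _ ez ex ey oz ox oy); try by rewrite Zp_cast; lia.
  by do 3![apply: funext => ?]; rewrite /view2 /transp; congr (_ < _); lia.
- rewrite -box_energy_view1.
  apply: (key _ _ _ K L _ ey ez ex oy oz ox); try by rewrite Zp_cast; lia.
  by do 3![apply: funext => ?]; rewrite /view1; congr (_ < _); lia.
- rewrite -box_energy_view1 -box_energy_transp.
  apply: (key _ _ _ K L _ ez ey ex oz oy ox); try by rewrite Zp_cast; lia.
  by do 3![apply: funext => ?]; rewrite /view1 /transp; congr (_ < _); lia.
Qed.

End Allowed.

End LexPaths.


(** * Recovering a lexicographic path from one of its edges *)

Section Moves.
Variable p : nat.
Local Notation Z := 'I_p.+2.
Local Open Scope ring_scope.

Definition move (e : bool) (x : Z) : Z := if e then x + 1 else x - 1.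

Lemma moveK e : cancel (move (~~ e)) (move e).
Proof. by case: e => x; rewrite /move ?subrK ?addrK. Qed.

Lemma pos_move e o x : pos e o (move e x) = ((pos e o x).+1 %% p.+2)%N.
Proof.
have add1 (y : Z) : (y + 1 : Z) = (y.+1 %% p.+2)%N :> nat.
  by rewrite /= [(1 %% p.+2)%N]modn_small // addn1.
rewrite /pos /move; case: e; first by rewrite addrAC add1.
by rewrite opprB addrCA addrC add1.
Qed.

Lemma pos_forward e o x : ((pos e o x).+1 < p.+2)%N -> pos e o (move e x) = (pos e o x).+1.
Proof. by move=> h; rewrite pos_move modn_small. Qed.

Lemma pos_backward e o x : (0 < pos e o x)%N -> pos e o x = (pos e o (move (~~ e) x)).+1.
Proof.
rewrite -{1 2}[x](moveK e) pos_move; set y := pos _ _ _; move=> h.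
have : (y.+1 <= p.+2)%N by apply: pos_lt.
rewrite leq_eqVlt => /orP[/eqP e1|h']; last by rewrite modn_small.
by move: h; rewrite e1 modnn.
Qed.

End Moves.

Section Unique.
Variables K L M : nat.
Hypotheses (K3 : 2 < K) (L3 : 2 < L) (M3 : 2 < M).
Local Notation site := (site K L M).
Local Notation lexpath := (lexpath K L M).
Local Notation rank := (@rank K L M).

(** No digit of [n] is extremal: the site that is added lies away from the seams of the path, and
    the shape around it reveals the path. *)
Definition generic (n : nat) : bool :=
  [&& 0 < n %% K, n %% K + 2 <= K, 0 < n %/ K %% L, n %/ K %% L + 2 <= L,
      0 < n %/ (K * L) & n %/ (K * L) + 2 <= M].

Lemma rank_digits (w : lexpath) x : allowed K L M w.1.1 ->
  axes w.1.1 (position w x) = (rank w x %% K, rank w x %/ K %% L, rank w x %/ (K * L)).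
Proof.
move=> aw; rewrite rank_axes //; have := position_lt K3 L3 M3 w x.
case: (position w x) => [[i0 j0] l0] /and3P[h1 h2 h3].
have := axes_lt K3 L3 M3 aw h1 h2 h3; case: (axes _ _) => [[i j] l] /and3P[iK jL lM].
have K0 : 0 < K by apply: leq_trans K3.
have -> : i + K * j + K * L * l = (j + L * l) * K + i by lia.
have L0 : 0 < L by apply: leq_trans L3.
have d1 : ((j + L * l) * K + i) %/ K = j + L * l by rewrite divnMDl // divn_small // addn0.
rewrite modnMDl modn_small // divnMA d1; congr (_, _, _).
  by rewrite addnC mulnC modnMDl modn_small.
by rewrite addnC mulnC divnMDl // divn_small // addn0.
Qed.

Definition interior (w : lexpath) x : bool :=
  let: (i, j, l) := position w x in
  [&& (0 < i) && (i.+1 < K), (0 < j) && (j.+1 < L) & (0 < l) && (l.+1 < M)].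

Lemma generic_interior w x : allowed K L M w.1.1 -> generic (rank w x) -> interior w x.
Proof.
move=> aw; rewrite /generic /interior; have := rank_digits x aw; have := allowed_axes aw.
rewrite /axes; case: w.1.1 => -[|[|[|[|[|[|//]]]]]] _ /=; case: (position w x) => [[i j] l].
all: by move=> [e1 e2 e3] [<- <- <-] /and5P[h1 h2 h3 h4 /andP[h5 h6]]; lia.
Qed.

Definition at1 (b : bool) (x : site) : site := (move b x.1.1, x.1.2, x.2).
Definition at2 (b : bool) (x : site) : site := (x.1.1, move b x.1.2, x.2).
Definition at3 (b : bool) (x : site) : site := (x.1.1, x.1.2, move b x.2).

Definition signs_at (A : site -> bool) x : bool * bool * bool :=
  (A (at1 false x), A (at2 false x), A (at3 false x)).

(** One step back on an axis and one forward on another leads to an earlier site exactly if the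
    first axis has the larger weight. *)
Definition order_at (e : bool * bool * bool) (A : site -> bool) x : bool * bool * bool :=
  (A (at1 (~~ e.1.1) (at2 e.1.2 x)), A (at1 (~~ e.1.1) (at3 e.2 x)), A (at2 (~~ e.1.2) (at3 e.2 x))).

Lemma weights_gt0 c : let: (u, v, t) := weights K L c in [&& 0 < u, 0 < v & 0 < t].
Proof.
have KL : 0 < K * L by rewrite muln_gt0; lia.
rewrite /weights; case: c => -[|[|[|[|[|[|//]]]]]] _ /=; rewrite ?KL; lia.
Qed.

Section Local.
Variables (w : lexpath) (x : site).
Hypothesis iw : interior w x.

Let pos_Z n (n3 : 2 < n) e (o y : 'Z_n) : (pos e o y).+1 < n -> pos e o (move e y) = (pos e o y).+1.
Proof. by move=> h; apply: pos_forward; rewrite Zp_cast // ltnW. Qed.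

Lemma signs_atP : signs_at (fun y => rank w y < rank w x) x = w.1.2.
Proof.
move: iw (weights_gt0 w.1.1); rewrite /interior /signs_at /rank /position /=.
case: w => [[c [[ex ey] ez]] [[ox oy] oz]] /=; case: (weights K L c) => [[u v] t].
move=> /and3P[/andP[x0 xK] /andP[y0 yL] /andP[z0 zM]] /and3P[u0 v0 t0].
congr (_, _, _).
- case: ex x0 xK => x0 xK; rewrite /at1 /=; last first.
    by rewrite (pos_Z K3 xK) mulnS; apply/negbTE; rewrite -leqNgt; lia.
  by have /= -> := pos_backward x0; rewrite mulnS; lia.
- case: ey y0 yL => y0 yL; rewrite /at2 /=; last first.
    by rewrite (pos_Z L3 yL) mulnS; apply/negbTE; rewrite -leqNgt; lia.
  by have /= -> := pos_backward y0; rewrite mulnS; lia.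
case: ez z0 zM => z0 zM; rewrite /at3 /=; last first.
  by rewrite (pos_Z M3 zM) mulnS; apply/negbTE; rewrite -leqNgt; lia.
by have /= -> := pos_backward z0; rewrite mulnS; lia.
Qed.

Lemma order_atP : let: (u, v, t) := weights K L w.1.1 in
  order_at w.1.2 (fun y => rank w y < rank w x) x = (v < u, t < u, t < v).
Proof.
move: iw; rewrite /interior /order_at /rank /position /=.
case: w => [[c [[ex ey] ez]] [[ox oy] oz]] /=; case: (weights K L c) => [[u v] t].
move=> /and3P[/andP[x0 xK] /andP[y0 yL] /andP[z0 zM]].
have bx := pos_backward x0; have b_y := pos_backward y0; have bz := pos_backward z0.
congr (_, _, _).
- by rewrite [X in _ = X]/= (pos_Z L3 yL) bx !mulnS; lia.
- by rewrite (pos_Z M3 zM) bx !mulnS; lia.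
by rewrite (pos_Z M3 zM) b_y !mulnS; lia.
Qed.

End Local.

Lemma weights_order c c' : let: (u, v, t) := weights K L c in
  let: (u', v', t') := weights K L c' in
  (v < u, t < u, t < v) = (v' < u', t' < u', t' < v') -> c = c'.
Proof.
have K1 : 1 < K by lia. have KL : K < K * L by rewrite ltn_Pmulr; lia.
have L1 : 1 < K * L by lia.
have K1' : K < 1 = false by lia. have KL' : K * L < K = false by lia.
have L1' : K * L < 1 = false by lia.
rewrite /weights; case: c => -[|[|[|[|[|[|//]]]]]] h; case: c' => -[|[|[|[|[|[|//]]]]]] h' /=.
all: rewrite ?K1 ?KL ?L1 ?K1' ?KL' ?L1'.
all: first [by move=> _; apply: val_inj | by []].
Qed.

Lemma pos_origin p e (o o' x : 'I_p.+2) : pos e o x = pos e o' x -> o = o'.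
Proof.
rewrite /pos; case: e => /val_inj; first by move/addrI/oppr_inj.
by move/addIr.
Qed.

(** The neighbours of [x] give the directions, the diagonal neighbours the order of the axes, and
    the digits of the rank of [x] then locate the origin. *)
Lemma lexpath_unique (w w' : lexpath) x :
  allowed K L M w.1.1 -> allowed K L M w'.1.1 -> rank w x = rank w' x -> generic (rank w x) ->
  (forall y, (rank w y < rank w x) = (rank w' y < rank w x)) -> w = w'.
Proof.
move=> aw aw' e g h; have iw := generic_interior aw g.
have iw' : interior w' x by apply: generic_interior => //; rewrite -e.
have hA : (fun y => rank w y < rank w x) = (fun y => rank w' y < rank w' x).
  by apply: funext => y; rewrite h e.
have es : w.1.2 = w'.1.2 by rewrite -(signs_atP iw) -(signs_atP iw') hA.
have ec : w.1.1 = w'.1.1.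
  have := order_atP iw; have := order_atP iw'; rewrite hA es.
  have := weights_order w.1.1 w'.1.1.
  case: (weights K L w.1.1) => [[u v] t]; case: (weights K L w'.1.1) => [[u' v'] t'].
  by move=> wo e1 e2; apply: wo; rewrite -e1 -e2.
have := rank_digits x aw'; rewrite -e -ec -(rank_digits x aw) => /axes_inj.
move: es ec; case: w {aw e g h iw hA} => [[c [[ex ey] ez]] [[ox oy] oz]].
case: w' {aw' iw'} => [[c' [[ex' ey'] ez']] [[ox' oy'] oz']] /= [-> -> ->] -> [].
by move=> /pos_origin -> /pos_origin -> /pos_origin ->.
Qed.

End Unique.


Lemma card_Zn n : 1 < n -> #|'Z_n| = n.
Proof. by move=> h; rewrite card_ord Zp_cast. Qed.

(** * Growth steps lie on lexicographic paths *)

Section GrowthPath.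
Variables (K L M s : nat).
Hypotheses (KL : K <= L) (LM : L <= M) (s5 : 5 <= s) (sK : 100 * s ^ 2 <= K).
Local Notation box := ('Z_K -> 'Z_L -> 'Z_M -> bool).
Implicit Types (a : box).

Let K2500 : 2500 <= K.
Proof. by apply: leq_trans sK; rewrite (@leq_mul 100 25) // (@leq_sqr 5). Qed.
Let K3 : 2 < K. Proof. by apply: leq_trans K2500. Qed.
Let L3 : 2 < L. Proof. exact: leq_trans KL. Qed.
Let M3 : 2 < M. Proof. exact: leq_trans LM. Qed.
Let cK : #|'Z_K| = K. Proof. by rewrite card_Zn // ltnW. Qed.
Let cL : #|'Z_L| = L. Proof. by rewrite card_Zn // ltnW. Qed.
Let cM : #|'Z_M| = M. Proof. by rewrite card_Zn // ltnW. Qed.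

Definition lex_step a i0 j0 t0 : Prop := exists w : lexpath K L M,
  allowed K L M w.1.1 /\ forall i j t, a i j t = (rank w (i, j, t) < rank w (i0, j0, t0)).

Let mk (c : 'I_6) ex ey ez (ox : 'Z_K) (oy : 'Z_L) (oz : 'Z_M) : lexpath K L M :=
  (c, (ex, ey, ez), (ox, oy, oz)).

(** Growth in the second or third view has energy [2 * K * M + 2 * K + 2] or
    [2 * L * M + 2 * K + 2]. This fits into Gamma only if [M = L], respectively [K = L = M], so the
    path found is always an allowed one. *)
Lemma growth_path (R : realFieldType) a a' i0 j0 t0 : adds a a' i0 j0 t0 ->
  box_energy a <= Gamma K L -> box_energy a' <= Gamma K L ->
  [\/ growth R s K a a', growth R s K (view2 a) (view2 a') | growth R s K (view1 a) (view1 a')] ->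
  [/\ box_energy a = Gamma K L, box_energy a' = Gamma K L & lex_step a i0 j0 t0].
Proof.
move=> ad ea ea'; have KM := leq_trans KL LM; rewrite /Gamma in ea ea' *.
have kI : K <= #|'Z_K| by rewrite cK.
have kJ : K <= #|'Z_L| by rewrite cL.
have kT : K <= #|'Z_M| by rewrite cM.
have K0 : 0 < K by apply: leq_trans K3.
have KKL : K * K <= K * L by rewrite leq_mul2l KL orbT.
have KLM : K * L <= K * M by rewrite leq_mul2l LM orbT.
have KMLM : K * M <= L * M by rewrite leq_mul2r KL orbT.
case => -[c c' st _].
- have [|| -> -> [ex [ey [ez [ox [oy [oz h]]]]]]] := box_growth kI kJ kT s5 sK ad _ _ c c' st.
  + by rewrite cK cL mulnA.
  + by rewrite cK cL mulnA.
  rewrite /= cK cL in h *; split; [by rewrite mulnA|by rewrite mulnA|].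
  case: h => [[_ h]|[LK h]].
    exists (mk (inord 0) ex ey ez ox oy oz); rewrite /allowed /axes /= inordK //; split=> // i j t.
    by rewrite h /rank /weights /= inordK.
  exists (mk (inord 1) ex ey ez ox oy oz); rewrite /allowed /axes /= inordK //; split=> [|i j t].
    by rewrite LK.
  by rewrite h /rank /weights /= inordK.
- rewrite -(box_energy_view2 a) -(box_energy_view2 a') in ea ea' *.
  have [|| e1 e2 [ex [ez [ey [ox [oz [oy h]]]]]]] := box_growth kI kT kJ s5 sK (adds_view2 ad) _ _ c c' st.
  + by rewrite cK cM; move: ea KLM; clear; lia.
  + by rewrite cK cM; move: ea' KLM; clear; lia.
  rewrite /= cK cM in h e1 e2.
  have MLe : M = L by apply/eqP; rewrite eqn_leq LM andbT -(leq_pmul2l K0); move: e1 ea; clear; lia.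
  rewrite e1 e2 MLe; split; [by rewrite mulnA|by rewrite mulnA|].
  case: h => [[_ h]|[MK h]].
    exists (mk (inord 2) ex ey ez ox oy oz); rewrite /allowed /axes /= inordK //; split=> [|i j t].
      by rewrite MLe.
    rewrite -[LHS]/(view2 a i t j) h /rank /weights /= inordK // (_ : K * M = K * L) ?MLe //; congr (_ < _); lia.
  exists (mk (inord 3) ex ey ez ox oy oz); rewrite /allowed /axes /= inordK //; split=> [|i j t].
    by rewrite -MLe MK.
  rewrite -[LHS]/(view2 a i t j) h /rank /weights /= inordK // (_ : K * M = K * L) ?MLe //; congr (_ < _); lia.
rewrite -(box_energy_view1 a) -(box_energy_view1 a') in ea ea' *.
have [|| e1 e2 [ey [ez [ex [oy [oz [ox h]]]]]]] := box_growth kJ kT kI s5 sK (adds_view1 ad) _ _ c c' st.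
+ by rewrite cL cM; move: ea KLM KMLM; clear; lia.
+ by rewrite cL cM; move: ea' KLM KMLM; clear; lia.
rewrite /= cL cM in h e1 e2.
have L0 : 0 < L by apply: leq_trans L3.
have MK : M = K by apply/eqP; rewrite eqn_leq KM andbT -(leq_pmul2l L0); move: e1 ea; clear; lia.
have LK : L = K by apply/eqP; rewrite eqn_leq KL andbT -MK.
rewrite e1 e2; split; [by rewrite MK; lia|by rewrite MK; lia|].
case: h => [[_ h]|[_ h]].
  exists (mk (inord 4) ex ey ez ox oy oz); rewrite /allowed /axes /= inordK //; split=> [|i j t].
    by rewrite MK LK.
  rewrite -[LHS]/(view1 a j t i) h /rank /weights /= inordK // (_ : L * M = K * L) ?MK 1?mulnC //; congr (_ < _); lia.
exists (mk (inord 5) ex ey ez ox oy oz); rewrite /allowed /axes /= inordK //; split=> [|i j t].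
  by rewrite MK LK.
rewrite -[LHS]/(view1 a j t i) h /rank /weights /= inordK // (_ : L * M = K * L) ?MK 1?mulnC //; congr (_ < _); lia.
Qed.

Lemma growth_profile (R : realFieldType) a a' i0 j0 t0 : adds a a' i0 j0 t0 ->
  box_energy a <= Gamma K L -> box_energy a' <= Gamma K L ->
  test_function R s a' = test_function R s a \/
  [/\ box_energy a = Gamma K L, box_energy a' = Gamma K L, lex_step a i0 j0 t0 &
      test_function R s a' = (test_function R s a + (profile K s K L M (K * L * M))%:R^-1)%R].
Proof.
move=> ad ea ea'.
have ch (b : box) : box_energy b <= Gamma K L -> cheap #|'Z_K| b.
  by move=> h; apply: cheap_of_energy; rewrite cK cL mulnA.
have IJ : #|'Z_K| <= #|'Z_L| by rewrite cK cL.
have JT : #|'Z_L| <= #|'Z_M| by rewrite cL cM.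
have sK' : 100 * s ^ 2 <= #|'Z_K| by rewrite cK.
have := test_function_step R IJ JT s5 sK' ad (ch _ ea) (ch _ ea'); rewrite cK cL cM.
have KM := leq_trans KL LM; have K0 : 0 < K by apply: leq_trans K3.
have L0 : 0 < L by apply: leq_trans L3.
have KKL : K * K <= K * L by rewrite leq_mul2l KL orbT.
have KLM : K * L <= K * M by rewrite leq_mul2l LM orbT.
have KMLM : K * M <= L * M by rewrite leq_mul2r KL orbT.
case => [->|[g e]|[g e]|[g e]]; first by left.
- by right; have [h1 h2 h3] := growth_path ad ea ea' (Or31 _ _ g).
- right; have [h1 h2 h3] := growth_path ad ea ea' (Or32 _ _ g); split=> //; rewrite e.
  have e1 : box_energy (view2 a) >= 2 * (#|'Z_K| * #|'Z_M|) + 2 * K + 2.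
    have kI : K <= #|'Z_K| by rewrite cK.
    have kJ : K <= #|'Z_L| by rewrite cL.
    have kT : K <= #|'Z_M| by rewrite cM.
    case: g => c c' st _.
    have [|| -> //] := box_growth kI kT kJ s5 sK (adds_view2 ad) _ _ c c' st.
      by rewrite box_energy_view2 cK cM; move: ea KLM; rewrite /Gamma; clear; lia.
    by rewrite box_energy_view2 cK cM; move: ea' KLM; rewrite /Gamma; clear; lia.
  suff eM : M = L by congr (_ + (_%:R)^-1)%R; rewrite eM.
  move: e1; rewrite box_energy_view2 cK cM h1 /Gamma => e1.
  by apply/eqP; rewrite eqn_leq LM andbT -(leq_pmul2l K0); move: e1; clear; lia.
right; have [h1 h2 h3] := growth_path ad ea ea' (Or33 _ _ g); split=> //; rewrite e.
have e1 : box_energy (view1 a) >= 2 * (#|'Z_L| * #|'Z_M|) + 2 * K + 2.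
  have kI : K <= #|'Z_K| by rewrite cK.
  have kJ : K <= #|'Z_L| by rewrite cL.
  have kT : K <= #|'Z_M| by rewrite cM.
  case: g => c c' st _.
  have [|| -> //] := box_growth kJ kT kI s5 sK (adds_view1 ad) _ _ c c' st.
    by rewrite box_energy_view1 cL cM; move: ea KLM KMLM; rewrite /Gamma; clear; lia.
  by rewrite box_energy_view1 cL cM; move: ea' KLM KMLM; rewrite /Gamma; clear; lia.
move: e1; rewrite box_energy_view1 cL cM h1 /Gamma => e1.
have MK : M = K.
  by apply/eqP; rewrite eqn_leq KM andbT -(leq_pmul2l L0); move: e1; clear; lia.
have LK : L = K by apply/eqP; rewrite eqn_leq KL andbT -MK.
by congr (_ + (_%:R)^-1)%R; rewrite MK LK.
Qed.

End GrowthPath.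

(** * From regions of one spin to configurations *)

Section Regions.
Variables (q K L M : nat) (a0 : 'I_q).
Hypotheses (K3 : 2 < K) (L3 : 2 < L) (M3 : 2 < M).
Implicit Types (sigma : config q K L M) (w : lexpath K L M).

Definition region sigma : 'Z_K -> 'Z_L -> 'Z_M -> bool := fun i j t => sigma (i, j, t) == a0.

Lemma regionE sigma x : region sigma x.1.1 x.1.2 x.2 = (sigma x == a0).
Proof. by case: x => [[i j] t]. Qed.

Let jump_le sigma d x :
  (region sigma x.1.1 x.1.2 x.2 != region sigma (shift d x).1.1 (shift d x).1.2 (shift d x).2) <=
  (sigma x != sigma (shift d x)).
Proof. by rewrite !regionE; case: (eqVneq (sigma x) (sigma (shift d x))) => [->|_] /=; rewrite ?eqxx ?leq_b1. Qed.

Lemma region_energy sigma : box_energy (region sigma) <= hamiltonian sigma.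
Proof.
rewrite -line_energyE hamiltonian_sum //.
by apply: leq_sum => d _; apply: leq_sum => x _; apply: jump_le.
Qed.

(** Merging the spins other than [a0] loses the edges between two of them; if no energy is lost,
    there are no such edges. *)
Lemma region_energy_eq sigma : hamiltonian sigma <= box_energy (region sigma) ->
  forall d x, sigma x != a0 -> sigma (shift d x) != a0 -> sigma x = sigma (shift d x).
Proof.
rewrite -line_energyE hamiltonian_sum // => h d x hx hy; apply/eqP/negPn/negP => n.
have : line_energy (region sigma) < \sum_d \sum_x (sigma x != sigma (shift d x)).
  rewrite /line_energy (bigD1 d) //= [ltnRHS](bigD1 d) //= -addSn leq_add //; last first.
    by apply: leq_sum => d' _; apply: leq_sum => y _; apply: jump_le.
  rewrite (bigD1 x) //= [ltnRHS](bigD1 x) //= -addSn leq_add //; last first.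
    by apply: leq_sum => y _; apply: jump_le.
  by rewrite !regionE (negbTE hx) (negbTE hy) n.
by rewrite ltnNge h.
Qed.

Definition lexconf w (n : nat) (b : 'I_q) : config q K L M :=
  [ffun x => if rank w x < n then a0 else b].

Lemma lexconf_energy w n b : allowed K L M w.1.1 -> b != a0 ->
  hamiltonian (lexconf w n b) <= Gamma K L.
Proof.
move=> aw ba; have := lexset_energy K3 L3 M3 aw n; rewrite mulnA; apply: leq_trans.
rewrite -line_energyE hamiltonian_sum //; apply: leq_sum => d _; apply: leq_sum => x _.
rewrite !ffunE /lexset /=.
have -> : rank w (x.1.1, x.1.2, x.2) = rank w x by case: (x) => [[? ?] ?].
have -> : rank w ((shift d x).1.1, (shift d x).1.2, (shift d x).2) = rank w (shift d x).
  by case: (shift d x) => [[? ?] ?].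
by case: (rank w x < n); case: (rank w (shift d x) < n); rewrite ?eqxx ?ba ?[a0 == _]eq_sym ?ba.
Qed.

(** The complement of an initial segment is connected, so the other spins are all equal. *)
Lemma outside_constant sigma w n : allowed K L M w.1.1 ->
  hamiltonian sigma <= box_energy (region sigma) ->
  (forall x, (sigma x == a0) = (rank w x < n)) -> n < K * L * M ->
  exists2 b, b != a0 & sigma = lexconf w n b.
Proof.
move=> aw he hr nN; have eqs := region_energy_eq he.
have out x : n <= rank w x -> sigma x != a0 by rewrite hr -leqNgt.
have up1 b x : n <= rank w x -> n <= rank w (at1 b x) -> sigma x = sigma (at1 b x).
  case: b x => -[[i j] t] /out h1 /out h2.
    by have := eqs (inord 0) (i, j, t); rewrite /shift inordK //; apply.
  have := eqs (inord 0) (at1 false (i, j, t)).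
  by rewrite /shift /at1 /move inordK //= subrK => /(_ h2 h1) ->.
have up2 b x : n <= rank w x -> n <= rank w (at2 b x) -> sigma x = sigma (at2 b x).
  case: b x => -[[i j] t] /out h1 /out h2.
    by have := eqs (inord 1) (i, j, t); rewrite /shift inordK //; apply.
  have := eqs (inord 1) (at2 false (i, j, t)).
  by rewrite /shift /at2 /move inordK //= subrK => /(_ h2 h1) ->.
have up3 b x : n <= rank w x -> n <= rank w (at3 b x) -> sigma x = sigma (at3 b x).
  case: b x => -[[i j] t] /out h1 /out h2.
    by have := eqs (inord 2) (i, j, t); rewrite /shift inordK //; apply.
  have := eqs (inord 2) (at3 false (i, j, t)).
  by rewrite /shift /at3 /move inordK //= subrK => /(_ h2 h1) ->.
(* From any site outside, moving forward along an axis increases the rank and stays outside, until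
   the corner of maximal rank is reached; [m] bounds the distance to the top. *)
have climb m x : K * L * M <= rank w x + m -> n <= rank w x ->
    exists2 t, sigma x = sigma t & position w t = (K.-1, L.-1, M.-1).
  elim: m x => [|m IH] x hm hx; first by have := rank_lt_volume K3 L3 M3 aw x; move: hm; clear; lia.
  have next y : rank w x < rank w y -> sigma x = sigma y ->
      exists2 t, sigma x = sigma t & position w t = (K.-1, L.-1, M.-1).
    move=> xy sxy; have [||t st pt] := IH y; last by exists t; rewrite ?sxy.
      by move: hm xy; clear; lia.
    by move: hx xy; clear; lia.
  have := position_lt K3 L3 M3 w x; have := weights_gt0 K3 L3 M3 w.1.1.
  have posZ N (N3 : 2 < N) e (o y : 'Z_N) : (pos e o y).+1 < N -> pos e o (move e y) = (pos e o y).+1.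
    by move=> h; apply: pos_forward; rewrite Zp_cast // ltnW.
  case: (ltnP (pos w.1.2.1.1 w.2.1.1 x.1.1).+1 K) => h1.
    move=> wt _; have lt : rank w x < rank w (at1 w.1.2.1.1 x).
      rewrite /rank /position /at1 /= (posZ _ K3 _ _ _ h1); move: wt.
      by case: (weights _ _ _) => [[u v] t] /= /and3P[u0 _ _]; rewrite mulnS; move: u0; clear; lia.
    exact: (next _ lt (up1 _ _ hx (leq_trans hx (ltnW lt)))).
  case: (ltnP (pos w.1.2.1.2 w.2.1.2 x.1.2).+1 L) => h2.
    move=> wt _; have lt : rank w x < rank w (at2 w.1.2.1.2 x).
      rewrite /rank /position /at2 /= (posZ _ L3 _ _ _ h2); move: wt.
      by case: (weights _ _ _) => [[u v] t] /= /and3P[_ u0 _]; rewrite mulnS; move: u0; clear; lia.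
    exact: (next _ lt (up2 _ _ hx (leq_trans hx (ltnW lt)))).
  case: (ltnP (pos w.1.2.2 w.2.2 x.2).+1 M) => h3.
    move=> wt _; have lt : rank w x < rank w (at3 w.1.2.2 x).
      rewrite /rank /position /at3 /= (posZ _ M3 _ _ _ h3); move: wt.
      by case: (weights _ _ _) => [[u v] t] /= /and3P[_ _ u0]; rewrite mulnS; move: u0; clear; lia.
    exact: (next _ lt (up3 _ _ hx (leq_trans hx (ltnW lt)))).
  move=> _ /and3P[p1 p2 p3]; exists x => //; rewrite /position.
  by congr (_, _, _); [move: h1 p1|move: h2 p2|move: h3 p3]; clear; lia.
have [z hz] := rank_surj K3 L3 M3 aw nN.
exists (sigma z); first by apply: out; rewrite hz.
apply/ffunP => x; rewrite ffunE; case: ltnP => hx; first by apply/eqP; rewrite hr.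
have [t -> pt] := climb (K * L * M) x (leq_addl _ _) hx.
have [t' -> pt'] := climb (K * L * M) z (leq_addl _ _) (eq_leq (esym hz)).
by congr (sigma _); apply: (position_inj (w := w)); rewrite pt pt'.
Qed.

End Regions.


(** * Counting generic and steep volumes *)

Section Counts.
Variables K L M s : nat.
Hypotheses (K0 : 0 < K) (L0 : 0 < L).

Lemma sum_digits (F : nat -> nat) a b :
  \sum_(n < a * b) F n = \sum_(i < b) \sum_(r < a) F (a * i + r).
Proof.
elim: b => [|b IH]; first by rewrite muln0 !big_ord0.
by rewrite mulnSr big_split_ord big_ord_recr /= IH.
Qed.

Lemma sum_range lo hi n : \sum_(t < n) (lo <= t < hi) = minn hi n - lo.
Proof.
elim: n => [|n IH]; first by rewrite big_ord0 minn0.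
rewrite big_ord_recr /= IH; case: (leqP lo n) => h1; case: (ltnP n hi) => h2 /=; lia.
Qed.

Lemma sum_digits3 (F : nat -> nat) (P1 P2 P3 : nat -> bool) :
  (forall t j i, t < K -> j < L -> P1 t -> P2 j -> P3 i -> 0 < F (K * L * i + (K * j + t))) ->
  (\sum_(t < K) P1 t) * (\sum_(j < L) P2 j) * (\sum_(i < M) P3 i) <= \sum_(n < K * L * M) F n.
Proof.
move=> h; rewrite sum_digits mulnC big_distrl; apply: leq_sum => i _ /=.
rewrite (sum_digits (fun r => F (K * L * i + r))).
case: (boolP (P3 i)) => [p3|_]; last by rewrite mul0n.
rewrite mul1n mulnC big_distrl; apply: leq_sum => j _ /=.
case: (boolP (P2 j)) => [p2|_]; last by rewrite mul0n.
rewrite mul1n; apply: leq_sum => t _.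
by case: (boolP (P1 t)) => // p1; apply: h.
Qed.

Let digit t j i : t < K -> j < L ->
  [/\ (K * L * i + (K * j + t)) %% K = t, (K * L * i + (K * j + t)) %/ K %% L = j,
      (K * L * i + (K * j + t)) %/ (K * L) = i & (K * L * i + (K * j + t)) %% (K * L) = K * j + t].
Proof.
move=> tK jL; have KL0 : 0 < K * L by rewrite muln_gt0 K0.
have lt : K * j + t < K * L.
  have : K * j.+1 <= K * L by rewrite leq_mul2l jL orbT.
  by rewrite mulnS; move: tK; clear; lia.
have e : K * L * i + (K * j + t) = (L * i + j) * K + t by lia.
split.
- by rewrite e modnMDl modn_small.
- by rewrite e divnMDl // divn_small // addn0 mulnC modnMDl modn_small.
- by rewrite mulnC divnMDl // divn_small // addn0.
- by rewrite mulnC modnMDl modn_small.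
Qed.

Lemma generic_count :
  (K - 2) * (L - 2) * (M - 2) <= \sum_(n < K * L * M) generic K L M n.
Proof.
have -> : (K - 2) * (L - 2) * (M - 2) = (\sum_(t < K) (1 <= t < K.-1)) *
    (\sum_(j < L) (1 <= j < L.-1)) * (\sum_(i < M) (1 <= i < M.-1)).
  by rewrite !sum_range; congr (_ * _ * _); lia.
apply: (@sum_digits3 (fun n => nat_of_bool (generic K L M n)) (fun t => 1 <= t < K.-1)
  (fun j => 1 <= j < L.-1) (fun i => 1 <= i < M.-1)) => t j i tK jL p1 p2 p3.
by rewrite lt0b /generic; have [-> -> -> _] := digit i tK jL; move: p1 p2 p3; clear; lia.
Qed.

(** Steep volumes are found digit by digit: three rows at each end of a layer provide the margin
    [3 * K], and [12 * M %/ (5 * s) + 1] layers at each end the flat parts. *)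
Lemma profile_count : 5 <= s ->
  (K - 2) * (L - 6) * (M - 2 * (12 * M %/ (5 * s) + 1)) <= profile K s K L M (K * L * M).
Proof.
move=> s5; set d := 12 * M %/ (5 * s).
have s0 : 0 < 5 * s by move: s5; clear; lia.
apply: (@leq_trans ((\sum_(t < K) (1 <= t < K.-1)) *
    (\sum_(j < L) (3 <= j < L - 3)) * (\sum_(i < M) (d + 1 <= i < M - (d + 1))))).
  by rewrite !sum_range !leq_mul //; lia.
apply: (@sum_digits3 (fun n => nat_of_bool (steep K s K L M n)) (fun t => 1 <= t < K.-1)
  (fun j => 3 <= j < L - 3) (fun i => d + 1 <= i < M - (d + 1))) => t j i tK jL p1 p2 p3.
rewrite lt0b /steep; have [_ _ -> ->] := digit i tK jL.
have -> : (K * j + t) %% K = t by rewrite mulnC modnMDl modn_small.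
have hd : 12 * M <= 5 * s * (d + 1) by rewrite [5 * s * _]mulnC addn1 ltnW // ltn_ceil.
have h1 : 5 * s * (d + 1) <= 5 * s * i by rewrite leq_mul2l; case/andP: p3 => ->; rewrite orbT.
have h2 : 5 * s * (d + 1 + (i + 1)) <= 5 * s * M by rewrite leq_mul2l; apply/orP; right; move: p3; clear; lia.
rewrite mulnDr in h2.
have h3 : K * 3 <= K * j by rewrite leq_mul2l; case/andP: p2 => ->; rewrite orbT.
have h4 : K * (j + 4) <= K * L by rewrite leq_mul2l; apply/orP; right; move: p2; clear; lia.
rewrite mulnDr in h4.
by apply/and5P; split; [| | | |apply/andP; split]; move: hd h1 h2 h3 h4 p1 tK; clear; lia.
Qed.

End Counts.


(** * Bounds on the Dirichlet form *)

Section Dirichlet.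
Variables (R : realFieldType) (q K L M : nat) (a0 : 'I_q).
Hypotheses (K3 : 2 < K) (L3 : 2 < L) (M3 : 2 < M).
Local Notation conf := (config q K L M).
Local Notation H := (@hamiltonian q K L M).
Local Notation N := (K * L * M).
Local Notation mono := (monochromatic K L M).
Implicit Types (sigma zeta : conf) (w : lexpath K L M).

Definition flip sigma zeta : bool := #|[set x | sigma x != zeta x]%SET| == 1%N.

Definition low sigma zeta : bool :=
  [&& flip sigma zeta, H sigma <= Gamma K L & H zeta <= Gamma K L].

Definition low_form (f : conf -> R) : R :=
  (\sum_sigma \sum_zeta (if low sigma zeta then (f sigma - f zeta) ^+ 2 else 0))%R.

Definition lexpaths : {set lexpath K L M} := [set w | allowed K L M w.1.1]%SET.

(** A bound for the number of paths through an edge at volume [n]: in general 6 orders times 8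
    choices of directions. *)
Definition multiplicity (n : nat) : nat := if generic K L M n then 1 else 48.

Lemma flipC sigma zeta : flip sigma zeta = flip zeta sigma.
Proof. by rewrite /flip; congr (_ == _); apply: eq_card => x; rewrite !inE eq_sym. Qed.

Lemma lowC sigma zeta : low sigma zeta = low zeta sigma.
Proof. by rewrite /low flipC [X in _ && X]andbC. Qed.

Lemma card_lexset w n : allowed K L M w.1.1 -> n <= N -> #|[set x | rank w x < n]%SET| = n.
Proof.
move=> aw; elim: n => [|n IH] nN.
  by apply/eqP; rewrite cards_eq0; apply/eqP/setP => x; rewrite !inE.
have [x hx] := rank_surj K3 L3 M3 aw nN.
have -> : [set x | rank w x < n.+1]%SET = (x |: [set x | rank w x < n])%SET.
  apply/setP => y; rewrite !inE ltnS leq_eqVlt; congr orb.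
  by apply/eqP/eqP => [h|->//]; apply: (rank_inj K3 L3 M3 aw); rewrite h.
by rewrite cardsU1 inE hx ltnn IH // ltnW.
Qed.

Lemma lexconf0 w b : lexconf a0 w 0 b = mono b.
Proof. by apply/ffunP => x; rewrite !ffunE. Qed.

Lemma lexconf_volume w b : allowed K L M w.1.1 -> lexconf a0 w N b = mono a0.
Proof. by move=> aw; apply/ffunP => x; rewrite !ffunE (rank_lt_volume K3 L3 M3 aw). Qed.

Section Step.
Variables (w : lexpath K L M) (b : 'I_q) (n : nat).
Hypotheses (aw : allowed K L M w.1.1) (ba : b != a0) (nN : n < N).

Lemma lexconf_diff x : (lexconf a0 w n b x != lexconf a0 w n.+1 b x) = (rank w x == n).
Proof.
rewrite !ffunE ltnS [rank w x <= n]leq_eqVlt.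
by case: ltngtP => _ /=; rewrite ?eqxx.
Qed.

Lemma lexconf_low : low (lexconf a0 w n b) (lexconf a0 w n.+1 b).
Proof.
rewrite /low !lexconf_energy // !andbT /flip.
have [x hx] := rank_surj K3 L3 M3 aw nN; apply/cards1P; exists x.
apply/setP => y; rewrite !inE lexconf_diff.
by apply/eqP/eqP => [h|->//]; apply: (rank_inj K3 L3 M3 aw); rewrite h.
Qed.

Lemma lexconf_card : #|[set x | lexconf a0 w n b x == a0]%SET| = n.
Proof.
rewrite -[RHS](card_lexset aw (ltnW nN)); apply: eq_card => x; rewrite !inE ffunE.
by case: ifP => _; rewrite ?eqxx ?(negbTE ba).
Qed.

End Step.

Local Notation path_step := (lexpath K L M * 'I_q * 'I_N)%type.

Definition step_edge (p : path_step) : conf * conf :=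
  (lexconf a0 p.1.1 p.2 p.1.2, lexconf a0 p.1.1 p.2.+1 p.1.2).

Definition path_steps : {set path_step} := [set p | (p.1.1 \in lexpaths) && (p.1.2 != a0)]%SET.

Lemma step_edge_eq p p' : p \in path_steps -> p' \in path_steps ->
  step_edge p = step_edge p' ->
  [/\ p.1.2 = p'.1.2, p.2 = p'.2, exists x, rank p.1.1 x = p.2 /\ rank p'.1.1 x = p.2 &
      forall y, (rank p.1.1 y < p.2) = (rank p'.1.1 y < p.2)].
Proof.
case: p => [[w b] n]; case: p' => [[w' b'] n']; rewrite !inE /= => /andP[aw ba] /andP[aw' ba'].
rewrite /step_edge /= => -[e1 e2]; have en : n = n'.
  by apply: val_inj; rewrite /= -(lexconf_card aw ba (ltn_ord n)) e1 lexconf_card.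
subst n'; have [x hx] := rank_surj K3 L3 M3 aw (ltn_ord n); split=> //; last first.
- move=> y; have := congr1 (fun c : conf => c y == a0) e1; rewrite /= !ffunE.
  by case: ifP => _; case: ifP => _; rewrite ?eqxx ?(negbTE ba) ?(negbTE ba').
- exists x; split=> //; apply/eqP; rewrite -(lexconf_diff w' n ba') -e1 -e2 lexconf_diff //.
  exact/eqP.
have := congr1 (fun c : conf => c x) e1; rewrite !ffunE hx ltnn.
by case: ifP => // _ e; rewrite e eqxx in ba.
Qed.

Lemma rank_origin w w' x : allowed K L M w.1.1 -> w.1 = w'.1 ->
  rank w x = rank w' x -> w = w'.
Proof.
move=> aw e1 e; have := rank_digits K3 L3 M3 x aw.
have aw' : allowed K L M w'.1.1 by rewrite -e1.
have := rank_digits K3 L3 M3 x aw'; rewrite -e -e1 => <- /axes_inj.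
case: w w' e1 {aw aw' e} => [[c [[ex ey] ez]] [[ox oy] oz]] [[c' [[ex' ey'] ez']] [[ox' oy'] oz']].
by case=> -> -> -> -> [] /pos_origin -> /pos_origin -> /pos_origin ->.
Qed.

(** An edge determines the site that is added and its rank. At a generic volume this fixes the path;
    otherwise order and directions fix it by [rank_origin]. *)
Lemma fiber_card e : forall p, p \in path_steps -> step_edge p = e ->
  #|[set p' in path_steps | step_edge p' == e]%SET| <= multiplicity p.2.
Proof.
move=> p pP pe; rewrite /multiplicity; case: ifP => g.
  apply: (@leq_trans #|[set p]%SET|); last by rewrite cards1.
  apply/fintype.subset_leq_card/fintype.subsetP => p'; rewrite inE => /andP[p'P /eqP p'e].
  have [eb en [x [h1 h2]] hy] := step_edge_eq pP p'P (etrans pe (esym p'e)).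
  rewrite inE; apply/eqP; case: p p' pP p'P eb en h1 h2 hy g {pe p'e} => [[w b] n] [[w' b'] n'] /=.
  rewrite !inE /= => /andP[aw _] /andP[aw' _] -> <- h1 h2 hy g; congr (_, _, _); apply/esym.
  by apply: (lexpath_unique K3 L3 M3 aw aw' (x := x)); rewrite ?h1 ?h2.
have -> : 48 = #|{: 'I_6 * (bool * bool * bool)}| by rewrite !card_prod card_ord !card_bool.
rewrite -(card_in_imset (f := fun p' : path_step => p'.1.1.1)) ?max_card //.
move=> p1 p2; rewrite [p1 \in _]inE [p2 \in _]inE => /andP[p1P /eqP p1e] /andP[p2P /eqP p2e] e12.
have [eb en [x [h1 h2]] hy] := step_edge_eq p1P p2P (etrans p1e (esym p2e)).
case: p1 p2 p1P p2P eb en h1 h2 e12 {p1e p2e hy} => [[w b] n] [[w' b'] n'] /=.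
rewrite !inE /= => /andP[aw _] /andP[aw' _] -> <- h1 h2 e12; congr (_, _, _).
by apply: (rank_origin (x := x)); rewrite ?h1 ?h2.
Qed.

End Dirichlet.


Section FormBounds.
Variables (R : realFieldType) (q K L M : nat) (a0 : 'I_q).
Hypotheses (K3 : 2 < K) (L3 : 2 < L) (M3 : 2 < M).
Local Notation conf := (config q K L M).
Local Notation N := (K * L * M).
Local Notation mono := (monochromatic K L M).
Local Notation D := (path_steps K L M a0).
Local Notation edge := (@step_edge q K L M a0).
Implicit Types (sigma zeta : conf).
Local Open Scope ring_scope.

Definition spin_count sigma : nat := #|[set x | sigma x == a0]%SET|.

Lemma sum_path_steps (g : lexpath K L M -> 'I_q -> 'I_N -> R) :
  \sum_(p in D) g p.1.1 p.1.2 p.2 =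
  \sum_(w in lexpaths K L M) \sum_(b | b != a0) \sum_n g w b n.
Proof.
rewrite pair_big (pair_big _ _ (fun p n => g p.1 p.2 n)) /=.
by apply: eq_bigl => -[[w b] n]; rewrite inE /= andbT.
Qed.

Lemma card_path_steps : #|D| = (#|lexpaths K L M| * q.-1 * N)%N.
Proof.
have -> : D = finset.setX (finset.setX (lexpaths K L M) [set b | b != a0]%SET) [set: 'I_N]%SET.
  by apply/setP => -[[w b] n]; rewrite !inE andbT.
rewrite !cardsX cardsT card_ord; congr (_ * _ * _)%N.
have -> : [set b | b != a0]%SET = (~: [set a0])%SET by apply/setP => b; rewrite !inE.
by rewrite cardsC1 card_ord.
Qed.

Lemma card_other_spins : #|[pred b : 'I_q | b != a0]| = q.-1.
Proof.
rewrite -[q in RHS]card_ord -(cardsC1 a0).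
by apply: eq_card => b; rewrite !inE.
Qed.

Lemma edge_spin_count p : p \in D ->
  (spin_count (edge p).1 < spin_count (edge p).2)%N /\ low (edge p).1 (edge p).2.
Proof.
case: p => [[w b] n]; rewrite inE /= => /andP[]; rewrite inE => aw ba.
split; last exact: lexconf_low.
rewrite /spin_count (lexconf_card K3 L3 M3 aw ba (ltn_ord n)).
have -> : [set x | lexconf a0 w n.+1 b x == a0]%SET = [set x | (rank w x < n.+1)%N]%SET.
  by apply/setP => x; rewrite !inE ffunE; case: ifP => _; rewrite ?eqxx ?(negbTE ba).
by rewrite card_lexset.
Qed.

(** Orienting edges by the number of spins [a0] selects each edge of a path once, and the form
    counts it twice. *)
Lemma low_form_half (f : conf -> R) :
  2 * (\sum_sigma \sum_zeta
    if low sigma zeta && (spin_count sigma < spin_count zeta)%N then (f sigma - f zeta) ^+ 2 else 0)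
  <= low_form f.
Proof.
rewrite mulr_natl mulr2n [X in _ + X]exchange_big -big_split; apply: ler_sum => sigma _.
rewrite -big_split; apply: ler_sum => zeta _ /=; rewrite [low zeta sigma]lowC.
case: (low sigma zeta) => /=; last by rewrite addr0.
by case: ltngtP => _; rewrite ?addr0 ?add0r ?sqr_ge0 // -opprB sqrrN.
Qed.

Lemma steps_form (f : conf -> R) :
  \sum_(p in D) (f (edge p).2 - f (edge p).1) ^+ 2 / (multiplicity K L M p.2)%:R <=
  \sum_sigma \sum_zeta
    if low sigma zeta && (spin_count sigma < spin_count zeta)%N then (f sigma - f zeta) ^+ 2 else 0.
Proof.
pose g (p : lexpath K L M * 'I_q * 'I_N) : R := (f (edge p).2 - f (edge p).1) ^+ 2.
rewrite -[X in X <= _]/(\sum_(p in D) g p / (multiplicity K L M p.2)%:R).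
rewrite (partition_big edge predT) //= pair_big /=; apply: ler_sum => -[sigma zeta] _ /=.
have [p0 /andP[pD /eqP pe]|none] := pickP (fun p => (p \in D) && (edge p == (sigma, zeta))); last first.
  rewrite big_pred0 //; case: ifP => // _; exact: sqr_ge0.
have [c l] := edge_spin_count pD; rewrite pe /= in c l; rewrite l c /=.
have m0 : 0 < (multiplicity K L M p0.2)%:R :> R by rewrite ltr0n /multiplicity; case: ifP.
rewrite (eq_bigr (fun=> (f sigma - f zeta) ^+ 2 / (multiplicity K L M p0.2)%:R)); last first.
  move=> p /andP[pD' /eqP pe']; rewrite /g pe' /= -opprB sqrrN.
  by have [_ -> _ _] := step_edge_eq K3 L3 M3 pD' pD (etrans pe' (esym pe)).
rewrite sumr_const -[X in X <= _]mulr_natr -mulrA ler_piMr ?sqr_ge0 //.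
rewrite mulrC ler_pdivrMr // mul1r ler_nat.
have := fiber_card K3 L3 M3 pD pe; apply: leq_trans; apply: eq_leq.
by apply: eq_card => p; rewrite [in RHS]inE.
Qed.

(** The increments of [f] along each path add up to 1. Cauchy-Schwarz with the multiplicities as
    weights compensates for the edges shared by several paths. *)
Lemma low_form_lower (f : conf -> R) : f (mono a0) = 1 -> (forall b, b != a0 -> f (mono b) = 0) ->
  2 * (#|lexpaths K L M| * q.-1)%:R / (\sum_(n < N) multiplicity K L M n)%:R <= low_form f.
Proof.
move=> f1 f0; set X := (_ * q.-1)%:R; set S := (\sum_(n < N) _)%:R.
have N0 : (0 < N)%N by rewrite !muln_gt0 !(ltn_trans (ltn0Sn 1)).
have S0 : 0 < S.
  rewrite ltr0n (bigD1 (Ordinal N0)) //= addn_gt0 /multiplicity.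
  by case: ifP.
have s1 : \sum_(p in D) (f (edge p).2 - f (edge p).1) = X.
  rewrite (sum_path_steps (fun w b n => f (lexconf a0 w n.+1 b) - f (lexconf a0 w n b))).
  rewrite (eq_bigr (fun=> (q.-1)%:R)); first by rewrite sumr_const /X natrM mulr_natl.
  move=> w; rewrite inE => aw; rewrite (eq_bigr (fun=> 1)).
    by rewrite sumr_const card_other_spins.
  move=> b ba; rewrite -(big_mkord xpredT (fun n => f (lexconf a0 w n.+1 b) - f (lexconf a0 w n b))).
  by rewrite telescope_sumr // lexconf0 lexconf_volume // f1 f0 // subr0.
have s2 : \sum_(p in D) (multiplicity K L M p.2)%:R = X * S.
  rewrite (sum_path_steps (fun w b n => (multiplicity K L M n)%:R)).
  rewrite (eq_bigr (fun=> (q.-1)%:R * S)); first by rewrite sumr_const /X natrM -mulrA !mulr_natl.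
  by move=> v _; rewrite sumr_const card_other_spins /S natr_sum mulr_natl.
(* Cauchy-Schwarz in the linearised form [d ^ 2 / m >= 2 * l * d - l ^ 2 * m], with the optimal
   value [l = 1 / S]. *)
have h : 2 / S * X - S^-1 ^+ 2 * (X * S) <=
    \sum_(p in D) (f (edge p).2 - f (edge p).1) ^+ 2 / (multiplicity K L M p.2)%:R.
  rewrite -s2 -s1 !mulr_sumr -sumrB; apply: ler_sum => p _.
  set d := _ - f _; have m0 : 0 < (multiplicity K L M p.2)%:R :> R.
    by rewrite ltr0n /multiplicity; case: ifP.
  move: m0; set m := _%:R => m0; rewrite -subr_ge0.
  have -> : d ^+ 2 / m - (2 / S * d - S^-1 ^+ 2 * m) = (d - S^-1 * m) ^+ 2 / m.
    by field; rewrite ?lt0r_neq0.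
  by rewrite divr_ge0 ?sqr_ge0 // ltW.
apply: le_trans (low_form_half f).
rewrite -mulrA ler_pM2l ?ltr0n //; apply: le_trans (le_trans h (steps_form f)).
have -> : 2 / S * X - S^-1 ^+ 2 * (X * S) = X / S by field; rewrite lt0r_neq0.
by [].
Qed.

Lemma low_form_upper (f : conf -> R) c : 0 <= c ->
  (forall sigma zeta, low sigma zeta -> f sigma = f zeta \/
     (f sigma - f zeta) ^+ 2 = c /\
     exists2 p, p \in D & edge p = (sigma, zeta) \/ edge p = (zeta, sigma)) ->
  low_form f <= 2 * (#|lexpaths K L M| * q.-1 * N)%:R * c.
Proof.
move=> c0 h; pose im := (edge @: D)%SET.
have : low_form f <= \sum_sigma \sum_zeta c * (((sigma, zeta) \in im)%:R + ((zeta, sigma) \in im)%:R).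
  apply: ler_sum => sigma _; apply: ler_sum => zeta _.
  case: ifP => [lo|_]; last by rewrite mulr_ge0 // addr_ge0 // ler0n.
  case: (h _ _ lo) => [->|[-> [p pD pe]]].
    by rewrite subrr expr0n mulr_ge0 // addr_ge0 // ler0n.
  rewrite ler_peMr // -natrD (ler_nat _ 1%N).
  by case: pe => <-; rewrite imset_f // ?leq_addr ?leq_addl.
move=> h1; apply: le_trans h1 _; rewrite mulrC.
under eq_bigr do rewrite -mulr_sumr; rewrite -mulr_sumr ler_wpM2l //.
under eq_bigr do rewrite big_split /=; rewrite big_split /= [X in _ + X]exchange_big /=.
rewrite -mulr2n -[X in X <= _]mulr_natl ler_wpM2l ?ler0n // pair_big /=.
rewrite -card_path_steps -natr_sum ler_nat; apply: leq_trans (leq_imset_card edge D).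
rewrite -sum1_card [leqRHS]big_mkcond /=; apply: leq_sum => -[s z] _ /=.
by case: ifP.
Qed.

End FormBounds.


(** * The test function on configurations *)

Section TestConfiguration.
Variables (R : realFieldType) (q K L M s : nat) (a0 : 'I_q).
Hypotheses (KL : K <= L) (LM : L <= M) (s5 : 5 <= s) (sK : 100 * s ^ 2 <= K).
Local Notation conf := (config q K L M).
Local Notation N := (K * L * M).
Local Notation mono := (monochromatic K L M).
Local Notation H := (@hamiltonian q K L M).
Local Notation p := (profile K s K L M N).

Let K2500 : 2500 <= K.
Proof. by apply: leq_trans sK; rewrite (@leq_mul 100 25) // (@leq_sqr 5). Qed.
Let K3 : 2 < K. Proof. by apply: leq_trans K2500. Qed.
Let L3 : 2 < L. Proof. exact: leq_trans KL. Qed.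
Let M3 : 2 < M. Proof. exact: leq_trans LM. Qed.

Definition test_conf (sigma : conf) : R := test_function R s (region a0 sigma).

Let cN : #|'Z_K| * #|'Z_L| * #|'Z_M| = N.
Proof. by rewrite !card_Zn // ltnW. Qed.

Let N0 : 0 < N.
Proof. by rewrite !muln_gt0 !(ltn_trans (ltn0Sn 1)). Qed.

Lemma test_conf_same : test_conf (mono a0) = 1%R.
Proof.
have e : volume (boxC (region a0 (mono a0))) = 0.
  rewrite /volume big1 // => i _; rewrite big1 // => j _; rewrite big1 // => t _.
  by rewrite /boxC /region ffunE eqxx.
have e' : volume (region a0 (mono a0)) = N by rewrite -cN -(volumeC (region a0 (mono a0))) e addn0.
rewrite /test_conf /test_function e e' cN muln0 N0.
by rewrite ltnNge leq_pmull //; apply: leq_trans s5.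
Qed.

Lemma test_conf_other b : b != a0 -> test_conf (mono b) = 0%R.
Proof.
move=> ba; have e : volume (region a0 (mono b)) = 0.
  rewrite /volume big1 // => i _; rewrite big1 // => j _; rewrite big1 // => t _.
  by rewrite /region ffunE (negbTE ba).
by rewrite /test_conf /test_function e cN muln0 N0.
Qed.

Lemma test_conf_01 sigma : (0 <= test_conf sigma <= 1)%R.
Proof. by apply: test_function_01; rewrite ?card_Zn // ltnW. Qed.

(** If the value changes, the region of [a0] is lexicographic and already has energy Gamma. Then no
    energy is left for edges among the other spins, and the step is an edge of a path. *)
Lemma grow_step (sigma zeta : conf) x : (forall y, y != x -> sigma y = zeta y) ->
  sigma x != a0 -> zeta x = a0 -> H sigma <= Gamma K L -> H zeta <= Gamma K L ->
  test_conf zeta = test_conf sigma \/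
  [/\ test_conf zeta = (test_conf sigma + p%:R^-1)%R, H sigma = Gamma K L, H zeta = Gamma K L &
      exists2 u, u \in path_steps K L M a0 & step_edge a0 u = (sigma, zeta)].
Proof.
case: x => [[i0 j0] t0] same sx zx hs hz.
have ad : adds (region a0 sigma) (region a0 zeta) i0 j0 t0.
  split=> // i j t; rewrite /region.
  have [[-> -> ->]|n] := eqVneq (i, j, t) (i0, j0, t0); first by rewrite zx !eqxx orbT.
  by rewrite -same // andbA -!xpair_eqE (negbTE n) orbF.
have es := leq_trans (region_energy a0 K3 L3 M3 sigma) hs.
have ez := leq_trans (region_energy a0 K3 L3 M3 zeta) hz.
case: (growth_profile KL LM s5 sK R ad es ez) => [e|[e1 e2 [w [aw hw]] e]]; first by left.
right; have rE y : (sigma y == a0) = (rank w y < rank w (i0, j0, t0)).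
  by case: y => [[i j] t]; apply: hw.
have nN := rank_lt_volume K3 L3 M3 aw (i0, j0, t0).
have hs' : H sigma <= box_energy (region a0 sigma) by rewrite e1.
have [b ba sE] := outside_constant K3 L3 M3 aw hs' rE nN.
split=> //.
- by apply/eqP; rewrite eqn_leq hs -e1 region_energy.
- by apply/eqP; rewrite eqn_leq hz -e2 region_energy.
exists (w, b, Ordinal nN); first by rewrite !inE /= aw.
rewrite /step_edge /= -sE; congr pair; apply/ffunP => y; rewrite ffunE ltnS leq_eqVlt.
have [->|n] := eqVneq y (i0, j0, t0); first by rewrite eqxx zx.
rewrite (inj_eq (rank_inj K3 L3 M3 aw)) (negbTE n) /= -same // -rE.
case: eqP => [->//|]; rewrite {1 2}sE ffunE; case: ifP => // _ /eqP.
Qed.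

Lemma test_conf_step (sigma zeta : conf) : low sigma zeta ->
  test_conf sigma = test_conf zeta \/
  [/\ H sigma = Gamma K L, H zeta = Gamma K L,
      ((test_conf sigma - test_conf zeta) ^+ 2 = p%:R^-1 ^+ 2)%R &
      exists2 u, u \in path_steps K L M a0 & step_edge a0 u = (sigma, zeta) \/ step_edge a0 u = (zeta, sigma)].
Proof.
case/and3P => /cards1P[x /setP hx] hs hz.
have same y : y != x -> sigma y = zeta y.
  by move=> n; apply/eqP/negPn; have := hx y; rewrite !inE (negbTE n) => ->.
case: (eqVneq (sigma x) a0) => sx; case: (eqVneq (zeta x) a0) => zx.
- left; congr test_conf; apply/ffunP => y.
  by have [->|/same//] := eqVneq y x; rewrite sx zx.
- have same' y : y != x -> zeta y = sigma y by move/same.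
  case: (grow_step same' zx sx hz hs) => [->|[-> -> -> [u uP ue]]]; [by left|right].
  by split=> //; [rewrite addrAC subrr add0r|exists u => //; right].
- case: (grow_step same sx zx hs hz) => [->|[-> -> -> [u uP ue]]]; [by left|right].
  by split=> //; [rewrite opprD addrA subrr add0r sqrrN|exists u => //; left].
left; rewrite /test_conf; congr test_function.
apply: funext => i; apply: funext => j; apply: funext => t; rewrite /region.
have [->|/same -> //] := eqVneq (i, j, t) x.
by rewrite (negbTE sx) (negbTE zx).
Qed.

Lemma test_conf_form :
  (low_form test_conf <= 2 * (#|lexpaths K L M| * q.-1 * N)%:R * p%:R^-1 ^+ 2)%R.
Proof.
apply: (low_form_upper (a0 := a0)) => [|sigma zeta lo]; first exact: sqr_ge0.
by case: (test_conf_step lo) => [|[_ _ h h']]; [left|right].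
Qed.

End TestConfiguration.

(** * Error terms of order 1 / s *)

Section Asymptotics.
Variables (R : realFieldType) (K L M s : nat).
Hypotheses (KL : K <= L) (LM : L <= M) (s5 : 5 <= s) (sK : 100 * s ^ 2 <= K).
Local Notation N := (K * L * M).
Local Notation p := (profile K s K L M N).
Local Open Scope ring_scope.

Let s0 : 0 < s%:R :> R. Proof. by rewrite ltr0n; apply: leq_trans s5. Qed.
Let sK500 : (500 * s <= K)%N.
Proof. by apply: leq_trans sK; rewrite -mulnn mulnA leq_mul2r (@leq_mul 100 5) ?orbT. Qed.
Let K0 : (0 < K)%N. Proof. by apply: leq_trans sK500; rewrite muln_gt0 (leq_trans _ s5). Qed.

Let u : R := s%:R^-1.
Let u0 : 0 < u. Proof. by rewrite invr_gt0. Qed.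
Let u5 : 5 * u <= 1. Proof. by rewrite ler_pdivrMr // mul1r (ler_nat _ 5). Qed.

(** Since [s >= 5], every side is at least [500 * s], so a constant is a multiple of [u / 500] times
    a side. *)
Let small n c : (K <= n)%N -> (c%:R : R) <= n%:R * (c%:R / 500 * u).
Proof.
move=> Kn; have : 500 * s%:R <= n%:R :> R by rewrite -natrM ler_nat (leq_trans sK500).
move=> h; have h1 : 1 <= n%:R / 500 * u by rewrite /u ler_pdivlMr // mul1r; lra.
have := ler_wpM2l (ler0n R c) h1; lra.
Qed.

(** The main loss is the flat fraction [24 / 5 * u] of the layers; with the lower-order terms the
    ratio is at least [1 - 5 * u], before squaring. *)
Lemma profile_ratio : 1 - 12 * u <= (p%:R / N%:R) ^+ 2.
Proof.
have u_gt0 := u0; have u_le := u5.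
have L0 : (0 < L)%N := leq_trans K0 KL; have M0 : (0 < M)%N := leq_trans L0 LM.
have N0 : 0 < N%:R :> R by rewrite ltr0n !muln_gt0 K0 L0.
set d := (12 * M %/ (5 * s))%N.
have hd : d%:R <= M%:R * (12 / 5 * u) :> R.
  have : (d * (5 * s) <= 12 * M)%N by rewrite leq_trunc_div.
  rewrite -(ler_nat R) !natrM => h.
  have -> : M%:R * (12 / 5 * u) = 12 * M%:R / (5 * s%:R) :> R by rewrite /u; field; rewrite lt0r_neq0.
  by rewrite ler_pdivlMr ?mulr_gt0 // ?ltr0n //; lra.
have sub (m n : nat) : m%:R - n%:R <= (m - n)%:R :> R.
  case: (leqP n m) => h; first by rewrite natrB.
  by apply: (@le_trans _ _ 0); rewrite ?ler0n // subr_le0 ler_nat ltnW.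
have h1 : K%:R * (1 - 2 / 500 * u) <= (K - 2)%:R :> R.
  by have := sub K 2%N; have := @small K 2%N (leqnn K); lra.
have h2 : L%:R * (1 - 6 / 500 * u) <= (L - 6)%:R :> R.
  by have := sub L 6%N; have := @small L 6%N KL; lra.
have h3 : M%:R * (1 - (24 / 5 + 2 / 500) * u) <= (M - 2 * (d + 1))%:R :> R.
  have := sub M (2 * (d + 1))%N; have := @small M 2%N (leq_trans KL LM).
  by rewrite natrM natrD; lra.
have pos1 : 0 <= 1 - 2 / 500 * u by lra.
have pos2 : 0 <= 1 - 6 / 500 * u by lra.
have pos3 : 0 <= 1 - (24 / 5 + 2 / 500) * u by lra.
have h : N%:R * ((1 - 2 / 500 * u) * (1 - 6 / 500 * u) * (1 - (24 / 5 + 2 / 500) * u)) <= p%:R.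
  have := profile_count M K0 L0 s5; rewrite -(ler_nat R) !natrM; apply: le_trans.
  have := ler_pM (mulr_ge0 (mulr_ge0 (ler0n _ K) pos1) (mulr_ge0 (ler0n _ L) pos2))
    (mulr_ge0 (ler0n _ M) pos3) (ler_pM (mulr_ge0 (ler0n _ K) pos1) (mulr_ge0 (ler0n _ L) pos2) h1 h2) h3.
  by apply: le_trans; rewrite le_eqVlt; apply/orP; left; apply/eqP; ring.
have r0 : 1 - 5 * u <= p%:R / N%:R.
  rewrite ler_pdivlMr // mulrC; apply: le_trans h; rewrite ler_wpM2l ?ler0n //; nra.
have r1 : 0 <= 1 - 5 * u by lra.
have := ler_pM r1 r1 r0 r0; rewrite -expr2; apply: le_trans; nra.
Qed.

(** A volume that is not generic costs 47 more than a generic one, and such volumes form a fraction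
    of at most [6 / 500 * u]. *)
Lemma multiplicity_ratio :
  (\sum_(n < N) multiplicity K L M n)%:R / N%:R <= 1 + 12 * u :> R.
Proof.
have u_gt0 := u0; have u_le := u5.
have L0 : (0 < L)%N := leq_trans K0 KL; have M0 : (0 < M)%N := leq_trans L0 LM.
have N0 : 0 < N%:R :> R by rewrite ltr0n !muln_gt0 K0 L0.
have e : (\sum_(n < N) multiplicity K L M n + 47 * \sum_(n < N) generic K L M n = 48 * N)%N.
  have -> : (48 * N = \sum_(n < N) 48)%N by rewrite sum_nat_const card_ord mulnC.
  rewrite big_distrr -big_split /=.
  by apply: eq_bigr => n _; rewrite /multiplicity; case: ifP.
have sub (m n : nat) : m%:R - n%:R <= (m - n)%:R :> R.
  case: (leqP n m) => h; first by rewrite natrB.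
  by apply: (@le_trans _ _ 0); rewrite ?ler0n // subr_le0 ler_nat ltnW.
have part n : (K <= n)%N -> n%:R * (1 - 2 / 500 * u) <= (n - 2)%:R :> R.
  by move=> Kn; have := sub n 2%N; have := small 2 Kn; lra.
have pos : 0 <= 1 - 2 / 500 * u by lra.
have h : N%:R * ((1 - 2 / 500 * u) * (1 - 2 / 500 * u) * (1 - 2 / 500 * u)) <=
    (\sum_(n < N) generic K L M n)%:R :> R.
  have := generic_count M K0 L0; rewrite -(ler_nat R) !natrM; apply: le_trans.
  have := ler_pM (mulr_ge0 (mulr_ge0 (ler0n _ K) pos) (mulr_ge0 (ler0n _ L) pos))
    (mulr_ge0 (ler0n _ M) pos) (ler_pM (mulr_ge0 (ler0n _ K) pos) (mulr_ge0 (ler0n _ L) pos)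
      (part _ (leqnn K)) (part _ KL)) (part _ (leq_trans KL LM)).
  by apply: le_trans; rewrite le_eqVlt; apply/orP; left; apply/eqP; ring.
rewrite ler_pdivrMr //; move: e => /(congr1 (fun n => n%:R : R)); rewrite natrD !natrM => e.
have : N%:R * (1 - 6 / 500 * u) <= (\sum_(n < N) generic K L M n)%:R :> R.
  by apply: le_trans h; rewrite ler_wpM2l ?ler0n //; nra.
rewrite !natrM; nra.
Qed.

End Asymptotics.

Section CountPaths.
Variables K L M : nat.
Hypotheses (K3 : 2 < K) (L3 : 2 < L) (M3 : 2 < M).

Definition orders : nat := \sum_(c < 6) allowed K L M c.

Lemma card_lexpaths : #|lexpaths K L M| = 8 * orders * (K * L * M).
Proof.
have -> : lexpaths K L M = finset.setX (finset.setX [set c | allowed K L M c] [set: bool * bool * bool])%SET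
    [set: site K L M]%SET.
  by apply/setP => -[[c e] o]; rewrite !inE !andbT.
rewrite !cardsX !cardsT (card_site K3 L3 M3) !card_prod !card_bool [8 * _]mulnC.
congr (_ * _ * _); rewrite -sum1_card big_mkcond; apply: eq_bigr => c _.
by rewrite inE; case: ifP.
Qed.

Lemma orders_distinct : K < L < M -> orders = 1.
Proof.
case/andP => h1 h2; rewrite /orders /allowed /axes !big_ord_recl big_ord0 /= !xpair_eqE.
by rewrite !eqxx; move: h1 h2; clear; lia.
Qed.

Lemma orders_pair : ((K == L) && (L < M)) || ((K < L) && (L == M)) -> orders = 2.
Proof.
move=> h; rewrite /orders /allowed /axes !big_ord_recl big_ord0 /= !xpair_eqE.
by rewrite !eqxx; move: h; clear; lia.
Qed.

Lemma orders_cube : (K == L) && (L == M) -> orders = 6.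
Proof.
case/andP => /eqP e1 /eqP e2; rewrite /orders /allowed /axes !big_ord_recl big_ord0 /= e1 e2.
by rewrite !eqxx.
Qed.

End CountPaths.


(** * Potential theory on a finite state space *)

Section Generator.
Variables (R : realFieldType) (V : finType) (r : V -> V -> R).
Implicit Types (u v f g : V -> R) (A : {set V}).
Local Open Scope ring_scope.

Definition generator u x : R := \sum_y r x y * (u y - u x).

Hypothesis r0 : forall x y, 0 <= r x y.

Definition irreducible_rates : Prop := forall B : pred V, (exists x, B x) ->
  (forall x y, B x -> 0 < r x y -> B y) -> forall y, B y.

Hypothesis irr : irreducible_rates.

(** If the minimum were negative, its points would avoid [A], and superharmonicity would make the
    set of minimisers closed under jumps, hence everything. *)
Lemma min_principle A u : (exists a, a \in A) -> (forall x, x \notin A -> generator u x <= 0) ->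
  (forall x, x \in A -> 0 <= u x) -> forall x, 0 <= u x.
Proof.
move=> [a aA] sup bd x; rewrite leNgt; apply/negP => ux.
have [m _ mmin] := @arg_minP _ R V x xpredT u isT.
have um : u m < 0 by apply: le_lt_trans ux; apply: mmin.
have all : forall y, u y == u m.
  apply: (irr (B := fun y => u y == u m)); first by exists m.
  move=> y z /eqP e ryz; have yA : y \notin A.
    by apply/negP => /bd; rewrite e leNgt um.
  have t0 w : 0 <= r y w * (u w - u y) by rewrite mulr_ge0 // subr_ge0 e mmin.
  have : generator u y == 0 by rewrite eq_le sup // sumr_ge0.
  rewrite psumr_eq0 // => /allP /(_ z); rewrite mem_index_enum => /(_ isT) /=.
  by rewrite mulf_eq0 gt_eqF //= subr_eq0 e.
by have := bd a aA; rewrite (eqP (all a)) leNgt um.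
Qed.

Lemma generatorB u v x : generator (fun y => u y - v y) x = generator u x - generator v x.
Proof. by rewrite /generator -sumrB; apply: eq_bigr => y _; ring. Qed.

Lemma harmonic_unique A u v : (exists a, a \in A) ->
  (forall x, x \notin A -> generator u x = generator v x) ->
  (forall x, x \in A -> u x = v x) -> forall x, u x = v x.
Proof.
move=> A0 h b x; apply/eqP; rewrite eq_le -subr_ge0 -[X in _ && X]subr_ge0.
by apply/andP; split; apply: (min_principle (u := fun y => _ y - _ y) A0) => y yA;
  rewrite ?generatorB ?h ?b ?subrr.
Qed.

(** A square linear system: uniqueness makes its matrix [m] invertible. The map [T] evaluates the
    boundary values on [A] and the generator elsewhere. *)
Lemma dirichlet_problem A g : (exists a, a \in A) ->
  exists v, (forall x, x \in A -> v x = 0) /\ (forall x, x \notin A -> generator v x = g x).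
Proof.
move=> A0; pose n := #|V|.
pose T v x := if x \in A then v x else generator v x.
pose m : 'M[R]_n := \matrix_(i, j) T (fun y => (y == enum_val i)%:R) (enum_val j).
have TE (w : 'rV[R]_n) j : (w *m m) 0 j = T (fun y => w 0 (enum_rank y)) (enum_val j).
  rewrite mxE; under eq_bigr do rewrite mxE.
  have wE y : w 0 (enum_rank y) = \sum_i w 0 i * (y == enum_val i)%:R.
    rewrite (bigD1 (enum_rank y)) //= enum_rankK eqxx mulr1 big1 ?addr0 // => i iy.
    by rewrite -(inj_eq enum_rank_inj) enum_valK eq_sym (negbTE iy) mulr0.
  rewrite /T; case: ifP => _; first by rewrite wE.
  rewrite /generator; under [RHS]eq_bigr do rewrite !wE -sumrB mulr_sumr.
  rewrite exchange_big /=; apply: eq_bigr => i _; rewrite mulr_sumr.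
  by apply: eq_bigr => y _; ring.
have free : row_free m.
  apply: inj_row_free => w wm; apply/rowP => i; rewrite mxE -[i]enum_valK.
  apply: (harmonic_unique (u := fun y => w 0 (enum_rank y)) (v := fun=> 0) A0) => x xA.
    have := TE w (enum_rank x); rewrite wm mxE enum_rankK /T (negbTE xA) => <-.
    by rewrite /generator big1 // => y _; rewrite subrr mulr0.
  by have := TE w (enum_rank x); rewrite wm mxE enum_rankK /T xA.
rewrite row_free_unit in free.
pose b : 'rV[R]_n := \row_j (if enum_val j \in A then 0 else g (enum_val j)).
exists (fun y => (b *m invmx m) 0 (enum_rank y)); split=> x xA.
  have := TE (b *m invmx m) (enum_rank x); rewrite mulmxKV // mxE enum_rankK /T xA.
  by move=> <-.
have := TE (b *m invmx m) (enum_rank x); rewrite mulmxKV // mxE enum_rankK /T (negbTE xA).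
by move=> <-.
Qed.

End Generator.

Section Reversible.
Variables (R : realFieldType) (V : finType) (r c : V -> V -> R) (mu : V -> R).
Implicit Types (u v f g h : V -> R) (A : {set V}).
Local Open Scope ring_scope.
Hypotheses (c0 : forall x y, 0 <= c x y) (cC : forall x y, c x y = c y x).
Hypothesis cE : forall x y, x != y -> mu x * r x y = c x y.

Definition cform u v : R := \sum_x \sum_y c x y * (u x - u y) * (v x - v y).

Lemma cformC u v : cform u v = cform v u.
Proof. by apply: eq_bigr => x _; apply: eq_bigr => y _; ring. Qed.

Lemma green u v : cform u v = 2 * \sum_x mu x * u x * (- generator r v x).
Proof.
have -> : \sum_x mu x * u x * (- generator r v x) = \sum_x \sum_y c x y * u x * (v x - v y).
  apply: eq_bigr => x _; rewrite /generator -sumrN mulr_sumr; apply: eq_bigr => y _.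
  by have [->|xy] := eqVneq x y; [ring|rewrite -cE //; ring].
rewrite mulr_natl mulr2n [X in _ + X]exchange_big -big_split; apply: eq_bigr => x _.
rewrite -big_split; apply: eq_bigr => y _ /=; rewrite (cC y x); ring.
Qed.

Lemma cform_ge0 u : 0 <= cform u u.
Proof.
by apply: sumr_ge0 => x _; apply: sumr_ge0 => y _; rewrite -mulrA mulr_ge0 // -expr2 sqr_ge0.
Qed.

Definition equilibrium A s h : Prop :=
  [/\ h s = 1, forall x, x \in A -> h x = 0 &
      forall x, x \notin A -> x != s -> generator r h x = 0].

(** The difference [f - h] vanishes on the boundary, so by Green's formula it is orthogonal to
    [h]. *)
Lemma dirichlet_principle A s h f : equilibrium A s h -> f s = 1 ->
  (forall x, x \in A -> f x = 0) -> cform h h <= cform f f.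
Proof.
move=> [hs hA hL] fs fA; pose g x := f x - h x.
have gh : cform g h = 0.
  rewrite green big1 ?mulr0 // => x _; rewrite /g.
  have [->|xs] := eqVneq x s; first by rewrite fs hs; ring.
  by have [xA|xA] := boolP (x \in A); [rewrite fA // hA //; ring|rewrite hL //; ring].
have -> : cform f f = cform h h + 2 * cform g h + cform g g.
  rewrite /cform mulr_sumr -!big_split; apply: eq_bigr => x _; rewrite mulr_sumr -!big_split.
  by apply: eq_bigr => y _; rewrite /= /g; ring.
by rewrite gh mulr0 addr0 lerDl cform_ge0.
Qed.

Lemma equilibrium_01 A s h : (forall x y, 0 <= r x y) -> irreducible_rates r ->
  equilibrium A s h -> forall x, 0 <= h x <= 1.
Proof.
move=> r0 irr [hs hA hL] x; have A0 : exists a, a \in (s |: A)%SET by exists s; rewrite finset.setU11.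
apply/andP; split.
  apply: (min_principle r0 irr A0) => y.
    by rewrite !inE negb_or => /andP[ys yA]; rewrite hL.
  by rewrite !inE => /orP[/eqP ->|/hA ->]; rewrite ?hs.
rewrite -subr_ge0; apply: (min_principle (u := fun y => 1 - h y) r0 irr A0) => y.
  rewrite !inE negb_or => /andP[ys yA].
  rewrite (generatorB r (fun=> 1) h) hL // subr0 /generator big1 // => z _.
  by rewrite subrr mulr0.
by rewrite !inE => /orP[/eqP ->|/hA ->]; rewrite ?hs ?subrr ?subr0.
Qed.

Lemma equilibrium_exists A s : (forall x y, 0 <= r x y) -> irreducible_rates r ->
  s \notin A -> exists h, equilibrium A s h.
Proof.
move=> r0 irr sA; have A0 : exists a, a \in (s |: A)%SET by exists s; rewrite finset.setU11.
(* The boundary value 1 at [s] is moved to the right-hand side by subtracting the indicator of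
   [s]. *)
have [v [vA vL]] := dirichlet_problem r0 irr (fun x => - generator r (fun y => (y == s)%:R) x) A0.
exists (fun x => v x + (x == s)%:R); split.
- by rewrite vA ?finset.setU11 // eqxx add0r.
- move=> x xA; rewrite vA ?inE ?xA ?orbT // add0r.
  by have [e|//] := eqVneq x s; rewrite -e xA in sA.
- move=> x xA xs; have := vL x; rewrite !inE negb_or xs xA => /(_ isT) e.
  rewrite -(addNr (generator r (fun y => (y == s)%:R) x)) -e.
  by rewrite /generator -big_split; apply: eq_bigr => y _ /=; ring.
Qed.

(* Green's formula for the pair of the equilibrium potential and the mean
   hitting time, evaluated in both ways. *)
Lemma hitting_time_capacity A s h v : equilibrium A s h -> s \notin A ->
  (forall x, x \in A -> v x = 0) -> (forall x, x \notin A -> generator r v x = -1) ->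
  v s * cform h h = 2 * \sum_x mu x * h x.
Proof.
move=> [hs hA hL] sA vA vL.
have at_s (u : V -> R) : (forall x, x \in A -> u x = 0) ->
    cform u h = 2 * (mu s * u s * - generator r h s).
  move=> uA; rewrite green (bigD1 s) //= big1 ?addr0 // => x xs.
  by have [xA|xA] := boolP (x \in A); [rewrite uA //; ring|rewrite hL //; ring].
have -> : v s * cform h h = cform v h by rewrite (at_s h hA) (at_s v vA) hs; ring.
rewrite cformC green; congr (_ * _); apply: eq_bigr => x _.
by have [xA|xA] := boolP (x \in A); [rewrite hA //; ring|rewrite vL // opprK mulr1].
Qed.

End Reversible.


(** * Mean hitting times of a finite Markov chain *)

Section Skeleton.
Variables (R : realType) (d : measure_display) (Omega : measurableType d).
Variables (P : probability Omega R) (V : finType) (r : V -> V -> R) (v0 : V).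
Variables (X : R -> Omega -> V) (p : R -> V -> V -> R) (A : {set V}) (delta : R).
Hypotheses (mX : forall (t : R) v, (0 <= t)%R -> measurable [set w | X t w = v]%classic).
Hypothesis fdd : forall (n : nat) (t : nat -> R) (x : nat -> V),
  t 0%N = 0%R -> (forall i, t i <= t i.+1)%R ->
  P [set w | forall i, (i <= n)%N -> X (t i) w = x i]%classic =
  ((x 0%N == v0)%:R * \prod_(i < n) p (t i.+1 - t i) (x i) (x i.+1))%:E%R.
Hypothesis d0 : (0 < delta)%R.
Local Open Scope ring_scope.
Local Open Scope classical_set_scope.

Local Notation time k := (k%:R * delta).

Definition killed (f : V -> R) (y : V) : R := \sum_(z | z \notin A) p delta y z * f z.

(** The probability of missing [A] at the grid times 1 to [k]; the starting point itself is not
    tested, whence the hypothesis of [prob_survival]. *)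
Definition survival (k : nat) : V -> R := iter k killed (fun=> 1).

Definition avoid (m n : nat) : set Omega :=
  [set w | forall j, (m < j <= n)%N -> X (time j) w \notin A].

Definition prefix (x : nat -> V) (k : nat) : set Omega :=
  [set w | forall i, (i <= k)%N -> X (time i) w = x i].

Let time_ge0 k : 0 <= time k.
Proof. by rewrite mulr_ge0 // ltW. Qed.

Let measurable_in k (B : {set V}) : measurable [set w | X (time k) w \in B].
Proof.
have -> : [set w | X (time k) w \in B] = \bigcup_(z in [set` B]) [set w | X (time k) w = z].
  by apply/seteqP; split=> w /=; [move=> h; exists (X (time k) w)|move=> [z zB ->]].
by apply: fin_bigcup_measurable => // z _; apply: mX.
Qed.

Lemma measurable_avoid m n : measurable (avoid m n).
Proof.
have -> : avoid m n = \bigcap_(j in [set j | (m < j <= n)%N]) [set w | X (time j) w \in (~: A)%SET].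
  by apply/seteqP; split=> w h j hj; have := h j hj; rewrite /= inE.
by apply: bigcap_measurableType => j _; apply: measurable_in.
Qed.

Lemma measurable_prefix x k : measurable (prefix x k).
Proof.
have -> : prefix x k = \bigcap_(j in [set j | (j <= k)%N]) [set w | X (time j) w = x j].
  by apply/seteqP; split=> w h j hj; have := h j hj.
by apply: bigcap_measurableType => j _; apply: mX.
Qed.

Lemma prob_split (B : set Omega) k : measurable B ->
  P B = (\sum_z P (B `&` [set w | X (time k) w = z]))%E.
Proof.
move=> mB; pose F z := B `&` [set w | X (time k) w = z].
have -> : P B = P (\bigcup_(z in [set` index_enum V]) F z).
  congr (P _); apply/seteqP; split=> w; last by move=> [z _ []].
  by move=> Bw; exists (X (time k) w) => //=; rewrite mem_index_enum.
rewrite measure_fin_bigcup.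
- by rewrite -fsbig_seq // index_enum_uniq.
- exact: finite_seq.
- by move=> z z' _ _ [w [[_ <-] [_ <-]]].
- by move=> z _; apply: measurableI => //; apply: mX.
Qed.

Definition extend (x : nat -> V) (k : nat) (z : V) : nat -> V :=
  fun i => if (i <= k)%N then x i else z.

Lemma prob_prefix x k : P (prefix x k) =
  ((x 0%N == v0)%:R * \prod_(i < k) p delta (x i) (x i.+1))%:E.
Proof.
rewrite /prefix (@fdd k (fun i => time i)) ?mul0r // => [|i]; last first.
  by rewrite ler_wpM2r ?ler_nat // ltW.
by congr (_ * _)%:E; apply: eq_bigr => i _; rewrite -mulrBl -natrB // subSnn mul1r.
Qed.

Lemma prefix_extend x k z : prefix x k `&` [set w | X (time k.+1) w = z] = prefix (extend x k z) k.+1.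
Proof.
apply/seteqP; split=> w /=.
  move=> [h1 h2] i; rewrite leq_eqVlt => /orP[/eqP ->|ik]; first by rewrite /extend ltnn.
  by rewrite /extend -ltnS ik; apply: h1.
move=> h; split; last by rewrite h // /extend ltnn.
by move=> i ik; rewrite h ?(leqW ik) // /extend ik.
Qed.

(** Keeping the whole past in [prefix] lets the product form of the finite-dimensional distributions
    play the role of the Markov property. *)
Lemma prob_prefix_avoid m : forall x k,
  P (prefix x k `&` avoid k (k + m)) = (fine (P (prefix x k)) * survival m (x k))%:E.
Proof.
elim: m => [|m IH] x k.
  have -> : avoid k (k + 0) = setT.
    by rewrite -subTset => w _ j /andP[h1 h2]; move: h2; rewrite addn0 leqNgt h1.
  by rewrite setIT mulr1 fineK // fin_num_measure //; exact: measurable_prefix.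
rewrite (prob_split k.+1); last by apply: measurableI; [exact: measurable_prefix|exact: measurable_avoid].
rewrite [survival m.+1 _]/(killed (survival m) _) /killed mulr_sumr -sumEFin [RHS]big_mkcond /=.
apply: eq_bigr => z _; case: ifPn => [zA|]; last first.
  rewrite negbK => zA; rewrite (_ : _ `&` _ = set0) ?measure0 //.
  rewrite -subset0 => w [[_ h] /= e].
  by have := h k.+1; rewrite ltnS leqnn e zA addnS ltnS leq_addr => /(_ isT).
have -> : prefix x k `&` avoid k (k + m.+1) `&` [set w | X (time k.+1) w = z] =
    prefix (extend x k z) k.+1 `&` avoid k.+1 (k.+1 + m).
  rewrite -prefix_extend; apply/seteqP; split=> w /=.
    move=> [[h1 h2] h3]; split=> // j /andP[j1 j2]; apply: h2.
    by rewrite (ltnW j1) addnS -addSn j2.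
  move=> [[h1 h2] h3]; split=> //; split=> // j /andP[]; rewrite leq_eqVlt => /orP[/eqP <-|j1] j2.
    by rewrite h2.
  by apply: h3; rewrite j1 addSn -addnS j2.
rewrite IH [extend x k z k.+1]/extend ltnn mulrA; congr (_ * _)%:E.
rewrite !prob_prefix /= big_ord_recr /= /extend leqnn ltnn mulrA; congr (_ * _ * _).
by apply: eq_bigr => i _; rewrite !ltn_ord (ltnW (ltn_ord i)).
Qed.

Lemma prob_survival m : v0 \notin A ->
  P [set w | forall j, (j <= m)%N -> X (time j) w \notin A] = (survival m v0)%:E.
Proof.
move=> v0A; have -> : [set w | forall j, (j <= m)%N -> X (time j) w \notin A] =
    [set w | X (time 0) w \in (~: A)%SET] `&` avoid 0 m.
  apply/seteqP; split=> w /=; first by move=> h; rewrite inE h //; split=> // j /andP[_]; apply: h.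
  by rewrite inE => -[h1 h2] [|j] hj //; apply: h2; rewrite hj.
rewrite (prob_split 0); last by apply: measurableI; [exact: measurable_in|exact: measurable_avoid].
have pre z : prefix (fun=> z) 0 = [set w | X (time 0) w = z].
  by apply/seteqP; split=> w /=; [apply|move=> h [|i]].
rewrite (bigD1 v0) //= big1 ?adde0.
  have -> : [set w | X (time 0) w \in (~: A)%SET] `&` avoid 0 m `&` [set w | X (time 0) w = v0] =
      prefix (fun=> v0) 0 `&` avoid 0 (0 + m).
    rewrite pre add0n; apply/seteqP; split=> w /=; first by move=> [[_ h] e].
    by move=> [h1 h2]; rewrite h1 inE.
  by rewrite prob_prefix_avoid prob_prefix /= eqxx big_ord0 !mul1r.
move=> z zv; apply/eqP; rewrite eq_le measure_ge0 andbT.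
apply: (@le_trans _ _ (P (prefix (fun=> z) 0))).
  apply: le_measure; rewrite ?inE; last by move=> w [_]; rewrite pre.
    by apply: measurableI; [apply: measurableI; [exact: measurable_in|exact: measurable_avoid]|exact: mX].
  exact: measurable_prefix.
by rewrite prob_prefix (negbTE zv) mul0r.
Qed.

End Skeleton.


Section SkeletonMean.
Variables (R : realType) (V : finType) (r : V -> V -> R) (p : R -> V -> V -> R) (A : {set V}).
Variable v : V -> R.
Local Open Scope ring_scope.
Local Open Scope classical_set_scope.
Hypothesis pP : is_transition_function r p.
Hypotheses (v0 : forall x, 0 <= v x) (vA : forall x, x \in A -> v x = 0).
Hypothesis vL : forall x, x \notin A -> generator r v x = -1.

Let p0 h x y : 0 <= h -> 0 <= p h x y. Proof. exact: (trans_ge0 pP). Qed.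

(** First-order expansion [v + h * generator v = v - h] off [A]; killing is harmless as [v] vanishes
    on [A], and the error is uniform because there are finitely many states. *)
Lemma killed_rate e : 0 < e -> exists2 h0, 0 < h0 & forall h, 0 < h < h0 ->
  forall y, y \notin A -> v y - h * (1 + e) <= killed p A h v y <= v y - h * (1 - e).
Proof.
move=> e0; pose f h y := \sum_z h^-1 * p h y z * (v z - v y).
have fcvg y : f h y @[h --> 0^'+] --> generator r v y.
  apply: cvg_big => [|z _]; first exact: add_continuous.
  have [->|yz] := eqVneq z y.
    by rewrite subrr mulr0; under eq_fun do rewrite mulr0; apply: cvg_cst.
  by apply: cvgMl; apply: (trans_rate pP); rewrite eq_sym.
have : \forall h \near 0^'+, forall y, `|f h y - generator r v y| < e.
  apply: filter_forall => y; have /cvgrPdist_lt /(_ e e0) := fcvg y.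
  by apply: filterS => h; rewrite distrC.
rewrite near_withinE => -[h0 /= h00 hh]; exists h0 => // h /andP[hp hlt] y yA.
have := hh h; rewrite /= sub0r normrN gtr0_norm // => /(_ hlt hp y).
rewrite vL // opprK => fe.
have kE : killed p A h v y = v y + h * f h y.
  rewrite /killed; have -> : \sum_(z | z \notin A) p h y z * v z = \sum_z p h y z * v z.
    rewrite [RHS](bigID (mem A)) /= [X in _ = X + _]big1 ?add0r // => z zA.
    by rewrite vA ?mulr0.
  rewrite /f mulr_sumr -[X in X + _](mul1r (v y)) -(trans_sum1 pP y (ltW hp)) mulr_suml -big_split.
  by apply: eq_bigr => z _ /=; rewrite !mulrA divff ?gt_eqF // mul1r; ring.
by rewrite kE; move: fe; rewrite ltr_norml => /andP[fe1 fe2]; apply/andP; split; nra.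
Qed.

Section Step.
Variables (h e : R).
Hypotheses (h0 : 0 < h) (e0 : 0 < e) (e1 : e < 1).
Hypothesis rate : forall y, y \notin A ->
  v y - h * (1 + e) <= killed p A h v y <= v y - h * (1 - e).
Local Notation kill := (killed p A h).
Local Notation surv := (survival p A h).

Lemma killed_le f g y : (forall z, z \notin A -> f z <= g z) -> kill f y <= kill g y.
Proof. by move=> fg; apply: ler_sum => z zA; rewrite ler_wpM2l ?fg // p0 // ltW. Qed.

Lemma survival_ge0 k y : 0 <= surv k y.
Proof.
elim: k y => [|k IH] y; first exact: ler01.
by apply: sumr_ge0 => z _; rewrite mulr_ge0 // p0 // ltW.
Qed.

Lemma survival_anti k y : surv k.+1 y <= surv k y.
Proof.
elim: k y => [|k IH] y; last first.
  by apply: (@killed_le (surv k.+1) (surv k)) => z _; apply: IH.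
rewrite /= /killed -[leRHS](trans_sum1 pP y (ltW h0)) [leRHS](bigID (mem A)) /=.
rewrite -[leLHS]add0r lerD //; first by apply: sumr_ge0 => z _; rewrite p0 // ltW.
by apply: ler_sum => z _; rewrite mulr1.
Qed.

Lemma sum_survivalS n y : \sum_(k < n.+1) surv k y = 1 + kill (fun z => \sum_(k < n) surv k z) y.
Proof.
rewrite big_ord_recl /= /killed; congr (_ + _); rewrite [LHS]exchange_big /=.
by apply: eq_bigr => z _; rewrite mulr_sumr.
Qed.

Lemma iter_killed_bound c n y : (forall z, v z <= c) -> 0 <= iter n kill v y <= c * surv n y.
Proof.
move=> vc; elim: n y => [|n IH] y /=; first by rewrite mulr1 v0 vc.
rewrite /killed mulr_sumr; apply/andP; split.
  by apply: sumr_ge0 => z _; have /andP[h1 _] := IH z; rewrite mulr_ge0 // p0 // ltW.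
apply: ler_sum => z _; have /andP[_ h1] := IH z.
by rewrite mulrCA ler_wpM2l // p0 // ltW.
Qed.

(** Each grid step lowers [v] by [h] up to a factor [1 - e] or [1 + e] while the chain survives;
    summing over [n] steps leaves the value of [v] at the surviving end. *)
Lemma survival_sum_bounds n y : y \notin A ->
  (1 - e) * h * (\sum_(k < n) surv k y) + iter n kill v y <= v y <=
  (1 + e) * h * (\sum_(k < n) surv k y) + iter n kill v y.
Proof.
elim: n y => [|n IH] y yA; first by rewrite big_ord0 !mulr0 !add0r lexx.
have lin c f g : kill (fun z => c * f z + g z) y = c * kill f y + kill g y.
  by rewrite /killed mulr_sumr -big_split; apply: eq_bigr => z _ /=; ring.
have /andP[r1 r2] := rate yA; rewrite sum_survivalS /=; apply/andP; split.
  have := @killed_le (fun z => (1 - e) * h * (\sum_(k < n) surv k z) + iter n kill v z) v y.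
  rewrite lin => /(_ (fun z zA => proj1 (andP (IH z zA)))) le1.
  by move: le1 r2; rewrite /=; lra.
have := @killed_le v (fun z => (1 + e) * h * (\sum_(k < n) surv k z) + iter n kill v z) y.
rewrite lin => /(_ (fun z zA => proj2 (andP (IH z zA)))) le1.
by move: le1 r1; rewrite /=; lra.
Qed.

Let c := \sum_x v x.

Let v_le z : v z <= c.
Proof. by rewrite /c (bigD1 z) //= lerDl sumr_ge0. Qed.

Lemma survival_sum_le n y : y \notin A -> h * (\sum_(k < n) surv k y) <= v y / (1 - e).
Proof.
move=> yA; rewrite ler_pdivlMr ?subr_gt0 //.
have /andP[b1 _] := survival_sum_bounds n yA; have /andP[b0 _] := iter_killed_bound n y v_le.
by move: b1 b0; lra.
Qed.

(** The remainder is at most [c * surv n y]. Survival probabilities decrease and have bounded sum,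
    so [n * surv n y] is bounded and the remainder tends to 0. *)
Lemma survival_sum_ge y t : y \notin A -> (forall n, h * (\sum_(k < n) surv k y) <= t) ->
  v y <= (1 + e) * t.
Proof.
move=> yA ht; rewrite leNgt; apply/negP => lt.
have c0 : 0 <= c by apply: sumr_ge0.
have gap : 0 < v y - (1 + e) * t by rewrite subr_gt0.
have t0 : 0 <= t by apply: le_trans (ht 0%N); rewrite big_ord0 mulr0.
pose n := (Num.truncn (c * t / h / (v y - (1 + e) * t))).+1.
have hn : c * t / h / (v y - (1 + e) * t) < n%:R by apply: truncnS_gt.
have anti l m : (l <= m)%N -> surv m y <= surv l y.
  by move/subnK <-; elim: (m - l)%N => // i IH; rewrite addSn (le_trans (survival_anti _ _)).
have nS : n%:R * surv n y <= \sum_(k < n) surv k y.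
  rewrite mulr_natl -[X in _ *+ X]card_ord -sumr_const; apply: ler_sum => k _.
  exact/anti/ltnW.
have /andP[_ b1] := survival_sum_bounds n yA; have /andP[_ b0] := iter_killed_bound n y v_le.
have b2 : (1 + e) * h * (\sum_(k < n) surv k y) <= (1 + e) * t.
  by rewrite -mulrA ler_wpM2l ?ht // addr_ge0 // ltW.
have b3 : v y - (1 + e) * t <= c * surv n y by move: b0 b1 b2; lra.
have b4 : h * (n%:R * surv n y) <= t by apply: le_trans (ht n); rewrite ler_pM2l.
move: hn; rewrite !ltr_pdivrMr // => hn.
have : (v y - (1 + e) * t) * n%:R * h <= c * surv n y * n%:R * h.
  by rewrite ler_wpM2r ?(ltW h0) // ler_wpM2r.
have : c * (h * (n%:R * surv n y)) <= c * t by rewrite ler_wpM2l.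
by move: hn; lra.
Qed.

End Step.

End SkeletonMean.


(** * From grid times to continuous time *)

Section MeanHitting.
Variables (R : realType) (V : finType) (r : V -> V -> R) (v0 : V) (C : markov_chain r v0).
Variable A : {set V}.
Local Open Scope ring_scope.
Local Open Scope classical_set_scope.

Local Notation X := (@chain_path _ _ _ _ C).
Local Notation P := (chain_prob C).
Local Notation tau := (@hitting_time _ _ _ _ C A).

Let before (h : R) (k : nat) : set (chain_space C) :=
  [set w | forall j, (j <= k)%N -> X (j%:R * h) w \notin A].

(** The first grid time in [A], written as a series of indicators so that its mean is the series of
    survival probabilities. *)
Definition grid_time (h : R) (w : chain_space C) : \bar R :=
  (\sum_(0 <= k <oo) (h * \1_(before h k) w)%:E)%E.

Let term_ge0 h k w : 0 <= h -> (0 <= (h * \1_(before h k) w)%:E)%E.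
Proof. by move=> h0; rewrite lee_fin mulr_ge0. Qed.

Lemma grid_time_le h k w : 0 <= h -> X (k%:R * h) w \in A -> (grid_time h w <= (k%:R * h)%:E)%E.
Proof.
move=> h0 hit; apply: lime_le; first by apply: is_cvg_nneseries => j _ _; apply: term_ge0.
apply: nearW => n; rewrite sumEFin lee_fin.
apply: (@le_trans _ _ ((minn n k)%:R * h)); last by rewrite ler_wpM2r // ler_nat geq_minr.
elim: n => [|n IH]; first by rewrite big_nil min0n mul0r.
rewrite big_nat_recr //=; case: (ltnP n k) => nk.
  rewrite (minn_idPl nk) -[n.+1]addn1 natrD mulrDl mul1r; move: IH; rewrite (minn_idPl (ltnW nk)) => IH.
  by rewrite lerD // -[leRHS]mulr1 ler_wpM2l // indicE lern1 leq_b1.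
rewrite (minn_idPr (leqW nk)); move: IH; rewrite (minn_idPr nk) => IH.
rewrite indicE memNset ?mulr0 ?addr0 //= => /(_ k nk).
by rewrite hit.
Qed.

Lemma grid_time_ge h k w : 0 <= h -> (forall j, (j < k)%N -> X (j%:R * h) w \notin A) ->
  ((k%:R * h)%:E <= grid_time h w)%E.
Proof.
move=> h0 miss; apply: le_trans (nneseries_lim_ge k _) => [|j _ _]; last exact: term_ge0.
rewrite sumEFin lee_fin (eq_big_nat _ _ (F2 := fun=> h)) => [|j /andP[_ jk]]; last first.
  by rewrite indicE mem_set ?mulr1 //= => i ij; apply/miss/(leq_ltn_trans ij).
by rewrite sumr_const_nat subn0 mulr_natl.
Qed.

Lemma grid_time_first h w : 0 < h ->
  (exists2 k, X (k%:R * h) w \in A & grid_time h w = (k%:R * h)%:E) \/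
  grid_time h w = +oo%E.
Proof.
move=> h0; case: (pselect (exists k, X (k%:R * h) w \in A)) => [hit|miss].
  case: (ex_minnP hit) => k kA kmin; left; exists k => //; apply/eqP.
  rewrite eq_le grid_time_le ?grid_time_ge ?(ltW h0) // => j jk.
  by apply/negP => /kmin; rewrite leqNgt jk.
right; apply/eqyP => t t0; set k := (Num.trunc (t / h)).+1.
apply: (@le_trans _ _ (k%:R * h)%:E).
  by rewrite lee_fin -ler_pdivrMr //; apply/ltW/truncnS_gt.
by apply: grid_time_ge; rewrite ?ltW // => j _; apply/negP => jA; apply: miss; exists j.
Qed.

Lemma grid_time_refine h n w : 0 < h -> (grid_time (h / n.+1%:R) w <= grid_time h w)%E.
Proof.
move=> h0; have [[k kA ->]|->] := grid_time_first w h0; last exact: leey.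
have e : (k * n.+1)%:R * (h / n.+1%:R) = k%:R * h.
  by rewrite natrM mulrACA divff ?pnatr_eq0 // mulr1.
by rewrite -e; apply: grid_time_le; rewrite ?e // divr_ge0 ?ltW.
Qed.

Lemma hitting_time_le_grid h w : 0 < h -> (tau w <= grid_time h w)%E.
Proof.
move=> h0; have [[k kA ->]|->] := grid_time_first w h0; last exact: leey.
apply: ereal_inf_lbound; exists (k%:R * h) => //; split; last exact: kA.
by rewrite mulr_ge0 // ltW.
Qed.

Local Notation mesh m := (2^-1 ^+ m : R).

Let mesh_gt0 m : 0 < mesh m. Proof. by rewrite exprn_gt0 // invr_gt0. Qed.

Lemma grid_time_homo w : {homo (fun m => grid_time (mesh m) w) : n m / (n <= m)%N >-> (m <= n)%E}.
Proof.
move=> n m nm; have -> : mesh m = mesh n / (2 ^ (m - n)).-1.+1%:R.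
  by rewrite prednK ?expn_gt0 // natrX -exprVn -exprD subnKC.
exact: grid_time_refine.
Qed.

(* Right continuity keeps the path in [A] on some interval [t, t + d[, which contains points of every fine enough grid. *)
Lemma grid_time_cvg w : (grid_time (mesh m) w @[m --> \oo] --> tau w)%E.
Proof.
suff -> : tau w = ereal_inf (range (fun m => grid_time (mesh m) w)).
  exact/ereal_nonincreasing_cvgn/grid_time_homo.
apply/eqP; rewrite eq_le; apply/andP; split.
  by apply: le_ereal_inf_tmp => _ [m _ <-]; apply: hitting_time_le_grid.
apply: le_ereal_inf_tmp => _ [t [t0 tA] <-]; apply/lee_addgt0Pr => e e0.
have /= := chain_right_continuous (chainP C) w t0; rewrite near_withinE => -[d /= d0 hd].
have m0 : 0 < Num.min d e by rewrite lt_min d0 e0.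
have z1 : `|2^-1 : R| < 1 by rewrite gtr0_norm ?invf_lt1 ?invr_gt0 ?ltr1n.
have /cvgrPdist_lt /(_ _ m0) := cvg_expr z1.
move=> [m _ /(_ m (leqnn m))] /=; rewrite sub0r normrN gtr0_norm // lt_min => /andP[md me].
set h := mesh m in md me; have h0 : 0 < h by apply: mesh_gt0.
set k := (Num.trunc (t / h)).+1.
have tk : t < k%:R * h by rewrite -ltr_pdivrMr // truncnS_gt.
have kt : k%:R * h <= t + h.
  rewrite -natr1 mulrDl mul1r lerD2r -ler_pdivlMr // truncn_le divr_ge0 // ltW //.
apply: (@le_trans _ _ (grid_time h w)); first by apply: ereal_inf_lbound; exists m.
apply: (@le_trans _ _ (k%:R * h)%:E); last by rewrite -EFinD lee_fin (le_trans kt) // lerD2l ltW.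
apply: grid_time_le; first exact: ltW.
rewrite hd //= distrC gtr0_norm ?subr_gt0 // ltrBlDr addrC (le_lt_trans kt) // ltrD2l //.
Qed.

Hypothesis v0A : v0 \notin A.

Let measurable_before h k : 0 < h -> measurable (before h k).
Proof.
move=> h0; have -> : before h k = \bigcap_(j in [set j | (j <= k)%N])
    \bigcup_(z in [set` (~: A)%SET]) [set w | X (j%:R * h) w = z].
  apply/seteqP; split=> w hw j /= jk; first by exists (X (j%:R * h) w) => //=; rewrite inE hw.
  by have [z /=] := hw j jk; rewrite inE => zA ->.
apply: bigcap_measurableType => j _; apply: fin_bigcup_measurable => // z _.
by apply: (chain_measurable (chainP C)); rewrite mulr_ge0 // ltW.
Qed.

Lemma measurable_grid_time h : 0 < h -> measurable_fun setT (grid_time h).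
Proof.
move=> h0; apply: (@ge0_emeasurable_sum _ _ _ _ (fun k w => (h * \1_(before h k) w)%:E) xpredT).
  by move=> k w _ _; apply/term_ge0/ltW.
move=> k _; apply/measurable_EFinP; apply: measurable_funM; first exact: measurable_cst.
exact/measurable_indic/measurable_before.
Qed.

Variable v : V -> R.
Hypotheses (v_ge0 : forall x, 0 <= v x) (vA : forall x, x \in A -> v x = 0).
Hypothesis vL : forall x, x \notin A -> generator r v x = -1.

Lemma mean_grid_time h p : 0 < h ->
  (forall (n : nat) (t : nat -> R) (x : nat -> V),
      t 0%N = 0 -> (forall i, t i <= t i.+1) ->
      P [set w | forall i, (i <= n)%N -> X (t i) w = x i] =
      ((x 0%N == v0)%:R * \prod_(i < n) p (t i.+1 - t i) (x i) (x i.+1))%:E) ->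
  (\int[P]_w grid_time h w = \sum_(0 <= k <oo) (h * survival p A h k v0)%:E)%E.
Proof.
move=> h0 fdd; rewrite /grid_time integral_nneseries //=.
- apply: eq_eseriesr => k _; rewrite (integralZl_indic measurableT (fun=> before h k)) //.
  + rewrite integral_indic ?setIT //; last exact: measurable_before.
    rewrite EFinM; congr (_ * _)%E; apply: prob_survival fdd h0 _ v0A => t z t0.
    exact: (chain_measurable (chainP C)).
  + by move=> hn; move: (lt_trans hn h0); rewrite ltxx.
  + exact: measurable_before.
- move=> k; apply/measurable_EFinP; apply: measurable_funM; first exact: measurable_cst.
  exact/measurable_indic/measurable_before.
- by move=> k w _; apply/term_ge0/ltW.
Qed.

Lemma mean_grid_time_bounds e : 0 < e -> e < 1 -> exists2 h0, 0 < h0 & forall h, 0 < h < h0 ->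
  ((v v0 / (1 + e))%:E <= \int[P]_w grid_time h w <= (v v0 / (1 - e))%:E)%E.
Proof.
move=> e0 e1; have [p pP fdd] := chain_fdd (chainP C).
have [h0 h00 rate] := killed_rate pP vA vL e0; exists h0 => // h hh.
have hp : 0 < h by case/andP: hh.
have s0 k : (0 <= (h * survival p A h k v0)%:E)%E.
  by rewrite lee_fin mulr_ge0 ?(ltW hp) //; apply: (survival_ge0 A pP hp).
have part n : (\sum_(0 <= k < n) (h * survival p A h k v0)%:E)%E =
    (h * \sum_(k < n) survival p A h k v0)%:E.
  by rewrite sumEFin mulr_sumr big_mkord.
rewrite (mean_grid_time hp fdd); apply/andP; split; last first.
  apply: lime_le; first by apply: is_cvg_nneseries => k _ _; apply: s0.
  by apply: nearW => n; rewrite part lee_fin (survival_sum_le pP v_ge0 hp e1 (rate h hh)).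
have le n : ((h * \sum_(k < n) survival p A h k v0)%:E <= \sum_(0 <= k <oo) (h * survival p A h k v0)%:E)%E.
  by rewrite -part; apply: nneseries_lim_ge => k _ _; apply: s0.
move: le; case: (\sum_(0 <= k <oo) _)%E => [t||] le; rewrite ?leey //.
  rewrite lee_fin ler_pdivrMr ?addr_gt0 // mulrC.
  by apply: (survival_sum_ge pP v_ge0 hp e0 (rate h hh)).
by have := le 0%N; rewrite leeNy_eq.
Qed.

(** Dyadic grid times decrease to the hitting time, which is thereby measurable. One of them has
    finite mean and dominates the finer ones, so the bounds pass to the limit; then [e] tends to
    0. *)
Lemma mean_hitting_timeE : mean_hitting_time C A = (v v0)%:E.
Proof.
have z1 : `|2^-1 : R| < 1 by rewrite gtr0_norm ?invf_lt1 ?invr_gt0 ?ltr1n.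
have fine_mesh h0 : 0 < h0 -> \forall m \near \oo, 0 < mesh m < h0.
  move=> h00; have /cvgrPdist_lt /(_ _ h00) := cvg_expr z1.
  by apply: filterS => m; rewrite /= sub0r normrN gtr0_norm // mesh_gt0.
have tau0 w : (0 <= tau w)%E by apply: le_ereal_inf_tmp => _ [t [t0 _] <-]; rewrite lee_fin.
have bounds0 m w : (0 <= grid_time (mesh m) w)%E.
  by apply: le_trans (tau0 w) _; apply: hitting_time_le_grid.
have half : (0 < (2^-1 : R)) /\ ((2^-1 : R) < 1) by rewrite invr_gt0 ltr0n invf_lt1 ?ltr1n.
have [h0 h00 hh] := mean_grid_time_bounds half.1 half.2.
have [m0 _ hm0] := fine_mesh h0 h00.
have mtau : measurable_fun setT tau.
  apply: (@emeasurable_fun_cvg _ _ _ setT (fun m => grid_time (mesh m)) tau) => [m|w _].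
    exact: measurable_grid_time.
  exact: grid_time_cvg.
have ig : P.-integrable setT (grid_time (mesh m0)).
  apply/integrableP; split; first exact: measurable_grid_time.
  under eq_integral do rewrite gee0_abs //.
  have /andP[_ b] := hh _ (hm0 m0 (leqnn m0)).
  exact: le_lt_trans b (ltry _).
have lim : (\int[P]_w grid_time (mesh (m + m0)) w @[m --> \oo] --> \int[P]_w tau w)%E.
  have [|||||_ _] := @dominated_convergence _ _ _ P setT measurableT
      (fun m => grid_time (mesh (m + m0))) tau (grid_time (mesh m0)).
  - by move=> m; apply: measurable_grid_time.
  - by [].
  - apply: aeW => w _ /=.
    by have := @grid_time_cvg w; rewrite -(cvg_shiftn m0).
  - by [].
  - apply: aeW => w m _; rewrite gee0_abs //.
    by apply: grid_time_homo; rewrite leq_addl.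
  - by [].
have bnd e : 0 < e -> e < 1 -> ((v v0 / (1 + e))%:E <= \int[P]_w tau w <= (v v0 / (1 - e))%:E)%E.
  move=> e0 e1; have [h1 h10 hh1] := mean_grid_time_bounds e0 e1.
  have [m1 _ hm1] := fine_mesh h1 h10.
  have nr : \forall m \near \oo, ((v v0 / (1 + e))%:E <= \int[P]_w grid_time (mesh (m + m0)) w <= (v v0 / (1 - e))%:E)%E.
    by exists m1 => // m /= mm; apply/hh1/hm1; rewrite /= (leq_trans mm) ?leq_addr.
  apply/andP; split; [apply: cvge_ge lim|apply: cvge_le lim].
    by apply: filterS nr => m /andP[].
  by apply: filterS nr => m /andP[].
rewrite /mean_hitting_time; have := bnd _ half.1 half.2.
move: bnd; case: (\int[P]_w _)%E => [t bnd _||]; last first.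
- by move=> _ /andP[].
- by move=> _ /andP[_].
have {}bnd e : 0 < e -> e < 1 -> v v0 <= t * (1 + e) /\ t * (1 - e) <= v v0.
  move=> e0 e1; have := bnd e e0 e1; rewrite !lee_fin.
  by rewrite ler_pdivrMr ?addr_gt0 // ler_pdivlMr ?subr_gt0 // => /andP[].
congr (_%:E); apply/eqP; rewrite eq_le.
have t0 : 0 <= t.
  have [b _] := bnd _ half.1 half.2; rewrite -(pmulr_lge0 _ (_ : 0 < 1 + 2^-1 :> R)).
    exact: le_trans (v_ge0 v0) b.
  by rewrite addr_gt0 // half.1.
have sm e : 0 < e -> let d := Num.min 2^-1 (e / (t + 1)) in [/\ 0 < d, d < 1 & t * d <= e].
  move=> e0 d; have d0 : 0 < d by rewrite lt_min half.1 divr_gt0 // ltr_wpDl.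
  split=> //; first by rewrite gt_min half.2.
  have : d <= e / (t + 1) by rewrite ge_min lexx orbT.
  by rewrite ler_pdivlMr ?ltr_wpDl //; rewrite mulrDr mulr1 (mulrC d); apply: le_trans; rewrite lerDl ltW.
by apply/andP; split; apply/ler_addgt0Pr => e /sm[d0 d1 de];
   have [b1 b2] := bnd _ d0 d1; lra.
Qed.

End MeanHitting.


(** * Low-temperature asymptotics of Metropolis chains *)

Section Metropolis.
Variables (R : realType) (V : finType) (E : rel V) (H : V -> nat).
Local Open Scope ring_scope.
Local Open Scope classical_set_scope.
Implicit Types (b : R) (x y : V) (f : V -> R).

Definition metropolis b x y : R :=
  if E x y then expR (- b * Num.max ((H y)%:R - (H x)%:R) 0) else 0.

Definition gibbs b x : R := expR (- b * (H x)%:R).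

Local Notation height x y := (maxn (H x) (H y)).

Definition conductance b x y : R := if E x y then expR (- b * (height x y)%:R) else 0.

Hypothesis EC : forall x y, E x y = E y x.
Hypothesis E_conn : forall B : pred V, (exists x, B x) ->
  (forall x y, B x -> E x y -> B y) -> forall y, B y.

Lemma metropolis_ge0 b x y : 0 <= metropolis b x y.
Proof. by rewrite /metropolis; case: ifP => // _; apply: expR_ge0. Qed.

Lemma metropolis_irreducible b : irreducible_rates (metropolis b).
Proof.
move=> B ex st; apply: E_conn ex _ => x y Bx xy; apply: st Bx _.
by rewrite /metropolis xy expR_gt0.
Qed.

Lemma conductance_ge0 b x y : 0 <= conductance b x y.
Proof. by rewrite /conductance; case: ifP => // _; apply: expR_ge0. Qed.

Lemma conductanceC b x y : conductance b x y = conductance b y x.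
Proof. by rewrite /conductance EC maxnC. Qed.

Lemma detailed_balance b x y : x != y -> gibbs b x * metropolis b x y = conductance b x y.
Proof.
rewrite /gibbs /metropolis /conductance => _; case: ifP => _; rewrite ?mulr0 // -expRD -mulrDr.
congr (expR (_ * _)); case: (leqP (H x) (H y)) => h.
  by rewrite max_l ?subr_ge0 ?ler_nat // addrC subrK.
by rewrite max_r ?addr0 // subr_le0 ler_nat ltnW.
Qed.

Variables (A : {set V}) (s : V) (G : nat).
Hypotheses (sA : s \notin A) (Hs : H s = 0%N).
Hypothesis Hpos : forall x, x \notin A -> x != s -> (0 < H x)%N.

(** The equilibrium potential takes values in [0, 1]; requiring this of all competitors makes each
    edge above height [G] contribute at most [expR (- b)] to the rescaled form. *)
Definition admissible f : Prop :=
  [/\ f s = 1, forall x, x \in A -> f x = 0 & forall x, 0 <= f x <= 1].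

(** The Dirichlet form multiplied by [expR (b * G)], without the edges above height [G]. The
    remaining weights do not decrease with [b]. *)
Definition low_dirichlet b f : R :=
  \sum_x \sum_y (if E x y && (height x y <= G)%N
    then expR (b * (G%:R - (height x y)%:R)) * (f x - f y) ^+ 2 else 0).

Definition low_capacity b : R := inf [set low_dirichlet b f | f in admissible].

(* The limit of [low_capacity b] as [b --> +oo], by monotonicity. *)
Definition sharp_capacity : R := sup [set low_capacity b | b in [set b | 0 <= b]].

Lemma low_dirichlet_ge0 b f : 0 <= low_dirichlet b f.
Proof.
apply: sumr_ge0 => x _; apply: sumr_ge0 => y _; case: ifP => // _.
by rewrite mulr_ge0 ?expR_ge0 ?sqr_ge0.
Qed.

Lemma low_dirichlet_le b b' f : b <= b' -> low_dirichlet b f <= low_dirichlet b' f.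
Proof.
move=> bb; apply: ler_sum => x _; apply: ler_sum => y _; case: ifP => // /andP[_ h].
by rewrite ler_wpM2r ?sqr_ge0 // ler_expR ler_wpM2r // subr_ge0 ler_nat.
Qed.

Lemma admissible_indicator : admissible (fun x => (x == s)%:R).
Proof.
split=> [|x xA|x]; rewrite ?eqxx //; last by rewrite ler0n lern1 leq_b1.
by case: eqVneq xA sA => // -> ->.
Qed.

Let low_inf b : has_inf [set low_dirichlet b f | f in admissible].
Proof.
split; first by exists (low_dirichlet b (fun x => (x == s)%:R)), (fun x => (x == s)%:R) => //;
  exact: admissible_indicator.
by exists 0 => _ [f _ <-]; apply: low_dirichlet_ge0.
Qed.

Lemma low_capacity_le b f : admissible f -> low_capacity b <= low_dirichlet b f.
Proof. by move=> af; apply: ge_inf; [exact: (low_inf b).2|exists f]. Qed.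

Lemma low_capacity_ge b t : (forall f, admissible f -> t <= low_dirichlet b f) ->
  t <= low_capacity b.
Proof. by move=> h; apply: lb_le_inf; [exact: (low_inf b).1|move=> _ [f af <-]; apply: h]. Qed.

Lemma low_capacity_homo b b' : b <= b' -> low_capacity b <= low_capacity b'.
Proof.
move=> bb; apply: low_capacity_ge => f af.
exact: le_trans (low_capacity_le b af) (low_dirichlet_le f bb).
Qed.

Variables (lo up : R) (t : V -> R).
Hypothesis lo_low : forall f, admissible f -> lo <= low_dirichlet 0 f.
Hypotheses (at_ : admissible t) (t_up : low_dirichlet 0 t <= up) (lo0 : 0 < lo).
Hypothesis t_flat : forall x y, E x y -> (height x y <= G)%N -> t x = t y \/ height x y = G.

(** The test function [t] varies only across edges of height [G], whose weight is 1 for all [b], so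
    its form does not depend on [b]. *)
Lemma low_capacity_bounds b : 0 <= b -> lo <= low_capacity b <= up.
Proof.
move=> b0; apply/andP; split.
  apply: low_capacity_ge => f af; apply: le_trans (lo_low af) _; exact: low_dirichlet_le.
apply: le_trans (low_capacity_le b at_) _; apply: le_trans t_up.
rewrite le_eqVlt; apply/orP; left; apply/eqP; apply: eq_bigr => x _; apply: eq_bigr => y _.
case: ifP => // /andP[xy h]; have [->|->] := t_flat xy h.
  by rewrite subrr expr0n !mulr0.
by rewrite subrr !mulr0.
Qed.

Let low_sup : has_sup [set low_capacity b | b in [set b | 0 <= b]].
Proof.
split; first by exists (low_capacity 0), 0 => //=.
by exists up => _ [b b0 <-]; have /andP[] := low_capacity_bounds b0.
Qed.

Lemma sharp_capacity_bounds : lo <= sharp_capacity <= up.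
Proof.
have /andP[l0 _] := low_capacity_bounds (lexx 0); apply/andP; split.
  by apply: le_trans l0 _; apply: ub_le_sup; [exact: low_sup.2|exists 0 => /=].
apply: ge_sup; first exact: low_sup.1.
by move=> _ [b b0 <-]; have /andP[] := low_capacity_bounds b0.
Qed.

Lemma low_capacity_cvg : low_capacity b @[b --> +oo] --> sharp_capacity.
Proof.
apply/cvgrPdist_lt => e e0; have [_ [b b0 <-] hb] := sup_adherent e0 low_sup.
near=> b'; have bb : b <= b' by near: b'; apply: nbhs_pinfty_ge; apply: num_real.
have h1 := low_capacity_homo bb.
have h2 : low_capacity b' <= sharp_capacity.
  by apply: ub_le_sup; [exact: low_sup.2|exists b' => //=; apply: le_trans bb].
by rewrite ger0_norm ?subr_ge0 // ltrBlDl -ltrBlDr (lt_le_trans hb).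
Unshelve. all: by end_near.
Qed.

Let n2 : R := (#|V| * #|V|)%:R.

Section Fixed.
Variables (b : R) (h v : V -> R).
Hypothesis b0 : 0 <= b.
Hypothesis eqh : equilibrium (metropolis b) A s h.
Local Notation cap := (expR (G%:R * b) * cform (conductance b) h h).

Lemma scaled_form f : expR (G%:R * b) * cform (conductance b) f f =
  \sum_x \sum_y (if E x y then expR (b * (G%:R - (height x y)%:R)) * (f x - f y) ^+ 2 else 0).
Proof.
rewrite /cform mulr_sumr; apply: eq_bigr => x _; rewrite mulr_sumr; apply: eq_bigr => y _.
rewrite /conductance; case: ifP => _; last by rewrite !mul0r mulr0.
by rewrite -mulrA -expr2 mulrA -expRD; congr (expR _ * _); ring.
Qed.

Lemma capacity_le f : admissible f -> cap <= low_dirichlet b f + n2 * expR (- b).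
Proof.
move=> [fs fA f01].
have le := dirichlet_principle (conductance_ge0 b) (conductanceC b) (@detailed_balance b) eqh fs fA.
apply: le_trans (ler_wpM2l (expR_ge0 _) le) _; rewrite scaled_form /low_dirichlet /n2.
have -> : (#|V| * #|V|)%:R * expR (- b) = \sum_(x : V) \sum_(y : V) expR (- b).
  by under eq_bigr do rewrite sumr_const; rewrite sumr_const -mulrnA mulr_natl.
rewrite -big_split; apply: ler_sum => x _; rewrite -big_split; apply: ler_sum => y _ /=.
case: (E x y) => /=; last by rewrite add0r expR_ge0.
case: leqP => hG; first by rewrite lerDl expR_ge0.
rewrite add0r -[leRHS]mulr1 ler_pM ?expR_ge0 ?sqr_ge0 //.
  rewrite ler_expR; have : (G%:R : R) + 1 <= (height x y)%:R by rewrite natr1 ler_nat.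
  by move: b0; nra.
by have := f01 x; have := f01 y; move=> /andP[? ?] /andP[? ?]; nra.
Qed.

(** The equilibrium potential is itself admissible, which gives the lower bound; the upper bound is
    the Dirichlet principle applied to each admissible function. *)
Lemma capacity_bounds : low_capacity b <= cap <= low_capacity b + n2 * expR (- b).
Proof.
have [hs hA _] := eqh; have h01 := equilibrium_01 (metropolis_ge0 b) (@metropolis_irreducible b) eqh.
apply/andP; split; last first.
  by rewrite -lerBlDr; apply: low_capacity_ge => f af; rewrite lerBlDr; apply: capacity_le.
apply: le_trans (low_capacity_le b (And3 hs hA h01)) _; rewrite scaled_form.
apply: ler_sum => x _; apply: ler_sum => y _; case: (E x y) => //=; case: ifP => // _.
by rewrite mulr_ge0 ?expR_ge0 ?sqr_ge0.
Qed.

(** The state [s] has weight 1, and every other state is in [A] or has energy at least 1. *)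
Lemma equilibrium_mass : 1 <= \sum_x gibbs b x * h x <= 1 + #|V|%:R * expR (- b).
Proof.
have [hs hA _] := eqh; have h01 := equilibrium_01 (metropolis_ge0 b) (@metropolis_irreducible b) eqh.
have gs : gibbs b s * h s = 1 by rewrite /gibbs Hs hs mulr0 expR0 mulr1.
rewrite (bigD1 s) //= gs lerDl lerD2l; apply/andP; split.
  by apply: sumr_ge0 => x _; rewrite mulr_ge0 ?expR_ge0 //; case/andP: (h01 x).
apply: (@le_trans _ _ (\sum_(x : V) expR (- b))); last by rewrite sumr_const mulr_natl.
rewrite [leLHS]big_mkcond /=; apply: ler_sum => x _; case: eqVneq => [_|xs] /=; first exact: expR_ge0.
have [xA|xA] := boolP (x \in A); first by rewrite hA // mulr0 expR_ge0.
rewrite -[leRHS]mulr1; have /andP[h0 h1] := h01 x; rewrite ler_pM ?expR_ge0 // ler_expR.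
by have : (1 : R) <= (H x)%:R; [rewrite ler1n Hpos|move: b0; nra].
Qed.

End Fixed.

Lemma mean_exit_cvg (v : R -> V -> R) :
  (forall b x, x \in A -> v b x = 0) ->
  (forall b x, x \notin A -> generator (metropolis b) (v b) x = -1) ->
  v b s / expR (G%:R * b) @[b --> +oo] --> 2 / sharp_capacity.
Proof.
move=> vA vL.
have /choice[h hP] : forall b, exists h, equilibrium (metropolis b) A s h.
  by move=> b; apply: equilibrium_exists => //; [exact: metropolis_ge0|exact: metropolis_irreducible].
pose cap b := expR (G%:R * b) * cform (conductance b) (h b) (h b).
pose Z b := \sum_x gibbs b x * h b x.
have sc0 : 0 < sharp_capacity by apply: lt_le_trans lo0 _; case/andP: sharp_capacity_bounds.
have near0 : \forall b \near +oo, 0 <= (b : R) by apply: nbhs_pinfty_ge; apply: num_real.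
have capc : cap b @[b --> +oo] --> sharp_capacity.
  apply: (@squeeze_cvgr _ _ _ _ low_capacity (fun b => low_capacity b + n2 * expR (- b))).
  - by apply: filterS near0 => b b0; apply: capacity_bounds.
  - exact: low_capacity_cvg.
  - rewrite -[X in _ --> X]addr0 -(mulr0 n2); apply: cvgD; first exact: low_capacity_cvg.
    by apply: cvgMr; exact: cvgr_expR.
have Zc : Z b @[b --> +oo] --> (1 : R).
  apply: (@squeeze_cvgr _ _ _ _ (fun=> 1) (fun b => 1 + #|V|%:R * expR (- b))) => //.
  - by apply: filterS near0 => b b0; apply: equilibrium_mass.
  - exact: cvg_cst.
  - rewrite -[X in _ --> X]addr0 -(mulr0 #|V|%:R); apply: cvgD; first exact: cvg_cst.
    by apply: cvgMr; exact: cvgr_expR.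
have lim : 2 * Z b / cap b @[b --> +oo] --> 2 / sharp_capacity.
  rewrite -[X in X / _](mulr1 2); apply: cvgM; first exact: cvgMr.
  by apply: cvgV => //; rewrite gt_eqF.
apply: cvg_trans lim; apply: near_eq_cvg; near=> b.
have /andP[lo_cap _] : low_capacity b <= cap b <= low_capacity b + n2 * expR (- b).
  by apply: capacity_bounds => //; near: b.
have cap0 : 0 < cap b.
  apply: lt_le_trans lo_cap; apply: (lt_le_trans lo0).
  by have /andP[] : lo <= low_capacity b <= up by apply: low_capacity_bounds; near: b.
have := hitting_time_capacity (conductanceC b) (@detailed_balance b) (hP b) sA (vA b) (vL b).
rewrite -/(Z b) => <-; rewrite /cap; move: cap0; rewrite /cap pmulr_rgt0 ?expR_gt0 // => c0.
by field; rewrite !gt_eqF ?expR_gt0.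
Unshelve. all: by end_near.
Qed.

End Metropolis.


(** * The Potts model *)

Section PottsLandscape.
Variables (q K L M : nat).
Hypotheses (K3 : 2 < K) (L3 : 2 < L) (M3 : 2 < M).
Local Notation conf := (config q K L M).
Local Notation H := (@hamiltonian q K L M).
Local Notation mono := (monochromatic K L M).
Implicit Types (sigma zeta : conf) (a b : 'I_q).

Lemma flip_connected (B : pred conf) : (exists sigma, B sigma) ->
  (forall sigma zeta, B sigma -> flip sigma zeta -> B zeta) -> forall zeta, B zeta.
Proof.
move=> [sigma Bs] st zeta; move e : #|[set x | sigma x != zeta x]%SET| => n.
elim: n zeta e => [|n IH] zeta e.
  suff <- : sigma = zeta by [].
  apply/ffunP => x; apply/eqP/negPn/negP => h.
  by have := cards0_eq e; move/setP/(_ x); rewrite !inE h.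
have /card_gt0P[z] : 0 < #|[set x | sigma x != zeta x]%SET| by rewrite e.
rewrite inE => hz; pose zeta' : conf := [ffun x => if x == z then sigma x else zeta x].
apply: (st zeta').
  apply: IH; move: e; rewrite (cardsD1 z) inE hz add1n => -[<-].
  by apply: eq_card => x; rewrite !inE ffunE; case: (x == z); rewrite ?eqxx.
rewrite /flip; apply/eqP; rewrite -(cards1 z); apply: eq_card => x; rewrite !inE ffunE.
by case: (eqVneq x z) => [->|_]; [exact: hz|rewrite eqxx].
Qed.

Lemma metropolis_rateE (R : realType) (beta : R) :
  @metropolis_rate R q K L M beta = metropolis (@flip q K L M) H beta.
Proof.
apply/funext => sigma; apply/funext => zeta; rewrite /metropolis_rate /metropolis /flip.
by case: eqP.
Qed.

Lemma hamiltonian_mono a : H (mono a) = 0.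
Proof.
apply/eqP; rewrite cards_eq0; apply/eqP/setP => e; rewrite inE; apply/negP => /imsetP[[x y]].
by rewrite inE /= !ffunE eqxx andbF.
Qed.

Lemma mono_inj : injective (@monochromatic q K L M).
Proof. by move=> a b /ffunP/(_ (0, 0, 0)%R); rewrite !ffunE. Qed.

Lemma hamiltonian_eq0 sigma : H sigma = 0 -> sigma \in ground_states q K L M.
Proof.
move/cards0_eq/setP => h0.
have nb x y : neighbour x y -> sigma x = sigma y.
  move=> n; apply/eqP/negPn/negP => ne; have := h0 [set x; y]%SET; rewrite [in RHS]inE => /negbT/negP[].
  by apply/imsetP; exists (x, y) => //; rewrite inE /= n.
have walk N (f : 'Z_N -> site K L M) : (forall i, neighbour (f i) (f (i + 1)%R)) ->
    forall i, sigma (f i) = sigma (f 0%R).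
  move=> hf i; rewrite -[i]natr_Zp; elim: (nat_of_ord i) => // n IH.
  by rewrite -addn1 natrD -(nb _ _ (hf _)).
apply/imsetP; exists (sigma (0, 0, 0)%R) => //; apply/ffunP => -[[i j] k]; rewrite ffunE.
rewrite (walk M (fun k => (i, j, k))); last by move=> x; rewrite /= !eqxx /Defs.adjacent eqxx !orbT.
rewrite (walk L (fun j => (i, j, 0%R))); last by move=> x; rewrite /= !eqxx /Defs.adjacent eqxx !orbT.
by rewrite (walk K (fun i => (i, 0%R, 0%R))) // => x; rewrite /= !eqxx /Defs.adjacent eqxx.
Qed.

Definition swap a b (sigma : conf) : conf := [ffun x => tperm a b (sigma x)].

Lemma swapK a b : involutive (swap a b).
Proof. by move=> sigma; apply/ffunP => x; rewrite !ffunE tpermK. Qed.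

Lemma swap_mono a b c : swap a b (mono c) = mono (tperm a b c).
Proof. by apply/ffunP => x; rewrite !ffunE. Qed.

Lemma swap_rate (R : realType) (beta : R) a b sigma zeta :
  metropolis_rate beta (swap a b sigma) (swap a b zeta) = metropolis_rate beta sigma zeta.
Proof.
have e x : (swap a b sigma x != swap a b zeta x) = (sigma x != zeta x).
  by rewrite !ffunE (inj_eq perm_inj).
have eH (xi : conf) : H (swap a b xi) = H xi.
  apply: eq_card => S; apply/imsetP/imsetP => -[p h ->]; exists p => //;
  by move: h; rewrite !inE !ffunE (inj_eq perm_inj).
rewrite /metropolis_rate !eH; congr (if _ then _ else _); congr (_ == _).
by apply: eq_card => x; rewrite !inE e.
Qed.

End PottsLandscape.


(** * Exit and target times under the symmetry of the spins *)

Section MeanTimes.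
Variables (R : realType) (V : finType) (r : V -> V -> R) (q : nat) (m : 'I_q -> V).
Variable swp : 'I_q -> 'I_q -> V -> V.
Local Open Scope ring_scope.
Hypotheses (r_ge0 : forall x y, 0 <= r x y) (irr : irreducible_rates r) (q2 : (2 <= q)%N).
Hypotheses (swpK : forall a b, involutive (swp a b)) (m_inj : injective m).
Hypothesis swp_m : forall a b c, swp a b (m c) = m (tperm a b c).
Hypothesis swp_rate : forall a b x y, r (swp a b x) (swp a b y) = r x y.
Implicit Types (a b c : 'I_q) (x : V).

Local Notation S := [set m c | c : 'I_q]%SET.

Let exit_set a : {set V} := (S :\ m a)%SET.

Lemma generator_swap a b u x : generator r (fun y => u (swp a b y)) x = generator r u (swp a b x).
Proof.
rewrite /generator [RHS](reindex_inj (inv_inj (swpK a b))) /=.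
by apply: eq_bigr => y _; rewrite swp_rate.
Qed.

Lemma exit_set_swap a b x : (swp a b x \in exit_set b) = (x \in exit_set a).
Proof.
have st y : y \in S -> swp a b y \in S by move=> /imsetP[c _ ->]; rewrite swp_m imset_f.
rewrite !inE; congr (~~ _ && _); last by apply/idP/idP => [/st|/st //]; rewrite swpK.
by rewrite -[X in _ == X](swpK a b) (inj_eq (inv_inj (swpK a b))) swp_m tpermR.
Qed.

Lemma other_spin a : exists b, b != a.
Proof.
have : (1 < #|'I_q|)%N by rewrite card_ord.
rewrite (cardD1 a) inE add1n ltnS => /card_gt0P[b]; rewrite !inE andbT => ba; by exists b.
Qed.

Let exit_set_ne a : exists x, x \in exit_set a.
Proof. by have [b ba] := other_spin a; exists (m b); rewrite !inE (inj_eq m_inj) ba imset_f. Qed.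

Variable v : 'I_q -> V -> R.
Hypothesis vA : forall a x, x \in exit_set a -> v a x = 0.
Hypothesis vL : forall a x, x \notin exit_set a -> generator r (v a) x = -1.

Lemma exit_swap a b x : v b (swp a b x) = v a x.
Proof.
apply: (@harmonic_unique _ _ r r_ge0 irr _ (fun y => v b (swp a b y)) (v a) (exit_set_ne a)) x => x xA.
  by rewrite generator_swap !vL // exit_set_swap.
by rewrite !vA // exit_set_swap.
Qed.

Lemma exit_time_eq a b : v a (m a) = v b (m b).
Proof. by rewrite -(exit_swap a b) swp_m tpermL. Qed.

(** The swap of [a] and [b] fixes the ground state of [c] and exchanges the two exit times. *)
Lemma exit_generator_eq a b c : c != a -> c != b ->
  generator r (v a) (m c) = generator r (v b) (m c).
Proof.
move=> ca cb; have := generator_swap a b (v b) (m c); rewrite swp_m tpermD 1?eq_sym // => <-.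
by apply: eq_bigr => y _; rewrite !exit_swap.
Qed.

(* [w] is a combination of constants and of all the [v a]: at a ground state [m b] the generators of
   the [v a], [a != b], coincide by symmetry, so that they cancel. *)
Lemma target_time c : exists w : V -> R,
  [/\ forall x, x \in [set m c]%SET -> w x = 0,
      forall x, x \notin [set m c]%SET -> generator r w x = -1 &
      forall a, a != c -> w (m a) = (q%:R - 1) * v a (m a)].
Proof.
pose T := v c (m c); have TE a : v a (m a) = T by apply: exit_time_eq.
(* The constant is chosen so that the value at [m c], namely [T - (q - 1) * T + (q - 2) * T],
   vanishes. *)
exists (fun x => \sum_a v a x - ((q%:R - 1) * v c x - (q%:R - 2) * T)).
have v0 a b : a != b -> v a (m b) = 0.
  by move=> ab; apply: vA; rewrite !inE (inj_eq m_inj) eq_sym ab imset_f.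
have sumv b : \sum_a v a (m b) = T.
  by rewrite (bigD1 b) //= TE big1 ?addr0 // => a /v0.
split=> [x|x|a ac]; rewrite ?inE.
- by move=> /eqP ->; rewrite sumv TE; ring.
- move=> xc; have gE : generator r (fun y => \sum_a v a y - ((q%:R - 1) * v c y - (q%:R - 2) * T)) x =
      \sum_a generator r (v a) x - (q%:R - 1) * generator r (v c) x.
    rewrite /generator exchange_big mulr_sumr -sumrB; apply: eq_bigr => y _ /=.
    by rewrite -mulr_sumr sumrB; ring.
  rewrite gE; have [/imsetP[b _ xb]|xS] := boolP (x \in S).
    subst x; have cb : c != b by rewrite eq_sym -(inj_eq m_inj).
    rewrite (bigD1 b) //= vL ?inE ?eqxx //.
    rewrite (eq_bigr (fun=> generator r (v c) (m b))) => [|a ab]; last first.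
      by apply: exit_generator_eq; rewrite eq_sym.
    have qE : q.-1%:R = q%:R - 1 :> R by rewrite -subn1 natrB // ltnW.
    by rewrite sumr_const cardC1 card_ord -[_ *+ q.-1]mulr_natl qE addrK.
  rewrite (eq_bigr (fun=> -1)) => [|a _]; last by rewrite vL // inE negb_and xS orbT.
  by rewrite vL ?inE ?negb_and ?xS ?orbT // sumr_const card_ord -[_ *+ q]mulr_natl; ring.
- by rewrite sumv TE v0 1?eq_sym //; ring.
Qed.

End MeanTimes.


Lemma asymptotic_fin (R : realType) (f : R -> \bar R) (u g : R -> R) : (forall beta, f beta = (u beta)%:E) ->
  (forall beta, g beta != 0)%R -> (u beta / g beta @[beta --> +oo] --> (1 : R))%R%classic -> asymptotic f g.
Proof.
move=> fu g0 lim; exists (fun beta => u beta / g beta - 1)%R.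
  by rewrite -(subrr (1 : R)%R); apply: cvgB => //; exact: cvg_cst.
by apply: nearW => beta; rewrite fu addrC subrK divfK.
Qed.

(** * The constant kappa and its bounds *)

Section PottsMean.
Variables (R : realType) (q K L M s : nat).
Hypotheses (q2 : 2 <= q) (KL : K <= L) (LM : L <= M) (s5 : 5 <= s) (sK : 100 * s ^ 2 <= K).
Local Open Scope ring_scope.
Local Open Scope classical_set_scope.
Local Notation conf := (config q K L M).
Local Notation H := (@hamiltonian q K L M).
Local Notation mono := (@monochromatic q K L M).
Local Notation N := (K * L * M)%N.
Local Notation ground := (ground_states q K L M).
Implicit Types (a b : 'I_q) (sigma zeta : conf) (beta : R).

Let K3 : (2 < K)%N. Proof. by move: s5 sK; clear; nia. Qed.
Let L3 : (2 < L)%N. Proof. exact: leq_trans KL. Qed.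
Let M3 : (2 < M)%N. Proof. exact: leq_trans LM. Qed.

Definition potts_capacity a : R :=
  sharp_capacity R (@flip q K L M) H (ground :\ mono a)%SET (mono a) (Gamma K L).

Let lo : R := 2 * (#|lexpaths K L M| * q.-1)%:R / (\sum_(n < N) multiplicity K L M n)%N%:R.
Let up : R := 2 * (#|lexpaths K L M| * q.-1 * N)%:R * (profile K s K L M N)%:R^-1 ^+ 2.

Lemma orders_gt0 : (0 < orders K L M)%N.
Proof.
move: KL LM; rewrite (leq_eqVlt K) (leq_eqVlt L) => /orP[/eqP e1|lt1] /orP[/eqP e2|lt2].
- by rewrite orders_cube // e1 e2 eqxx.
- by rewrite orders_pair // e1 eqxx lt2.
- by rewrite orders_pair // lt1 e2 eqxx orbT.
- by rewrite orders_distinct // lt1 lt2.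
Qed.

Let volume_gt0 : (0 < N)%N.
Proof. by rewrite !muln_gt0 (ltn_trans _ K3) ?(ltn_trans _ L3) ?(ltn_trans _ M3). Qed.

Let lex_gt0 : (0 < #|lexpaths K L M| * q.-1)%N.
Proof.
rewrite card_lexpaths // !muln_gt0 orders_gt0 /=; move: volume_gt0; rewrite !muln_gt0 => -> /=.
by rewrite -subn1 subn_gt0.
Qed.

Let mult_gt0 : (0 < \sum_(n < N) multiplicity K L M n)%N.
Proof.
rewrite (bigD1 (Ordinal volume_gt0)) //= addn_gt0 /multiplicity; by case: ifP.
Qed.

Let lo_gt0 : 0 < lo.
Proof. by rewrite divr_gt0 ?mulr_gt0 ?ltr0n. Qed.

Lemma low_dirichlet0 f : low_dirichlet (@flip q K L M) H (Gamma K L) 0 f = low_form f :> R.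
Proof.
apply: eq_bigr => sigma _; apply: eq_bigr => zeta _.
by rewrite /low geq_max; case: ifP => // _; rewrite mul0r expR0 mul1r.
Qed.

Let exit_set a : {set conf} := (ground :\ mono a)%SET.

Let mono_exit a : mono a \notin exit_set a.
Proof. by rewrite !inE eqxx. Qed.

Let exit_mono a b : b != a -> mono b \in exit_set a.
Proof. by move=> ba; rewrite !inE (inj_eq (@mono_inj q K L M)) ba imset_f. Qed.

Let outside_pos a sigma : sigma \notin exit_set a -> sigma != mono a -> (0 < H sigma)%N.
Proof.
move=> sA sa; rewrite lt0n; apply: contraNneq sA => /hamiltonian_eq0 h.
by rewrite !inE sa h.
Qed.

Let lo_low a (f : conf -> R) : admissible (exit_set a) (mono a) f ->
  lo <= low_dirichlet (@flip q K L M) H (Gamma K L) 0 f.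
Proof.
move=> [fs fA _]; rewrite low_dirichlet0; apply: (low_form_lower K3 L3 M3 fs) => b ba.
exact/fA/exit_mono.
Qed.

Let test_admissible a : admissible (exit_set a) (mono a) (test_conf R s a).
Proof.
split; [exact: test_conf_same| |by move=> x; exact: test_conf_01].
by move=> x; rewrite !inE => /andP[xa /imsetP[b _ e]]; rewrite e test_conf_other // -(inj_eq (@mono_inj q K L M)) -e.
Qed.

Let test_up a : low_dirichlet (@flip q K L M) H (Gamma K L) 0 (test_conf R s a) <= up.
Proof. by rewrite low_dirichlet0; apply: test_conf_form. Qed.

Let test_flat a sigma zeta : flip sigma zeta -> (maxn (H sigma) (H zeta) <= Gamma K L)%N ->
  test_conf R s a sigma = test_conf R s a zeta \/ maxn (H sigma) (H zeta) = Gamma K L.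
Proof.
move=> sz; rewrite geq_max => /andP[h1 h2].
have := @test_conf_step R q K L M s a KL LM s5 sK sigma zeta.
rewrite /low sz h1 h2 => /(_ isT)[->|[-> -> _ _]]; first by left.
by right; rewrite maxnn.
Qed.

Lemma potts_capacity_bounds a : lo <= potts_capacity a <= up.
Proof.
exact: (sharp_capacity_bounds (mono_exit a) (@lo_low a) (test_admissible a) (test_up a) (@test_flat a)).
Qed.

(** By [mean_exit_cvg] the rescaled exit time tends to [2 / potts_capacity a], which has to be
    [kappa / (q - 1)]. *)
Let kappa a : R := 2 * (q%:R - 1) / potts_capacity a.

Let cap_gt0 a : 0 < potts_capacity a.
Proof. by apply: lt_le_trans lo_gt0 _; case/andP: (potts_capacity_bounds a). Qed.

Let qE : q.-1%:R = q%:R - 1 :> R.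
Proof. by rewrite -subn1 natrB // ltnW. Qed.

Let q1_gt0 : 0 < q%:R - 1 :> R.
Proof. by rewrite subr_gt0 ltr1n. Qed.

Lemma kappa_gt0 a : 0 < kappa a.
Proof. by rewrite divr_gt0 ?mulr_gt0. Qed.

(** The two bounds for the capacity place [8 * orders * kappa] between [(p / N) ^ 2] and [S / N],
    where [p] counts the steep volumes and [S] sums the multiplicities. *)
Lemma kappa_close a : `|8 * (orders K L M)%:R * kappa a - 1| <= 12 / s%:R.
Proof.
have /andP[l u] := potts_capacity_bounds a.
have := @profile_ratio R K L M s KL LM s5 sK; have := @multiplicity_ratio R K L M s KL LM s5 sK.
set S := (\sum_(n < _) _)%:R; set p := (profile _ _ _ _ _ _)%:R => mr pr.
have S0 : 0 < S by rewrite ltr0n.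
have n0 : 0 < N%:R :> R by rewrite ltr0n.
have p0 : 0 < p by rewrite ltr0n; apply: profile_gt0 => //; exact: leq_trans LM.
have o0 : 0 < (orders K L M)%:R :> R by rewrite ltr0n orders_gt0.
set o : R := (orders K L M)%:R in o0 *; set n : R := N%:R in n0 mr pr.
have c0 := cap_gt0 a; set c := potts_capacity a in l u c0 *.
have {}l : 2 * (8 * o * n * (q%:R - 1)) / S <= c.
  by move: l; rewrite /lo card_lexpaths // 3!natrM qE.
have {}u : c <= 2 * (8 * o * n * (q%:R - 1) * n) * p^-1 ^+ 2.
  by move: u; rewrite /up card_lexpaths // 4!natrM qE.
clearbody o n p S; rewrite ler_distl; apply/andP; split.
  apply: le_trans pr _; rewrite /kappa -/c mulrA ler_pdivlMr //.
  apply: le_trans (ler_wpM2l (sqr_ge0 _) u) _; rewrite le_eqVlt; apply/orP; left; apply/eqP.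
  by field; rewrite !gt_eqF.
apply: le_trans mr; rewrite /kappa -/c mulrA ler_pdivrMr //.
apply: le_trans (ler_wpM2l _ l); last by rewrite divr_ge0 ?ltW.
rewrite le_eqVlt; apply/orP; left; apply/eqP; by field; rewrite !gt_eqF.
Qed.

Lemma potts_mean_times a0 (C : forall beta sigma, markov_chain (@metropolis_rate R q K L M beta) sigma) a c :
  a != c ->
  asymptotic (fun beta => mean_hitting_time (C beta (mono a)) (exit_set a))
    (fun beta => kappa a0 / (q%:R - 1) * expR ((Gamma K L)%:R * beta)) /\
  asymptotic (fun beta => mean_hitting_time (C beta (mono a)) [set mono c]%SET)
    (fun beta => kappa a0 * expR ((Gamma K L)%:R * beta)).
Proof.
move=> ac; pose r beta := @metropolis_rate R q K L M beta.
have rE beta : r beta = metropolis (@flip q K L M) H beta by apply: metropolis_rateE.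
have r0 beta x y : 0 <= r beta x y by rewrite rE metropolis_ge0.
have conn := @flip_connected q K L M.
have irr beta : irreducible_rates (r beta) by rewrite rE; apply: (metropolis_irreducible conn).
have ne b : exists x, x \in exit_set b.
  have [e eb] : exists e, e != b.
    have [ab|ab] := eqVneq a b; last by exists a.
    by exists c; rewrite -ab eq_sym.
  by exists (mono e); apply: exit_mono.
have /choice[v vP] : forall beta, exists v : 'I_q -> conf -> R, forall b,
    (forall x, x \in exit_set b -> v b x = 0) /\ (forall x, x \notin exit_set b -> generator (r beta) (v b) x = -1).
  move=> beta; have /choice[v vP] : forall b, exists u : conf -> R, (forall x, x \in exit_set b -> u x = 0) /\
      (forall x, x \notin exit_set b -> generator (r beta) u x = -1).
    by move=> b; apply: (dirichlet_problem (r0 beta) (irr beta) (fun=> -1) (ne b)).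
  by exists v.
have vA beta b x : x \in exit_set b -> v beta b x = 0 by case: (vP beta b) => h _; apply: h.
have vL beta b x : x \notin exit_set b -> generator (r beta) (v beta b) x = -1.
  by case: (vP beta b) => _; apply.
have solution_ge0 beta (A : {set conf}) u : (exists x, x \in A) -> (forall x, x \in A -> u x = 0) ->
    (forall x, x \notin A -> generator (r beta) u x = -1) -> forall x, 0 <= u x.
  move=> A0 uA uL; apply: (min_principle (r0 beta) (irr beta) A0) => x xA; last by rewrite uA.
  by rewrite uL // lerN10.
(* One reference spin [a0] defines [kappa]; symmetry transfers the exit time from [a]. *)
have teq beta : v beta a (mono a) = v beta a0 (mono a0).
  exact: (exit_time_eq (r0 beta) (irr beta) q2 (@swapK q K L M) (@mono_inj q K L M)
    (@swap_mono q K L M) (@swap_rate q K L M R beta) (vA beta) (vL beta)).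
have lim : v beta a (mono a) / expR ((Gamma K L)%:R * beta) @[beta --> +oo] --> 2 / potts_capacity a0.
  under eq_fun do rewrite teq.
  apply: (mean_exit_cvg (@flipC q K L M) conn (mono_exit a0) (hamiltonian_mono K L M a0)
    (@outside_pos a0) (@lo_low a0) (test_admissible a0) (test_up a0) lo_gt0 (@test_flat a0)
    (v := fun beta => v beta a0)) => [beta x|beta x xA]; first exact: vA.
  by rewrite -rE vL.
have c0 := cap_gt0 a0; have e0 beta : expR ((Gamma K L)%:R * beta) != 0 by rewrite gt_eqF ?expR_gt0.
have kE : 1 = 2 / potts_capacity a0 * ((q%:R - 1) / kappa a0).
  by rewrite /kappa; field; rewrite !gt_eqF.
have k0 := kappa_gt0 a0.
split.
  apply: (@asymptotic_fin _ _ (fun beta => v beta a (mono a))) => [beta|beta|].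
  - apply: (mean_hitting_timeE _ (mono_exit a) _ (vA beta a) (vL beta a)).
    exact: (solution_ge0 beta (exit_set a) _ (ne a) (vA beta a) (vL beta a)).
  - by rewrite mulf_neq0 // gt_eqF // divr_gt0.
  - have -> : (fun beta => v beta a (mono a) / (kappa a0 / (q%:R - 1) * expR ((Gamma K L)%:R * beta))) =
        (fun beta => v beta a (mono a) / expR ((Gamma K L)%:R * beta) * ((q%:R - 1) / kappa a0)).
      by apply/funext => beta; field; rewrite e0 !gt_eqF.
    by rewrite [X in _ --> X]kE; apply: cvgMl.
apply: (@asymptotic_fin _ _ (fun beta => (q%:R - 1) * v beta a (mono a))) => [beta|beta|].
- have [w [wA wL wE]] := target_time (r0 beta) (irr beta) q2 (@swapK q K L M) (@mono_inj q K L M)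
    (@swap_mono q K L M) (@swap_rate q K L M R beta) (vA beta) (vL beta) c.
  rewrite -wE //; apply: (mean_hitting_timeE _ _ _ wA wL); first by rewrite inE (inj_eq (@mono_inj q K L M)).
  by apply: (solution_ge0 beta _ _ _ wA wL); exists (mono c); rewrite inE.
- by rewrite mulf_neq0 // gt_eqF.
- have -> : (fun beta => (q%:R - 1) * v beta a (mono a) / (kappa a0 * expR ((Gamma K L)%:R * beta))) =
      (fun beta => v beta a (mono a) / expR ((Gamma K L)%:R * beta) * ((q%:R - 1) / kappa a0)).
    by apply/funext => beta; field; rewrite e0 !gt_eqF.
  by rewrite [X in _ --> X]kE; apply: cvgMl.
Qed.

End PottsMean.

Local Open Scope ring_scope.

Definition potts_kappa (R : realType) (q K L M : nat) (a : 'I_q) : R :=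
  2 * (q%:R - 1) / potts_capacity R K L M a.

Lemma potts_kappa_limit (R : realType) (q o : nat) (a : 'I_q) (D : nat -> nat -> nat -> bool) :
  (2 <= q)%N -> (0 < o)%N ->
  (forall K L M, D K L M -> [/\ (K <= L)%N, (L <= M)%N & orders K L M = o]) ->
  limit_along D (fun K L M => potts_kappa R K L M a) (1 / (8 * o%:R)).
Proof.
(* The error [12 / s] of [kappa_close] falls below [e], and [K >= 100 * s ^ 2] is a condition on [K]
   alone, whence uniformity in [L] and [M]. *)
move=> q2 o0 hD e e0; set s := maxn 5 (Num.trunc (12 / e)).+1.
have s5 : (5 <= s)%N by apply: leq_maxl.
have hs : 12 / e < s%:R.
  by apply: lt_le_trans (truncnS_gt _) _; rewrite ler_nat leq_maxr.
exists (100 * s ^ 2)%N => // K /= sK L M /hD[KL LM ok].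
have := kappa_close R q2 KL LM s5 sK a; rewrite ok -/(potts_kappa R K L M a).
move: (potts_kappa _ _ _ _ _) => k close.
have o1 : 1 <= o%:R :> R by rewrite ler1n.
have o8 : 0 < 8 * o%:R :> R by rewrite mulr_gt0 // (lt_le_trans ltr01).
have -> : k - 1 / (8 * o%:R) = (8 * o%:R * k - 1) / (8 * o%:R).
  by field; rewrite gt_eqF // (lt_le_trans ltr01).
rewrite normrM normfV (gtr0_norm o8) ltr_pdivrMr //; apply: le_lt_trans close _.
have s0 : 0 < s%:R :> R by rewrite ltr0n (leq_trans _ s5).
rewrite ltr_pdivrMr //; move: hs; rewrite ltr_pdivrMr // => hs.
by apply: lt_le_trans hs _; rewrite mulrC -subr_ge0; have := mulr_ge0 (ltW e0) (ltW s0); nra.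
Qed.

Theorem theorem2p10 (R : realType) (q : nat) (hq : (2 <= q)%N) :
  exists kappa : nat -> nat -> nat -> R,
    (forall K L M : nat, (2829 <= K)%N -> (K <= L)%N -> (L <= M)%N ->
       0 < kappa K L M /\
       forall (C : forall (beta : R) (sigma : config q K L M),
                 markov_chain (@metropolis_rate R q K L M beta) sigma)
              (s s' : config q K L M),
         s \in ground_states q K L M -> s' \in ground_states q K L M ->
         s != s' ->
         asymptotic
           (fun beta => mean_hitting_time (C beta s) (ground_states q K L M :\ s)%SET)
           (fun beta => kappa K L M / (q%:R - 1) * expR ((Gamma K L)%:R * beta))
         /\
         asymptotic
           (fun beta => mean_hitting_time (C beta s) [set s']%SET)
           (fun beta => kappa K L M * expR ((Gamma K L)%:R * beta)))
    /\ limit_along (fun K L M => (K < L < M)%N) kappa (1 / 8)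
    /\ limit_along (fun K L M => ((K == L) && (L < M)%N) || ((K < L)%N && (L == M))) kappa (1 / 16)
    /\ limit_along (fun K L M => (K == L) && (L == M)) kappa (1 / 48).
Proof.
pose a := Ordinal (ltnW hq); exists (fun K L M => potts_kappa R K L M a).
have lim := @potts_kappa_limit R q _ a _ hq.
split=> [K L M K0 KL LM|].
  (* For a fixed triple the smallest parameter [s = 5] suffices, and [100 * 5 ^ 2 = 2500]. *)
  have sK : (100 * 5 ^ 2 <= K)%N by apply: leq_trans K0.
  split=> [|C s s' /imsetP[b _ ->] /imsetP[c _ ->] bc]; first exact: (kappa_gt0 R hq KL LM (leqnn 5) sK).
  by apply: (potts_mean_times hq KL LM (leqnn 5) sK); apply: contraNneq bc => ->.
split; [|split].
- rewrite (_ : 1 / 8 = 1 / (8 * 1%:R)); last by rewrite mulr1.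
  apply: lim => // K L M /andP[h1 h2].
  by split; [exact: ltnW|exact: ltnW|apply: orders_distinct; rewrite h1].
- rewrite (_ : 1 / 16 = 1 / (8 * 2%:R)); last by lra.
  by apply: lim => // K L M h; rewrite orders_pair //; split=> //; lia.
- rewrite (_ : 1 / 48 = 1 / (8 * 6%:R)); last by lra.
  by apply: lim => // K L M h; rewrite orders_cube //; split=> //; lia.
Qed.
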